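(* Let $C$ be a $\lambda\mu$-context with holes $\xi_1,\dots,\xi_n$, and let $\mathcal X_1,\dots,\mathcal X_n$ be non-empty bounded sets of $\lambda\mu$-terms. Then for all $\lambda\mu$-terms $M_1,\dots,M_n$ such that $\mathrm{NF}(\mathcal T(M_i))=\bigcap_{N\in\mathcal X_i}\mathrm{NF}(\mathcal T(N))$ for each $i=1,\dots,n$, we have $$\mathrm{NF}(\mathcal T(C[M_1,\dots,M_n]))=\bigcap_{N_1\in\mathcal X_1}\cdots\bigcap_{N_n\in\mathcal X_n}\mathrm{NF}(\mathcal T(C[N_1,\dots,N_n])).$$
   Context: Fix disjoint countably infinite sets of variables and names. $\lambda\mu$-terms and contexts. - $\lambda\mu$-terms: $M::=x\mid\lambda x.M\mid MM\mid\mu\alpha.{}_\beta|M|$, up to renaming of bound variables and names. - Contexts with holes $\xi_1,\dots,\xi_n$: $C::=x\mid\xi_i\mid\lambda x.C\mid CC\mid\mu\alpha.{}_\beta|C|$. $C[M_1,\dots,M_n]$ replaces every occurrence of $\xi_i$ by $M_i$. Resource terms and sums. - Resource terms: $t::=x\mid\lambda x.t\mid t[t_1,\dots,t_n]\mid\mu\alpha.{}_\beta|t|$, with bags finite multisets; $1$ is the empty bag and $*$ is union. - Sums are finite sets with idempotent $+$ and empty sum $0$; constructors extend multilinearly, and $0$ annihilates. - A weak composition (w.c.) of a bag $B$ is a tuple of possibly empty bags whose union is $B$. Linear substitution $t\langle B/x\rangle$: - $x\langle[v]/x\rangle=v$, and $x\langle B/x\rangle=0$ otherwise. - For $y\ne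 x$: $y\langle1/x\rangle=y$, and $y\langle B/x\rangle=0$ if $B\ne1$. - It commutes with $\lambda y$ and with $\mu\alpha.{}_\beta|\cdot|$. - $(t[v_1..v_n])\langle B/x\rangle=\sum_{(B_0..B_n)\text{ w.c.}}t\langle B_0/x\rangle[v_i\langle B_i/x\rangle]_i$. Linear named application $\langle t\rangle_\alpha B$: - $\langle x\rangle_\alpha1=x$, and $\langle x\rangle_\alpha B=0$ if $B\ne1$. - It commutes with $\lambda y$ and with $\mu\gamma$. - $\langle{}_\eta|t|\rangle_\alpha B={}_\eta|\langle t\rangle_\alpha B|$ ($\eta\ne\alpha$), and $\langle{}_\alpha|t|\rangle_\alpha B=\sum_{(B_1,B_2)\text{ w.c.}}{}_\alpha|(\langle t\rangle_\alpha B_1)B_2|$. - $\langle t[v_1..v_n]\rangle_\alpha B=\sum_{(B_0..B_n)}(\langle t\rangle_\alpha B_0)[\langle v_i\rangle_\alpha B_i]_i$. Resource reduction. $\to_r$ is the closure under single-hole resource contexts of $(\lambda x.t)B\to t\langle B/x\rangle$, $(\mu\alpha.{}_\beta|t|)B\to\mu\alpha.\langle{}_\beta|t|\rangle_\alpha B$, and $\mu\gamma.{}_\alpha|\mu\beta.{}_\eta|t||\to\mu\gamma.({}_\eta|t|)\{\alpha/\beta\}$ (renaming free $\beta$ into $\alpha$), extended to sums by $t+\mathcal S\to_r\mathcal T+\mathcal S$ if $t\to_r\mathcal T$ and $t\notin\mathcal S$. It is confluent and strongly normalising; $\mathrm{nf}_r(t)$ is the normal form of $t$. Taylor expansion. -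 $\mathcal T(x)=\{x\}$, $\mathcal T(\lambda x.M)=\{\lambda x.t\mid t\in\mathcal T(M)\}$, $\mathcal T(\mu\alpha.{}_\beta|M|)=\{\mu\alpha.{}_\beta|t|\mid t\in\mathcal T(M)\}$. - $\mathcal T(MN)=\{t[u_1..u_n]\mid t\in\mathcal T(M),n\ge0,u_i\in\mathcal T(N)\}$. - $\mathrm{NF}(\mathcal T(M))=\bigcup_{t\in\mathcal T(M)}\mathrm{nf}_r(t)$. - $M\le N$ iff $\mathrm{NF}(\mathcal T(M))\subseteq\mathrm{NF}(\mathcal T(N))$. - A set $\mathcal X$ of $\lambda\mu$-terms is bounded iff there is a $\lambda\mu$-term $L$ with $M\le L$ for all $M\in\mathcal X$. *)

(* Defs.v *)
From mathcomp Require Import all_boot.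
From mathcomp Require Import boolp classical_sets.
From Stdlib Require List.
From Stdlib Require Import Relations.Relation_Operators.

Set Implicit Arguments.
Unset Strict Implicit.
Unset Printing Implicit Defensive.

(** Variables and names are both [nat] (disjoint, since the syntax keeps them
    apart).  Terms up to renaming of bound variables and names are de Bruijn
    terms, with one index space for variables and one for names: under [d]
    binders, the free variable (or name) [k] is written [k + d].  This is a
    bijection with alpha-classes of named terms, so alpha-equivalence is
    Leibniz equality and no well-scopedness condition is needed. *)

Definition up (f : nat -> nat) (k : nat) : nat :=
  if k is j.+1 then (f j).+1 else 0.

(** Renaming that turns the free [x] into the innermost bound index: the term
    [lambda x. M] of the named syntax is [Lam (ren (abs x) id M)]. *)
Definition abs (x k : nat) : nat := if k == x then 0 else k.+1.

(** Renaming that replaces the innermost bound index by [a]. *)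
Definition inst (a k : nat) : nat := if k is j.+1 then j else a.

(** [Mu b M] is [mu alpha. _beta|M|], with both [b] and [M] in the scope of the
    binder [alpha]: [b = 0] when [beta = alpha], [b = k.+1] when [beta] is the
    outer name [k]. *)
Inductive term : Type :=
| Var of nat
| Lam of term
| App of term & term
| Mu of nat & term.

Fixpoint ren (f g : nat -> nat) (M : term) : term :=
  match M with
  | Var x => Var (f x)
  | Lam M => Lam (ren (up f) g M)
  | App M N => App (ren f g M) (ren f g N)
  | Mu b M => Mu (up g b) (ren f (up g) M)
  end.

(** Filling a hole may capture, so contexts are not taken up to renaming: their
    binders carry the actual variable or name.  [CMu a b C] is [mu a. _b|C|]. *)
Inductive ctx (n : nat) : Type :=
| CVar of nat
| CHole of 'I_n
| CLam of nat & ctx n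
| CApp of ctx n & ctx n
| CMu of nat & nat & ctx n.

Fixpoint fill (n : nat) (C : ctx n) (M : 'I_n -> term) : term :=
  match C with
  | CVar x => Var x
  | CHole i => M i
  | CLam x C => Lam (ren (abs x) id (fill C M))
  | CApp C D => App (fill C M) (fill D M)
  | CMu a b C => Mu (abs a b) (ren id (abs a) (fill C M))
  end.

(** Bags are lists, identified up to (hereditary) permutation by [req]. *)
Inductive rterm : Type :=
| RVar of nat
| RLam of rterm
| RApp of rterm & seq rterm
| RMu of nat & rterm.

Notation bag := (seq rterm).

Inductive req : rterm -> rterm -> Prop :=
| req_var x : req (RVar x) (RVar x)
| req_lam t t' : req t t' -> req (RLam t) (RLam t')
| req_app t t' B B' : req t t' -> beq B B' -> req (RApp t B) (RApp t' B')
| req_mu b t t' : req t t' -> req (RMu b t) (RMu b t')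
with beq : bag -> bag -> Prop :=
| beq_nil : beq [::] [::]
| beq_cons t t' B B1 B2 :
    req t t' -> beq B (B1 ++ B2) -> beq (t :: B) (B1 ++ t' :: B2).

(** A sum is a list of terms, read as the finite set of the [req]-classes of its
    elements: order and repetitions are irrelevant, [+] is [++] and [0] is
    [[::]]. *)
Notation rsum := (seq rterm).

Definition smem (s : rterm) (S : rsum) : Prop :=
  exists2 s', List.In s' S & req s s'.

Definition sum_eq (S T : rsum) : Prop := forall s, smem s S <-> smem s T.

Fixpoint rren (f g : nat -> nat) (t : rterm) : rterm :=
  match t with
  | RVar x => RVar (f x)
  | RLam t => RLam (rren (up f) g t)
  | RApp t B => RApp (rren f g t) [seq rren f g v | v <- B]
  | RMu b t => RMu (up g b) (rren f (up g) t)
  end.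

(** Weakening of a bag under a [lambda], resp. a [mu]. *)
Definition shiftv (B : bag) : bag := [seq rren succn id v | v <- B].
Definition shiftn (B : bag) : bag := [seq rren id succn v | v <- B].

(** Weak compositions of a bag into two parts, resp. [n] parts, listed with
    repetitions (harmless since sums are idempotent). *)
Fixpoint splits (B : bag) : seq (bag * bag) :=
  if B is v :: B' then
    [seq (v :: p.1, p.2) | p <- splits B'] ++ [seq (p.1, v :: p.2) | p <- splits B']
  else [:: ([::], [::])].

Fixpoint wcomps (n : nat) (B : bag) : seq (seq bag) :=
  if n is n'.+1 then [seq p.1 :: Bs | p <- splits B, Bs <- wcomps n' p.2]
  else if B is [::] then [:: [::]] else [::].

(** Multilinear extension of bag formation to sums. *)
Fixpoint bag_of_sums (Ss : seq rsum) : seq bag :=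
  if Ss is U :: Ss' then [seq u :: us | u <- U, us <- bag_of_sums Ss']
  else [:: [::]].

(** Sum over the weak compositions [(B_0, ..., B_n)] of [B] of the applications
    [(f B_0)[f_1 B_1, ..., f_n B_n]], where [fs] lists [f_1, ..., f_n]. *)
Definition distr_app (f : bag -> rsum) (fs : seq (bag -> rsum)) (B : bag) : rsum :=
  flatten
    [seq [seq RApp u us | u <- f (head [::] Bs),
            us <- bag_of_sums [seq p.1 p.2 | p <- zip fs (behead Bs)]]
       | Bs <- wcomps (size fs).+1 B].

(** Linear substitution [t<B/x>] for the variable of index [k]; as that variable
    is the one bound by the contracted [lambda], the indices above [k] are
    lowered. *)
Fixpoint lsubst (k : nat) (B : bag) (t : rterm) : rsum :=
  match t with
  | RVar y =>
      if y == k then (if B is [:: v] then [:: v] else [::])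
      else (if B is [::] then [:: RVar (unbump k y)] else [::])
  | RLam t => [seq RLam u | u <- lsubst k.+1 (shiftv B) t]
  | RMu b t => [seq RMu b u | u <- lsubst k (shiftn B) t]
  | RApp t vs =>
      distr_app (fun B' => lsubst k B' t)
                [seq (fun B' => lsubst k B' v) | v <- vs] B
  end.

(** Bodies of the named terms in [<_b|t|>_a B], where [f B'] is [<t>_a B']; the
    outer name is always [b]. *)
Definition named_lapp (f : bag -> rsum) (a b : nat) (B : bag) : rsum :=
  if b == a then flatten [seq [seq RApp u p.2 | u <- f p.1] | p <- splits B]
  else f B.

(** Linear named application [<t>_a B]. *)
Fixpoint lapp (a : nat) (B : bag) (t : rterm) : rsum :=
  match t with
  | RVar x => if B is [::] then [:: RVar x] else [::]
  | RLam t => [seq RLam u | u <- lapp a (shiftv B) t]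
  | RMu b t =>
      [seq RMu b u |
         u <- named_lapp (fun B' => lapp a.+1 B' t) a.+1 b (shiftn B)]
  | RApp t vs =>
      distr_app (fun B' => lapp a B' t)
                [seq (fun B' => lapp a B' v) | v <- vs] B
  end.

Inductive rstep : rterm -> rsum -> Prop :=
| rstep_lam t B : rstep (RApp (RLam t) B) (lsubst 0 B t)
| rstep_mu b t B :
    rstep (RApp (RMu b t) B)
          [seq RMu b u | u <- named_lapp (fun B' => lapp 0 B' t) 0 b (shiftn B)]
| rstep_rho a e t :
    rstep (RMu a (RMu e t)) [:: RMu (inst a e) (rren id (inst a) t)]
| rstep_inlam t T : rstep t T -> rstep (RLam t) [seq RLam u | u <- T]
| rstep_inmu b t T : rstep t T -> rstep (RMu b t) [seq RMu b u | u <- T]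
| rstep_infun t T B : rstep t T -> rstep (RApp t B) [seq RApp u B | u <- T]
| rstep_inbag t v V B1 B2 :
    rstep v V ->
    rstep (RApp t (B1 ++ v :: B2)) [seq RApp t (B1 ++ u :: B2) | u <- V].

Definition sum_step (S S' : rsum) : Prop :=
  exists t T R,
    [/\ rstep t T, ~ smem t R, sum_eq S (t :: R) & sum_eq S' (T ++ R)].

Definition sum_normal (S : rsum) : Prop := forall S', ~ sum_step S S'.

Local Open Scope classical_set_scope.

(** The elements of the normal form of [t], which is unique up to [sum_eq] by
    confluence.  Like all sets of resource terms below, this set is closed under
    [req], hence amounts to a set of terms whose bags are multisets. *)
Definition nf (t : rterm) : set rterm :=
  [set s | exists S, [/\ clos_refl_trans rsum sum_step [:: t] S,
                         sum_normal S & smem s S]].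

Fixpoint taylor (M : term) : set rterm :=
  match M with
  | Var x => [set RVar x]
  | Lam M => [set RLam t | t in taylor M]
  | App M N =>
      [set s | exists t B, [/\ taylor M t, List.Forall (taylor N) B
                             & s = RApp t B]]
  | Mu b M => [set RMu b t | t in taylor M]
  end.

Definition NFT (M : term) : set rterm := \bigcup_(t in taylor M) nf t.

Definition term_le (M N : term) : Prop := NFT M `<=` NFT N.

Definition bounded_terms (X : set term) : Prop :=
  exists L, forall M, X M -> term_le M L.

(* Main.v *)
Require Import Defs.
From HB Require Import structures.
From mathcomp Require Import all_boot.
From mathcomp Require Import boolp classical_sets.
From mathcomp Require Import zify.
From Stdlib Require Import Relations.Relation_Operators.

(** The proof rests on two facts about resource terms.

    Confluence: the normal form of an application, an abstraction or a
    [mu]-abstraction can be computed by normalising its immediate subterms first,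
    so [NFT (App M N)] only depends on [NFT M] and [NFT N], and so on.  Linear
    substitution, linear named application and renaming of names are all
    instances of one linear substitution [sub], whose composition law gives every
    commutation needed for local confluence.

    Uniformity (Ehrhard and Regnier): two elements of a Taylor expansion are
    coherent, i.e. they only differ by the sizes of their bags; reduction
    preserves coherence, and two coherent terms with a common element in their
    normal forms are equal.

    By induction on [C], an element [s] of all the [NFT (fill C N)] comes, for
    each [N], from normal forms of the immediate subterms.  These are all in
    [NFT (fill D L)], where [L] bounds the sets [X i] and [D] is a subcontext of
    [C], so they are coherent; by uniformity they do not depend on [N], and the
    induction hypothesis applies to them. *)

Set Implicit Arguments.
Unset Strict Implicit.
Unset Printing Implicit Defensive.

(** * Linear substitution of tagged resources *)

(** Sums are idempotent, and a contraction can produce several summands or none, so confluence is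
    argued element by element. [Nf t u] says that the normal term [u] is reached from [t] along some
    branch, and confluence becomes: contracting any redex of [t] loses none of these [u]. Two
    notions then suffice, reachability of one summand ([red]) and reduction of all summands into a
    set ([covered]).

    For the same reason substitution is a relation between a term, a list of resources and one
    summand of the result: a weak composition is a permutation onto a concatenation, and the sum 0
    is the absence of a related term. An environment holds tags in place of the resources, so the
    resources of two successive substitutions stay apart, and exchanging the two substitutions
    amounts to exchanging their tags.

    Since bags are lists, the argument up to uniqueness of normal forms deals with raw terms, where
    only lists of resources are permuted; [req] is brought in afterwards, by showing that reduction
    respects it. *)

HB.instance Definition _ := gen_eqMixin rterm.

Lemma rterm_ind_in (P : rterm -> Prop) :
  (forall x, P (RVar x)) -> (forall t, P t -> P (RLam t)) ->
  (forall t (vs : seq rterm), P t -> (forall v, v \in vs -> P v) -> P (RApp t vs)) ->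
  (forall b t, P t -> P (RMu b t)) -> forall t, P t.
Proof.
move=> Hvar Hlam Happ Hmu; fix IH 1; case=> [x|t|t vs|b t].
- exact: Hvar.
- exact/Hlam/IH.
- apply: (Happ); first exact: IH.
  have: List.Forall P vs by elim: vs => [|v vs IHvs]; constructor; [exact: IH|].
  clear; elim: vs => // v vs IHvs /List.Forall_cons_iff[Pv /IHvs Pvs] w.
  by rewrite inE => /predU1P[->|/Pvs].
- exact/Hmu/IH.
Qed.

Lemma forall_in_cons (U : eqType) (P : U -> Prop) x s :
  (forall v, v \in x :: s -> P v) -> P x /\ (forall v, v \in s -> P v).
Proof.
by move=> h; split=> [|v vs]; apply: h; rewrite inE ?eqxx // vs orbT.
Qed.

(** A permutation is an equality of all counts, so consequences of several permutations of
    concatenations are linear arithmetic. *)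
Ltac perm_count :=
  let p := fresh "p" in
  apply/permP; intro p;
  repeat match goal with
  | H : is_true (perm_eq _ _) |- _ =>
      let H' := fresh in pose proof (elimT permP H p) as H'; cbv beta in H'; clear H
  end;
  repeat match goal with H : count p _ = count p _ |- _ => revert H end;
  rewrite ?(map_cat, count_cat) /= ?(map_cat, count_cat); lia.

(** * Lists up to permutation *)

Section PermExtra.
Variables (T U : eqType).
Implicit Types (R A B : seq T).

Lemma perm_cons_catP (x : T) R A B : perm_eq (x :: R) (A ++ B) ->
  (exists2 A', perm_eq A (x :: A') & perm_eq R (A' ++ B)) \/
  (exists2 B', perm_eq B (x :: B') & perm_eq R (A ++ B')).
Proof.
move=> H; have: x \in A ++ B by rewrite -(perm_mem H) mem_head.
rewrite mem_cat => /orP[xA|xB]; [left; exists (rem x A)|right; exists (rem x B)].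
- exact: perm_to_rem.
- by have := perm_to_rem xA => HA; perm_count.
- exact: perm_to_rem.
- by have := perm_to_rem xB => HA; perm_count.
Qed.

(** Two splittings of one multiset have a common refinement, the two-by-two table of the [C]s. This
    is the associativity of weak compositions on which the composition law rests. *)
Lemma perm_cat_catP A1 A2 B1 B2 : perm_eq (A1 ++ A2) (B1 ++ B2) ->
  exists C11 C12 C21 C22,
    [/\ perm_eq A1 (C11 ++ C12), perm_eq A2 (C21 ++ C22),
        perm_eq B1 (C11 ++ C21) & perm_eq B2 (C12 ++ C22)].
Proof.
elim: A1 B1 B2 => [|x A1 IH] B1 B2 /= H.
  by exists [::], [::], B1, B2.
case: (perm_cons_catP H) => -[D HD] /IH [C11 [C12 [C21 [C22 [h1 h2 h3 h4]]]]].
- by exists (x :: C11), C12, C21, C22; split=> //; perm_count.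
- by exists C11, (x :: C12), C21, C22; split=> //; perm_count.
Qed.

Lemma perm_map_exists (f : T -> U) R (R' : seq U) :
  perm_eq (map f R) R' -> exists2 R1, perm_eq R R1 & R' = map f R1.
Proof.
elim: R R' => [|x R IH] R' H.
  by exists [::] => //; apply/perm_nilP; rewrite perm_sym.
have fxR : f x \in R' by rewrite -(perm_mem H) mem_head.
case/splitPr: fxR H => A B H.
have /IH [R1 h1 h2] : perm_eq (map f R) (A ++ B) by perm_count.
have E1 : A = map f (take (size A) R1).
  by rewrite map_take -h2 take_size_cat.
have E2 : B = map f (drop (size A) R1).
  by rewrite map_drop -h2 drop_size_cat.
exists (take (size A) R1 ++ x :: drop (size A) R1); last by rewrite map_cat /= -E1 -E2.
by rewrite -(cat_take_drop (size A) R1) in h1; perm_count.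
Qed.

Lemma perm_map_cat (f : T -> U) R (A B : seq U) :
  perm_eq (map f R) (A ++ B) ->
  exists R1 R2, [/\ perm_eq R (R1 ++ R2), A = map f R1 & B = map f R2].
Proof.
move=> /perm_map_exists[R1 h E].
exists (take (size A) R1), (drop (size A) R1); rewrite cat_take_drop.
by rewrite map_take map_drop -E take_size_cat // drop_size_cat.
Qed.

End PermExtra.

Lemma perm_map_cat2 (T1 T2 U : eqType) (f : T1 -> U) (g : T2 -> U) R Q (A B : seq U) :
  perm_eq (map f R ++ map g Q) (A ++ B) ->
  exists R1 R2 Q1 Q2, [/\ perm_eq R (R1 ++ R2), perm_eq Q (Q1 ++ Q2),
    perm_eq A (map f R1 ++ map g Q1) & perm_eq B (map f R2 ++ map g Q2)].
Proof.
move=> /perm_cat_catP [C11 [C12 [C21 [C22 [h1 h2 h3 h4]]]]].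
have [R1 [R2 [hR E1 E2]]] := perm_map_cat h1.
have [Q1 [Q2 [hQ E3 E4]]] := perm_map_cat h2.
by exists R1, R2, Q1, Q2; rewrite -E1 -E2 -E3 -E4.
Qed.

Lemma rren_comp f g f' g' t :
  rren f g (rren f' g' t) = rren (f \o f') (g \o g') t.
Proof.
have upE h h' : up h \o up h' = up (h \o h') by apply/funext; case.
elim/rterm_ind_in: t f g f' g' => [x|t IH|t vs IH IHvs|b t IH] f g f' g' //=.
- by rewrite IH upE.
- rewrite IH -map_comp; congr RApp; apply/eq_in_map => v vs_v /=; exact: IHvs.
- by rewrite IH upE; congr RMu; case: b.
Qed.

Lemma up_id : up id = id. Proof. by apply/funext; case. Qed.

Lemma rren_id t : rren id id t = t.
Proof.
elim/rterm_ind_in: t => [x|t IH|t vs IH IHvs|b t IH] //=; rewrite ?up_id ?IH //.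
by congr RApp; rewrite -[RHS]map_id; apply/eq_in_map => v /IHvs.
Qed.

(** [ev s x] is either the new index of [x] or the tag of the resources that may
    replace it; the subterms named [b] are renamed and applied to one bag for
    each tag of [(en s b).2]. *)
Record env (T : Type) := Env { ev : nat -> nat + T; en : nat -> nat * seq T }.

(** Tags have no free variables, so lifting leaves them alone; the resources themselves are weakened
    separately, by [rmap] on the list [R]. The new bound variable or name is fixed and receives no
    resource. *)
Definition upv T (s : env T) : env T :=
  Env (fun k => if k is j.+1 then
                  match ev s j with inl y => inl y.+1 | inr c => inr c end
                else inl 0)
      (en s).
Definition upn T (s : env T) : env T :=
  Env (ev s)
      (fun k => if k is j.+1 then ((en s j).1.+1, (en s j).2) else (0, [::])).

Definition rmap T f g (R : seq (T * rterm)) := [seq (p.1, rren f g p.2) | p <- R].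
Definition tagl T (c : T) (B : seq rterm) := [seq (c, v) | v <- B].

(** [R'] may keep resources tagged [c]: if [c] occurs again in the list of tags, its resources are
    shared out among the corresponding bags in every possible way. *)
Fixpoint appl (T : eqType) (l : seq T) (R : seq (T * rterm)) (t w : rterm) : Prop :=
  if l is c :: l' then
    exists B R', perm_eq R (tagl c B ++ R') /\ appl l' R' (RApp t B) w
  else R = [::] /\ w = t.

(** [w] is one summand of the substitution of [R] in [t]. Linearity is the requirement that [R] be
    used up: it is empty at a variable left in place and a singleton at a variable that is replaced.
    The inner [fix] and the pair [c'] are spelled out so that these clauses are convertible to
    [subl] and [subc]. *)
Fixpoint sub (T : eqType) (s : env T) (R : seq (T * rterm)) (t w : rterm) : Prop :=
  match t with
  | RVar x => match ev s x with
              | inl y => R = [::] /\ w = RVar y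
              | inr c => R = [:: (c, w)]
              end
  | RLam t => exists2 u, sub (upv s) (rmap succn id R) t u & w = RLam u
  | RApp t vs =>
      exists u us, w = RApp u us /\ exists R1 R2,
        [/\ perm_eq R (R1 ++ R2), sub s R1 t u &
         (fix subl (R : seq (T * rterm)) (vs us : seq rterm) : Prop :=
            match vs, us with
            | [::], [::] => R = [::]
            | v :: vs, u :: us => exists R1 R2,
                [/\ perm_eq R (R1 ++ R2), sub s R1 v u & subl R2 vs us]
            | _, _ => False
            end) R2 vs us]
  | RMu b t => exists c', (exists R1 R2 u,
      [/\ perm_eq (rmap id succn R) (R1 ++ R2), sub (upn s) R1 t u,
          appl (en (upn s) b).2 R2 u c'.2 & c'.1 = (en (upn s) b).1])
      /\ w = RMu c'.1 c'.2
  end.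

Definition subl (T : eqType) (s : env T) :=
  fix subl (R : seq (T * rterm)) (vs us : seq rterm) : Prop :=
    match vs, us with
    | [::], [::] => R = [::]
    | v :: vs, u :: us => exists R1 R2,
        [/\ perm_eq R (R1 ++ R2), sub s R1 v u & subl R2 vs us]
    | _, _ => False
    end.

(** The clause of linear named application for a named term: [R1] goes inside the body, [R2] into
    the bags to which the body is then applied. *)
Definition subc (T : eqType) (s : env T) R (c c' : nat * rterm) : Prop :=
  exists R1 R2 u,
    [/\ perm_eq R (R1 ++ R2), sub s R1 c.2 u,
        appl (en s c.1).2 R2 u c'.2 & c'.1 = (en s c.1).1].

Lemma sub_app (T : eqType) (s : env T) R t vs w :
  sub s R (RApp t vs) w =
  exists u us, w = RApp u us /\ subl s R (t :: vs) (u :: us).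
Proof. by []. Qed.

Lemma sub_mu (T : eqType) (s : env T) R b t w :
  sub s R (RMu b t) w =
  exists c', subc (upn s) (rmap id succn R) (b, t) c' /\ w = RMu c'.1 c'.2.
Proof. by []. Qed.

Lemma rmap_perm (T : eqType) f g (R Q : seq (T * rterm)) :
  perm_eq R Q -> perm_eq (rmap f g R) (rmap f g Q).
Proof. exact: perm_map. Qed.

Section Sub.
Variable T : eqType.
Implicit Types (s : env T) (R Q : seq (T * rterm)).

Lemma appl_perm l R R' t w : perm_eq R R' -> appl l R t w -> appl l R' t w.
Proof.
case: l => [|c l] /=.
  by move=> /[swap] -[-> ->]; rewrite perm_sym => /perm_nilP ->.
by move=> h [B [R2 [h2 h3]]]; exists B, R2; split=> //; perm_count.
Qed.

Lemma sub_perm s R R' t w : perm_eq R R' -> sub s R t w -> sub s R' t w.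
Proof.
elim/rterm_ind_in: t s R R' w => [x|t IH|t vs IH IHvs|b t IH] s R R' w h.
- move=> /=; case: (ev s x) => [y|c].
    by case=> E ->; move: h; rewrite E perm_sym => /perm_nilP ->.
  by move=> E; move: h; rewrite E perm_sym => /(perm_small_eq (s2:=[:: (c, w)]) isT).
- by move=> [u hu ->]; exists u => //; apply: IH hu; apply: rmap_perm.
- by move=> [u [us [-> [R1 [R2 [h1 h2 h3]]]]]]; exists u, us; split=> //; exists R1, R2; split=> //; perm_count.
- move=> [c [[R1 [R2 [u [h1 h2 h3 h4]]]] ->]]; exists c; split=> //; exists R1, R2, u; split=> //.
  by have := rmap_perm id succn h => h'; perm_count.
Qed.

Lemma subl_perm s R R' vs us : perm_eq R R' -> subl s R vs us -> subl s R' vs us.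
Proof.
case: vs us => [|v vs] [|u us] //= h.
  by move=> E; move: h; rewrite E perm_sym => /perm_nilP.
by move=> [R1 [R2 [h1 h2 h3]]]; exists R1, R2; split=> //; perm_count.
Qed.

Lemma subc_perm s R R' c c' : perm_eq R R' -> subc s R c c' -> subc s R' c c'.
Proof.
by move=> h [R1 [R2 [u [h1 h2 h3 h4]]]]; exists R1, R2, u; split=> //; perm_count.
Qed.

Lemma subl_cat s R1 R2 vs1 vs2 us1 us2 :
  subl s R1 vs1 us1 -> subl s R2 vs2 us2 -> subl s (R1 ++ R2) (vs1 ++ vs2) (us1 ++ us2).
Proof.
elim: vs1 us1 R1 => [|v vs1 IH] [|u us1] R1 //=; first by move=> ->.
move=> [Q1 [Q2 [h1 h2 h3]]] h; exists Q1, (Q2 ++ R2); split=> //; first by perm_count.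
exact: IH.
Qed.

Lemma subl_catP s R vs1 vs2 us : subl s R (vs1 ++ vs2) us ->
  exists us1 us2 R1 R2, [/\ us = us1 ++ us2, perm_eq R (R1 ++ R2),
    subl s R1 vs1 us1 & subl s R2 vs2 us2].
Proof.
elim: vs1 us R => [|v vs1 IH] us R /=; first by exists [::], us, [::], R.
case: us => [|u us] // [R1 [R2 [h1 h2 /IH [us1 [us2 [Q1 [Q2 [-> h3 h4 h5]]]]]]]].
exists (u :: us1), us2, (R1 ++ Q1), Q2; split=> //; first by perm_count.
by exists R1, Q1.
Qed.

Lemma subl_catr s R vs us1 us2 : subl s R vs (us1 ++ us2) ->
  exists vs1 vs2 R1 R2, [/\ vs = vs1 ++ vs2, perm_eq R (R1 ++ R2),
    subl s R1 vs1 us1 & subl s R2 vs2 us2].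
Proof.
elim: us1 vs R => [|u us1 IH] vs R /=; first by exists [::], vs, [::], R.
case: vs => [|v vs] // [R1 [R2 [h1 h2 /IH [vs1 [vs2 [Q1 [Q2 [-> h3 h4 h5]]]]]]]].
exists (v :: vs1), vs2, (R1 ++ Q1), Q2; split=> //; first by perm_count.
by exists R1, Q1.
Qed.

Lemma sub_app_intro s R1 R2 R t vs u us :
  perm_eq R (R1 ++ R2) -> sub s R1 t u -> subl s R2 vs us -> sub s R (RApp t vs) (RApp u us).
Proof. by move=> h1 h2 h3; rewrite sub_app; exists u, us; split=> //; exists R1, R2. Qed.

Lemma sub_appP s R t vs w : sub s R (RApp t vs) w ->
  exists u us R1 R2, [/\ w = RApp u us, perm_eq R (R1 ++ R2), sub s R1 t u & subl s R2 vs us].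
Proof. by rewrite sub_app => -[u [us [-> [R1 [R2 [h1 h2 h3]]]]]]; exists u, us, R1, R2. Qed.

Lemma sub_muP s R b t w : sub s R (RMu b t) w ->
  exists2 c', subc (upn s) (rmap id succn R) (b, t) c' & w = RMu c'.1 c'.2.
Proof. by rewrite sub_mu => -[c [h ->]]; exists c. Qed.

Lemma sub_mu_intro s R b t c' :
  subc (upn s) (rmap id succn R) (b, t) c' -> sub s R (RMu b t) (RMu c'.1 c'.2).
Proof. by rewrite sub_mu => h; exists c'. Qed.

End Sub.

(** * Substitution before and after a renaming *)

Definition pree T (s : env T) f g : env T := Env (ev s \o f) (en s \o g).
Definition poste T f g (s : env T) : env T :=
  Env (fun x => match ev s x with inl y => inl (f y) | inr c => inr c end)
      (fun b => (g (en s b).1, (en s b).2)).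

Section Ren.
Variable T : eqType.
Implicit Types (s : env T) (R Q : seq (T * rterm)).

Lemma upv_pree s f g : upv (pree s f g) = pree (upv s) (up f) g.
Proof. by congr Env; apply/funext; case. Qed.
Lemma upn_pree s f g : upn (pree s f g) = pree (upn s) f (up g).
Proof. by congr Env; apply/funext; case. Qed.
Lemma upv_poste s f g : upv (poste f g s) = poste (up f) g (upv s).
Proof. by congr Env; apply/funext; case=> //= j; case: (ev s j). Qed.
Lemma upn_poste s f g : upn (poste f g s) = poste f (up g) (upn s).
Proof. by congr Env; apply/funext; case. Qed.
(** Substituting under the binder in a weakened term is weakening the result of the substitution.
    [subR_ren] and [subR_renP] take an equation of this form to move resources across a binder. *)
Lemma upv_shift s : pree (upv s) succn id = poste succn id s.
Proof. by congr Env; apply/funext => x //=; case: (en s x). Qed.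
Lemma upn_shift s : pree (upn s) id succn = poste id succn s.
Proof. by congr Env; apply/funext => x //=; case: (ev s x). Qed.

Lemma rmap_upv f g R : rmap succn id (rmap f g R) = rmap (up f) g (rmap succn id R).
Proof. by rewrite /rmap -!map_comp; apply: eq_map => -[c v] /=; rewrite !rren_comp. Qed.
Lemma rmap_upn f g R : rmap id succn (rmap f g R) = rmap f (up g) (rmap id succn R).
Proof. by rewrite /rmap -!map_comp; apply: eq_map => -[c v] /=; rewrite !rren_comp. Qed.

Lemma sub_pree s R f g t w : sub s R (rren f g t) w <-> sub (pree s f g) R t w.
Proof.
elim/rterm_ind_in: t s R f g w => [x|t IH|t vs IH IHvs|b t IH] s R f g w //.
- rewrite /= upv_pree.
  by split=> -[u /IH h ->]; exists u.
- have IHl R2 us : subl s R2 (map (rren f g) vs) us <-> subl (pree s f g) R2 vs us.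
    elim: vs IHvs R2 us => [|v vs IHl] /= IHvs R2 [|u us] //=.
    have [Hv /IHl Hl] := forall_in_cons IHvs.
    by split=> -[R3 [R4 [h1 /Hv h2 /Hl h3]]]; exists R3, R4.
  split=> /= /sub_appP[u [us [R1 [R2 [-> h1 /IH h2 /IHl h3]]]]].
    exact: (sub_app_intro h1).
  exact: (sub_app_intro h1).
- rewrite [rren _ _ _]/= !sub_mu upn_pree.
  by split=> -[c [[R1 [R2 [u [h1 /IH h2 h3 h4]]]] ->]]; exists c; split=> //;
    exists R1, R2, u.
Qed.

Lemma subc_pree s R f g b t c' :
  subc s R (g b, rren f g t) c' <-> subc (pree s f g) R (b, t) c'.
Proof.
by split=> -[R1 [R2 [u [h1 h2 h3 h4]]]]; exists R1, R2, u; split=> //; apply/sub_pree.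
Qed.

Lemma appl_poste l R t w f g :
  appl l R t w -> appl l (rmap f g R) (rren f g t) (rren f g w).
Proof.
elim: l R t => [|c l IH] R t /=; first by move=> [-> ->].
move=> [B [R' [h1 /IH h2]]]; exists (map (rren f g) B), (rmap f g R'); split=> //.
have := rmap_perm f g h1; rewrite /rmap map_cat.
by rewrite /tagl -!map_comp.
Qed.

Lemma appl_posteP l R t w' f g :
  appl l (rmap f g R) (rren f g t) w' ->
  exists2 w, w' = rren f g w & appl l R t w.
Proof.
elim: l R t => [|c l IH] R t /=.
  by case: R => [|? ?] [] // _ ->; exists t.
move=> [B [R' [/perm_map_cat [R1 [R2 [h1 h2 ->]]] h3]]].
have [E1 E2] : B = map (rren f g) (map snd R1) /\ R1 = tagl c (map snd R1).
  elim: R1 B h2 {h1 h3} => [|[d v] R1 IH'] [|v' B] //= [<- -> /IH'[<- {1}->]].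
  by [].
rewrite E1 in h3; have [w -> hw] := IH R2 (RApp t (map snd R1)) h3.
by exists w => //; exists (map snd R1), R2; split=> //; rewrite -E2.
Qed.

Lemma sub_poste s R f g t w :
  sub s R t w -> sub (poste f g s) (rmap f g R) t (rren f g w).
Proof.
elim/rterm_ind_in: t s R f g w => [x|t IH|t vs IH IHvs|b t IH] s R f g w.
- by rewrite /=; case: (ev s x) => [y [-> ->]|c ->].
- by move=> /= [u h ->]; exists (rren (up f) g u) => //; rewrite rmap_upv upv_poste; exact: IH.
- move=> /sub_appP[u [us [R1 [R2 [-> h1 h2 h3]]]]] /=.
  apply: (@sub_app_intro _ _ (rmap f g R1) (rmap f g R2)); [|exact: IH|].
    by rewrite -map_cat; exact: rmap_perm.
  elim: vs us IHvs R2 h3 {h1} => [|v vs IHl] [|u' us] IHvs R2 //=; first by move=> ->.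
  have [Hv /IHl Hl] := forall_in_cons IHvs.
  move=> [R3 [R4 [h4 h5 h6]]]; exists (rmap f g R3), (rmap f g R4); split.
  + by rewrite -map_cat; exact: rmap_perm.
  + exact: Hv.
  + exact: Hl.
- rewrite !sub_mu upn_poste rmap_upn => -[c [[R1 [R2 [u [h1 h2 h3 h4]]]] ->]].
  exists (up g c.1, rren f (up g) c.2); split=> //.
  exists (rmap f (up g) R1), (rmap f (up g) R2), (rren f (up g) u); split.
  + by rewrite -map_cat; exact: rmap_perm.
  + exact: IH.
  + exact: appl_poste.
  + by rewrite /= h4.
Qed.

(** Everything that enters the result, from the environment or from the resources, is in the image
    of the renaming, so the renaming can be pulled out. This undoes the weakening of the resources
    at a binder. *)
Lemma sub_posteP s R f g t w' :
  sub (poste f g s) (rmap f g R) t w' ->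
  exists2 w, w' = rren f g w & sub s R t w.
Proof.
elim/rterm_ind_in: t s R f g w' => [x|t IH|t vs IH IHvs|b t IH] s R f g w'.
- rewrite /=; case: (ev s x) => [y [] |c].
    by case: R => [|? ?] // _ ->; exists (RVar y).
  by case: R => [|[d v] [|]] // [-> <-]; exists v.
- rewrite /= upv_poste rmap_upv => -[u /IH[w -> h] ->].
  by exists (RLam w) => //; exists w.
- move=> /sub_appP[u [us [R1 [R2 [-> /perm_map_cat[R3 [R4 [h1 -> ->]]] /IH[w -> hw] h3]]]]].
  suff [ws -> hws] : exists2 ws, us = map (rren f g) ws & subl s R4 vs ws.
    by exists (RApp w ws) => //; exact: (sub_app_intro h1).
  elim: vs us IHvs R4 h3 {h1} => [|v vs IHl] [|u' us] IHvs R4 //=.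
    by case: R4 => [|? ?] // _; exists [::].
  have [Hv /IHl Hl] := forall_in_cons IHvs.
  move=> [R5 [R6 [/perm_map_cat[R7 [R8 [h4 -> ->]]] /Hv[v' -> hv'] /Hl[ws -> hws]]]].
  by exists (v' :: ws) => //; exists R7, R8.
- rewrite sub_mu upn_poste rmap_upn.
  move=> -[c [[R1 [R2 [u [/perm_map_cat[R3 [R4 [h1 -> ->]]] /IH[w -> hw] /appl_posteP[w2 E2 hw2] h4]]]] ->]].
  exists (RMu (en (upn s) b).1 w2); first by rewrite h4 E2 /=.
  by exists ((en (upn s) b).1, w2); split=> //; exists R3, R4, w.
Qed.

(** A renaming is a substitution without tags. The commutation of reduction with [sub] thereby
    covers renamings, including the one performed by the third reduction rule. *)
Definition rene f g : env T := Env (inl \o f) (fun b => (g b, [::])).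

Lemma sub_rene f g R t w : sub (rene f g) R t w <-> R = [::] /\ w = rren f g t.
Proof.
have Eu f' g' : upv (rene f' g') = rene (up f') g' by congr Env; apply/funext; case.
have En f' g' : upn (rene f' g') = rene f' (up g') by congr Env; apply/funext; case.
elim/rterm_ind_in: t f g R w => [x|t IH|t vs IH IHvs|b t IH] f g R w //.
- rewrite /= Eu; split; first by move=> [u /IH[]]; case: R => [|? ?] // _ -> ->.
  by move=> [-> ->]; exists (rren (up f) g t) => //; exact/IH.
- have IHl R2 us : subl (rene f g) R2 vs us <-> R2 = [::] /\ us = map (rren f g) vs.
    elim: vs IHvs R2 us => [|v vs IHl] IHvs R2 [|u us] //=.
    + by split=> [|[]].
    + by split=> [|[]].
    + by split=> [|[]].
    + have [Hv /IHl Hl] := forall_in_cons IHvs; split.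
        by move=> [R3 [R4 [h1 /Hv[E1 ->] /Hl[E2 ->]]]];
          move: h1; rewrite E1 E2 => /perm_nilP ->.
      by move=> [-> [-> ->]]; exists [::], [::]; split=> //; [exact/Hv|exact/Hl].
  split.
    move=> /sub_appP[u [us [R1 [R2 [-> h1 /IH[E1 ->] /IHl[E2 ->]]]]]].
    by move: h1; rewrite E1 E2 => /perm_nilP ->.
  by move=> [-> ->]; apply: (@sub_app_intro _ _ [::] [::]) => //; [apply/IH|apply/IHl].
- rewrite sub_mu En; split.
    move=> [c [[R1 [R2 [u [h1 /IH[E1 ->] [E2 ->] ->]]]] ->]].
    move: h1; rewrite E1 E2 => /perm_nilP; case: R => //.
  move=> [-> ->]; exists (up g b, rren f (up g) t); split=> //.
  by exists [::], [::], (rren f (up g) t); split=> //; exact/IH.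
Qed.

End Ren.
Arguments rene {T} f g.

(** * Retagging and composition *)

(** The two orders of composing substitutions have tags in [T + U] and in [U + T]; retagging along
    [swap] compares them. Retagging along [unsigM] merges two tags. *)
Definition rete T U (phi : T -> U) (s : env T) : env U :=
  Env (fun x => match ev s x with inl y => inl y | inr c => inr (phi c) end)
      (fun b => ((en s b).1, map phi (en s b).2)).

Definition rtag T U (phi : T -> U) (R : seq (T * rterm)) :=
  [seq (phi p.1, p.2) | p <- R].

Section Retag.
Variables (T U : eqType) (phi : T -> U).
Implicit Types (s : env T) (R Q : seq (T * rterm)).

Lemma upv_rete s : upv (rete phi s) = rete phi (upv s).
Proof. by congr Env; apply/funext; case=> //= j; case: (ev s j). Qed.
Lemma upn_rete s : upn (rete phi s) = rete phi (upn s).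
Proof. by congr Env; apply/funext; case. Qed.

Lemma rmap_rtag f g R : rmap f g (rtag phi R) = rtag phi (rmap f g R).
Proof. by rewrite /rmap /rtag -!map_comp. Qed.

Lemma rtag_tagl (c : T) B : rtag phi (tagl c B) = tagl (phi c) B.
Proof. by rewrite /rtag /tagl -map_comp. Qed.

Lemma rtag_cat R Q : rtag phi (R ++ Q) = rtag phi R ++ rtag phi Q.
Proof. exact: map_cat. Qed.

Lemma rtag_perm R Q : perm_eq R Q -> perm_eq (rtag phi R) (rtag phi Q).
Proof. exact: perm_map. Qed.

Lemma rtag_rmapP f g R (Y : seq (U * rterm)) : rtag phi R = rmap f g Y ->
  exists2 Z, R = rmap f g Z & Y = rtag phi Z.
Proof.
elim: R Y => [|[c v] R IH] [|[d w] Y] //=; first by exists [::].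
by move=> [<- -> /IH[Z -> ->]]; exists ((c, w) :: Z).
Qed.

Lemma appl_rtag l R t w : appl l R t w -> appl (map phi l) (rtag phi R) t w.
Proof.
elim: l R t => [|c l IH] R t /=; first by move=> [-> ->].
move=> [B [R' [/rtag_perm h1 /IH h2]]]; exists B, (rtag phi R'); split=> //.
by move: h1; rewrite rtag_cat rtag_tagl.
Qed.

Lemma appl_rtagP l (R' : seq (U * rterm)) t w : appl (map phi l) R' t w ->
  exists2 R, perm_eq R' (rtag phi R) & appl l R t w.
Proof.
elim: l R' t => [|c l IH] R' t /=; first by move=> [-> ->]; exists [::].
move=> [B [R1 [h1 /IH[R2 h2 h3]]]]; exists (tagl c B ++ R2); last by exists B, R2.
by rewrite rtag_cat rtag_tagl; perm_count.
Qed.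

Lemma sub_rete s R t w : sub s R t w -> sub (rete phi s) (rtag phi R) t w.
Proof.
elim/rterm_ind_in: t s R w => [x|t IH|t vs IH IHvs|b t IH] s R w.
- by rewrite /=; case: (ev s x) => [y [-> ->]|c ->].
- by move=> /= [u /IH h ->]; exists u => //; rewrite rmap_rtag upv_rete.
- move=> /sub_appP[u [us [R1 [R2 [-> h1 h2 h3]]]]] /=.
  apply: (@sub_app_intro _ _ (rtag phi R1) (rtag phi R2)); [|exact: IH|].
    by rewrite -map_cat; exact: rtag_perm.
  elim: vs us IHvs R2 h3 {h1} => [|v vs IHl] [|u' us] IHvs R2 //=; first by move=> ->.
  have [Hv /IHl Hl] := forall_in_cons IHvs.
  move=> [R3 [R4 [h4 /Hv h5 /Hl h6]]]; exists (rtag phi R3), (rtag phi R4); split=> //.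
  by rewrite -map_cat; exact: rtag_perm.
- rewrite !sub_mu upn_rete rmap_rtag => -[c [[R1 [R2 [u [h1 h2 h3 h4]]]] ->]].
  exists c; split=> //; exists (rtag phi R1), (rtag phi R2), u; split=> //.
  + by rewrite -map_cat; exact: rtag_perm.
  + exact: IH.
  + exact: appl_rtag.
Qed.

(** [phi] may merge tags: each resource gets back the tag of the place where it is used, so [R] is
    read off the derivation. *)
Lemma sub_reteP s (R' : seq (U * rterm)) t w : sub (rete phi s) R' t w ->
  exists2 R, perm_eq R' (rtag phi R) & sub s R t w.
Proof.
elim/rterm_ind_in: t s R' w => [x|t IH|t vs IH IHvs|b t IH] s R' w.
- rewrite /=; case: (ev s x) => [y [-> ->]|c ->]; first by exists [::].
  by exists [:: (c, w)].
- rewrite /= upv_rete => -[u /IH[X h1 h2] ->].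
  have [R1 h3 /rtag_rmapP[Z EX EY]] := perm_map_exists h1.
  by exists Z; [rewrite -EY|exists u => //; rewrite -EX].
- move=> /sub_appP[u [us [R1 [R2 [-> h1 /IH[X1 h2 h3] h4]]]]].
  suff [X2 h5 h6] : exists2 X2, perm_eq R2 (rtag phi X2) & subl s X2 vs us.
    exists (X1 ++ X2); last exact: (@sub_app_intro _ _ X1 X2).
    by rewrite /rtag in h2 h5 *; perm_count.
  elim: vs us IHvs R2 h4 {h1} => [|v vs IHl] [|u' us] IHvs R2 //=; first by move=> ->; exists [::].
  have [Hv /IHl Hl] := forall_in_cons IHvs.
  move=> [R3 [R4 [h4 /Hv[Y1 h5 h5'] /Hl[Y2 h6 h6']]]].
  exists (Y1 ++ Y2); last by exists Y1, Y2.
  by rewrite /rtag in h6 h5 *; perm_count.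
- rewrite sub_mu upn_rete => -[c [[R1 [R2 [u [h1 /IH[X1 h2 h2'] /appl_rtagP[X2 h3 h3'] h4]]]] ->]].
  have /perm_map_exists[R3 h5 /rtag_rmapP[Z EX EY]] : perm_eq (rmap id succn R') (rtag phi (X1 ++ X2)).
    by rewrite /rtag in h2 h3 *; perm_count.
  exists Z; first by rewrite -EY.
  by rewrite sub_mu; exists c; split=> //; exists X1, X2, u; rewrite -EX.
Qed.

Lemma subc_rete s R c c' : subc s R c c' -> subc (rete phi s) (rtag phi R) c c'.
Proof.
move=> [R1 [R2 [u [h1 h2 h3 h4]]]]; exists (rtag phi R1), (rtag phi R2), u; split=> //.
+ by rewrite -map_cat; exact: rtag_perm.
+ exact: sub_rete.
+ exact: appl_rtag.
Qed.

Lemma subc_reteP s (R' : seq (U * rterm)) c c' : subc (rete phi s) R' c c' ->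
  exists2 R, perm_eq R' (rtag phi R) & subc s R c c'.
Proof.
move=> [R1 [R2 [u [h1 /sub_reteP[X1 h2 h2'] /appl_rtagP[X2 h3 h3'] h4]]]].
exists (X1 ++ X2); last by exists X1, X2, u.
by rewrite /rtag in h2 h3 *; perm_count.
Qed.

End Retag.

(** Substitution inside the resources of another substitution, [Q] being distributed over them and
    their tags kept: when [r] follows [s], resources of [r] can land in those that [s] has put in
    place. The last constructor makes the three lists multisets. *)
Inductive subR (T U : eqType) (s : env T) :
  seq (T * rterm) -> seq (U * rterm) -> seq (U * rterm) -> Prop :=
| subR_nil : subR s [::] [::] [::]
| subR_cons c v v' Q1 Q R R' : sub s Q1 v v' -> subR s Q R R' ->
    subR s (Q1 ++ Q) ((c, v) :: R) ((c, v') :: R')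
| subR_perm Q Q2 R R2 R' R2' : subR s Q R R' ->
    perm_eq Q Q2 -> perm_eq R R2 -> perm_eq R' R2' -> subR s Q2 R2 R2'.

Section SubR.
Variables (T U : eqType).
Implicit Types (s : env T) (Q : seq (T * rterm)) (R : seq (U * rterm)).

Lemma subR_cat s Q1 R1 R1' Q2 R2 R2' :
  subR s Q1 R1 R1' -> subR s Q2 R2 R2' -> subR s (Q1 ++ Q2) (R1 ++ R2) (R1' ++ R2').
Proof.
move=> h h2; elim: h => //= [c v v' Qa Q R R' hv _ IH|Q Qa R Ra R' Ra' _ IH p1 p2 p3].
  by rewrite -catA; exact: subR_cons.
by apply: subR_perm IH _ _ _; perm_count.
Qed.

Lemma subR_consr s Q R R' : subR s Q R R' -> forall c v' A, perm_eq R' ((c, v') :: A) ->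
  exists Q1 Q2 v R1, [/\ perm_eq R ((c, v) :: R1), perm_eq Q (Q1 ++ Q2),
    sub s Q1 v v' & subR s Q2 R1 A].
Proof.
elim=> [|c v v' Qa {}Q {}R {}R' hv hR IH|{}Q Qa {}R Ra {}R' Ra' _ IH p1 p2 p3] d w A.
- by move=> /perm_size.
- move=> /(@perm_cons_catP _ _ _ [:: _])[[A' h1 h2]|[A' h1 h2]].
    have /eqP : [:: (d, w)] = (c, v') :: A' by rewrite perm_sym in h1; move: (perm_small_eq (s2:=[:: (d, w)]) isT h1).
    rewrite eqseq_cons => /andP[/eqP [E1 E2] /eqP EA]; subst.
    exists Qa, Q, v, R; split=> //; apply: subR_perm hR _ _ _ => //.
  have [Q1 [Q2 [x [R1 [h3 h4 h5 h6]]]]] := IH _ _ _ h2.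
  exists Q1, (Qa ++ Q2), x, ((c, v) :: R1); split=> //; try perm_count.
  apply: subR_perm (subR_cons c hv h6) _ _ _ => //; by rewrite perm_sym.
- move=> h; have [|Q1 [Q2 [x [R1 [h3 h4 h5 h6]]]]] := IH d w A; first by perm_count.
  by exists Q1, Q2, x, R1; split=> //; perm_count.
Qed.

Lemma subR_consl s Q R R' : subR s Q R R' -> forall c v A, perm_eq R ((c, v) :: A) ->
  exists Q1 Q2 v' R1, [/\ perm_eq R' ((c, v') :: R1), perm_eq Q (Q1 ++ Q2),
    sub s Q1 v v' & subR s Q2 A R1].
Proof.
elim=> [|c v v' Qa {}Q {}R {}R' hv hR IH|{}Q Qa {}R Ra {}R' Ra' _ IH p1 p2 p3] d w A.
- by move=> /perm_size.
- move=> /(@perm_cons_catP _ _ _ [:: _])[[A' h1 h2]|[A' h1 h2]].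
    have /eqP : [:: (d, w)] = (c, v) :: A' by rewrite perm_sym in h1; move: (perm_small_eq (s2:=[:: (d, w)]) isT h1).
    rewrite eqseq_cons => /andP[/eqP [E1 E2] /eqP EA]; subst.
    exists Qa, Q, v', R'; split=> //; apply: subR_perm hR _ _ _ => //.
  have [Q1 [Q2 [x [R1 [h3 h4 h5 h6]]]]] := IH _ _ _ h2.
  exists Q1, (Qa ++ Q2), x, ((c, v') :: R1); split=> //; try perm_count.
  apply: subR_perm (subR_cons c hv h6) _ _ _ => //; by rewrite perm_sym.
- move=> h; have [|Q1 [Q2 [x [R1 [h3 h4 h5 h6]]]]] := IH d w A; first by perm_count.
  by exists Q1, Q2, x, R1; split=> //; perm_count.
Qed.

Lemma subR_nilr s Q R R' : subR s Q R R' -> R' = [::] -> R = [::] /\ Q = [::].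
Proof.
elim=> [|c v v' Qa {}Q {}R {}R' hv hR IH|{}Q Qa {}R Ra {}R' Ra' _ IH p1 p2 p3] // E.
have /IH[E1 E2] : R' = [::] by apply/perm_nilP; rewrite -E.
by move: p1 p2; rewrite E1 E2 2!(perm_sym [::]) => /perm_nilP -> /perm_nilP ->.
Qed.

Lemma subR_nill s Q R R' : subR s Q R R' -> R = [::] -> R' = [::] /\ Q = [::].
Proof.
elim=> [|c v v' Qa {}Q {}R {}R' hv hR IH|{}Q Qa {}R Ra {}R' Ra' _ IH p1 p2 p3] // E.
have /IH[E1 E2] : R = [::] by apply/perm_nilP; rewrite -E.
by move: p1 p3; rewrite E1 E2 2!(perm_sym [::]) => /perm_nilP -> /perm_nilP ->.
Qed.

Lemma subR_splitr s Q R R' A B : subR s Q R R' -> perm_eq R' (A ++ B) ->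
  exists Ra Rb Qa Qb, [/\ perm_eq R (Ra ++ Rb), perm_eq Q (Qa ++ Qb),
    subR s Qa Ra A & subR s Qb Rb B].
Proof.
elim: A Q R R' => [|[c v'] A IH] Q R R' h p.
  exists [::], R, [::], Q; split=> //; first exact: subR_nil.
  exact: subR_perm h _ _ p.
have [Q1 [Q2 [v [R1 [h3 h4 h5 h6]]]]] := subR_consr h p.
have [Ra [Rb [Qa [Qb [h7 h8 h9 h10]]]]] := IH _ _ _ h6 (perm_refl _).
exists ((c, v) :: Ra), Rb, (Q1 ++ Qa), Qb; split=> //; try perm_count.
exact: subR_cons.
Qed.

Lemma subR_tagl s Q (c : U) B B' : subl s Q B B' -> subR s Q (tagl c B) (tagl c B').
Proof.
elim: B B' Q => [|v B IH] [|v' B'] Q //=; first by move=> ->; exact: subR_nil.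
move=> [Q1 [Q2 [h1 h2 /IH h3]]]; apply: subR_perm (subR_cons c h2 h3) _ _ _ => //.
by rewrite perm_sym.
Qed.

Lemma subR_taglr s Q R (c : U) B' : subR s Q R (tagl c B') ->
  exists2 B, perm_eq R (tagl c B) & subl s Q B B'.
Proof.
elim: B' Q R => [|v' B' IH] Q R h.
  by have [-> ->] := subR_nilr h erefl; exists [::].
have [Q1 [Q2 [v [R1 [h3 h4 h5 /IH[B h6 h7]]]]]] := subR_consr h (perm_refl _).
by exists (v :: B); [rewrite /=; perm_count|exists Q1, Q2].
Qed.

Lemma subR_tagll s Q R' (c : U) B : subR s Q (tagl c B) R' ->
  exists2 B', perm_eq R' (tagl c B') & subl s Q B B'.
Proof.
elim: B Q R' => [|v B IH] Q R' h.
  by have [-> ->] := subR_nill h erefl; exists [::].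
have [Q1 [Q2 [v' [R1 [h3 h4 h5 /IH[B' h6 h7]]]]]] := subR_consl h (perm_refl _).
by exists (v' :: B'); [rewrite /=; perm_count|exists Q1, Q2].
Qed.

Lemma subR_ren s s' f g Q R R' : pree s' f g = poste f g s ->
  subR s Q R R' -> subR s' (rmap f g Q) (rmap f g R) (rmap f g R').
Proof.
move=> E; elim=> [|c v v' Qa {}Q {}R {}R' hv hR IH|{}Q Qa {}R Ra {}R' Ra' _ IH p1 p2 p3].
- exact: subR_nil.
- rewrite /rmap map_cat; apply: subR_cons => //.
  by apply/sub_pree; rewrite E; exact: sub_poste.
- by apply: subR_perm IH _ _ _; exact: rmap_perm.
Qed.

Lemma subR_renP s s' f g Q R R' : pree s' f g = poste f g s ->
  subR s' (rmap f g Q) (rmap f g R) R' ->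
  exists2 R1, perm_eq R' (rmap f g R1) & subR s Q R R1.
Proof.
move=> E; elim: R Q R' => [|[c v] R IH] Q R' h.
  have [-> /=] := subR_nill h erefl; case: Q {h} => // _; exists [::] => //; exact: subR_nil.
have [Q1 [Q2 [v' [R1 [h3 /perm_map_cat[Q3 [Q4 [h4 E3 E4]]] h5 h6]]]]] := subR_consl h (perm_refl _).
rewrite E4 in h6; have [R2 h7 h8] := IH _ _ h6.
move: h5; rewrite E3 => /sub_pree; rewrite E => /sub_posteP[v2 Ev hv2].
exists ((c, v2) :: R2); first by rewrite Ev in h3; rewrite /=; perm_count.
by apply: subR_perm (subR_cons c hv2 h8) _ _ _ => //; rewrite perm_sym.
Qed.

(** Used with [sigL_shift] and [sigM_shift]: resources weakened under a binder do not mention the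
    bound variable or name, so the substitution for it puts nothing into them and merely renames
    them. *)
Lemma subR_rene s f g f' g' Q R R' : pree s f g = rene f' g' ->
  subR s Q (rmap f g R) R' -> Q = [::] /\ perm_eq R' (rmap f' g' R).
Proof.
move=> E; elim: R Q R' => [|[c v] R IH] Q R' h.
  by have [-> ->] := subR_nill h erefl.
have [Q1 [Q2 [v' [R1 [h3 h4 h5 /IH[E2 h6]]]]]] := subR_consl h (perm_refl _).
move: h5 => /sub_pree; rewrite E => /sub_rene[E1 Ev].
split; first by apply/perm_nilP; rewrite E1 E2 in h4.
by rewrite Ev in h3; rewrite /=; perm_count.
Qed.

Lemma subR_rene_intro s f g f' g' R : pree s f g = rene f' g' ->
  subR s [::] (rmap f g R) (rmap f' g' R).
Proof.
move=> E; elim: R => [|[c v] R IH]; first exact: subR_nil.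
rewrite -[[::]]/([::] ++ [::]); apply: subR_cons => //.
by apply/sub_pree; rewrite E; apply/sub_rene.
Qed.

End SubR.

(** A name takes its bags from [s1], then those that [s2] gives to the new name, in this order
    because applications nest to the left. *)
Definition compe T1 T2 (s1 : env T1) (s2 : env T2) : env (T1 + T2) :=
  Env (fun x => match ev s1 x with
                | inl y => match ev s2 y with inl z => inl z | inr d => inr (inr d) end
                | inr c => inr (inl c)
                end)
      (fun b => let p := en s1 b in let q := en s2 p.1 in
                (q.1, map inl p.2 ++ map inr q.2)).

Section Appl.
Variable T : eqType.
Implicit Types (R : seq (T * rterm)).

Lemma appl_cat l1 l2 R1 R2 t u w :
  appl l1 R1 t u -> appl l2 R2 u w -> appl (l1 ++ l2) (R1 ++ R2) t w.
Proof.
move=> h h2; elim: l1 R1 t h => [|c l1 IH] R1 t /=; first by move=> [-> <-].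
by move=> [B [R [h1 /IH h3]]]; exists B, (R ++ R2); split=> //; perm_count.
Qed.

Lemma appl_catP l1 l2 R t w : appl (l1 ++ l2) R t w ->
  exists R1 R2 u, [/\ perm_eq R (R1 ++ R2), appl l1 R1 t u & appl l2 R2 u w].
Proof.
elim: l1 R t => [|c l1 IH] R t /=; first by exists [::], R, t.
move=> [B [R' [h1 /IH[R1 [R2 [u [h2 h3 h4]]]]]]].
exists (tagl c B ++ R1), R2, u; split=> //; first by perm_count.
by exists B, R1.
Qed.

End Appl.

Section ApplSub.
Variables (T U : eqType) (s : env T).
Implicit Types (Q : seq (T * rterm)) (R : seq (U * rterm)).

Lemma appl_sub l R u u' Q w : appl l R u u' -> sub s Q u' w ->
  exists Qa Qb R' v, [/\ perm_eq Q (Qa ++ Qb), sub s Qa u v, subR s Qb R R' & appl l R' v w].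
Proof.
elim: l R u => [|c l IH] R u /=.
  by move=> [-> ->] h; exists Q, [::], [::], w; rewrite cats0; split=> //; exact: subR_nil.
move=> [B [R1 [h1 h2]]] /(IH _ _ h2)[Qa [Qb [R1' [v [h3 /sub_appP[v0 [B' [Q1 [Q2 [-> h4 h5 h6]]]]] h7 h8]]]]].
exists Q1, (Q2 ++ Qb), (tagl c B' ++ R1'), v0; split=> //; first by perm_count.
  apply: subR_perm (subR_cat (subR_tagl c h6) h7) _ _ _ => //; by rewrite perm_sym.
by exists B', R1'.
Qed.

Lemma appl_subV l R R' u v Qa Qb Q w : appl l R' v w -> sub s Qa u v -> subR s Qb R R' ->
  perm_eq Q (Qa ++ Qb) -> exists2 u', appl l R u u' & sub s Q u' w.
Proof.
elim: l R R' u v Qa Qb => [|c l IH] R R' u v Qa Qb /=.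
  move=> [-> ->] h1 /subR_nilr[]// -> -> p; exists u => //.
  by apply: sub_perm h1; rewrite cats0 perm_sym in p *.
move=> [B' [R1' [h1 h2]]] h3 /subR_splitr /(_ h1)[Ra [Rb [Qc [Qd [h4 h5 /subR_taglr[B h6 h7] h8]]]]] p.
have [|u' h9 h10] := IH _ _ _ _ _ _ h2 (sub_app_intro (perm_refl _) h3 h7) h8.
  by perm_count.
by exists u' => //; exists B, Rb; split=> //; perm_count.
Qed.

End ApplSub.

Lemma perm_inl_inr (T U : eqType) (A A' : seq (T * rterm)) (B B' : seq (U * rterm)) :
  perm_eq (rtag inl A ++ rtag inr B) (rtag inl A' ++ rtag inr B') ->
  perm_eq A A' /\ perm_eq B B'.
Proof.
have cA p (X : seq (T * rterm)) (Y : seq (U * rterm)) :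
    count (fun z : (T + U) * rterm => if z.1 is inl c then p (c, z.2) else false)
      (rtag inl X ++ rtag inr Y) = count p X.
  rewrite count_cat !count_map [X in _ + X](@eq_count _ _ pred0) // count_pred0 addn0.
  by apply: eq_count => -[].
have cB p (X : seq (T * rterm)) (Y : seq (U * rterm)) :
    count (fun z : (T + U) * rterm => if z.1 is inr c then p (c, z.2) else false)
      (rtag inl X ++ rtag inr Y) = count p Y.
  rewrite count_cat !count_map [X in X + _](@eq_count _ _ pred0) // count_pred0 add0n.
  by apply: eq_count => -[].
move=> /permP h; split; apply/permP => p.
  by rewrite -(cA p A B) h cA.
by rewrite -(cB p A B) h cB.
Qed.

Section Comp.
Variables (T U : eqType).
Implicit Types (s : env T) (r : env U) (R : seq (T * rterm)) (Q : seq (U * rterm)).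

Notation both R Q := (rtag inl R ++ rtag inr Q).

Lemma upv_compe s r : upv (compe s r) = compe (upv s) (upv r).
Proof.
by congr Env; apply/funext; case=> //= j; case: (ev s j) => //= y; case: (ev r y).
Qed.
Lemma upn_compe s r : upn (compe s r) = compe (upn s) (upn r).
Proof. by congr Env; apply/funext; case. Qed.

(** Composition law: [(t<R>)<Q>] is the sum, over the weak compositions [(Q1, Q2)] of [Q], of the
    simultaneous substitutions [t<R<Q1>, Q2>]. This is one inclusion, [bwd] is the other. *)
Let fwd t := forall s r R Q u w, sub s R t u -> sub r Q u w ->
  exists Q1 Q2 R', [/\ perm_eq Q (Q1 ++ Q2), subR r Q1 R R' &
                       sub (compe s r) (both R' Q2) t w].

(** The law at [t] is taken as a premise so that this serves inside the induction that proves the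
    law as well as after it. *)
Let subc_comp_aux t : fwd t -> forall s r R Q b c1 c2,
  subc s R (b, t) c1 -> subc r Q c1 c2 ->
  exists Q1 Q2 R', [/\ perm_eq Q (Q1 ++ Q2), subR r Q1 R R' &
                       subc (compe s r) (both R' Q2) (b, t) c2].
Proof.
move=> IH s r R Q b [b1 u1] [b2 w'] [Ra [Rb [u /= [h1 h2 h3 E1]]]] [Qa [Qb [w /= [h4 h5 h6 E2]]]].
have [Qa1 [Qa2 [Rb' [v [h7 h8 h9 h10]]]]] := appl_sub h3 h5.
have [q1 [q2 [Ra' [h11 h12 h13]]]] := IH _ _ _ _ _ _ h2 h8.
exists (q1 ++ Qa2), (q2 ++ Qb), (Ra' ++ Rb'); split; first by perm_count.
  by apply: subR_perm (subR_cat h12 h9) _ _ _ => //; rewrite perm_sym.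
exists (both Ra' q2), (both Rb' Qb), v; split=> //=.
- by rewrite /rtag !map_cat; perm_count.
- rewrite -E1; exact: appl_cat (appl_rtag _ h10) (appl_rtag _ h6).
- by rewrite E2 E1.
Qed.

Lemma sub_comp t : fwd t.
Proof.
elim/rterm_ind_in: t => [x|t IH|t vs IH IHvs|b t IH] s r R Q u w.
- rewrite /=; case: (ev s x) => [y [-> ->]|c ->].
    move=> h; exists [::], Q, [::]; split=> //; first exact: subR_nil.
    by move: h => /=; case: (ev r y) => [z [-> ->]|d ->].
  move=> h; exists Q, [::], [:: (c, w)]; split=> //; first by rewrite cats0.
  by rewrite -[Q]cats0; apply: subR_cons => //; exact: subR_nil.
- move=> /= [u' h1 ->] [w' h2 ->].
  have [Q1 [Q2 [R' [/perm_map_cat[Q3 [Q4 [h3 -> ->]]] h4 h5]]]] := IH _ _ _ _ _ _ h1 h2.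
  have [R1 h6 h7] := subR_renP (upv_shift r) h4.
  exists Q3, Q4, R1; split=> //; exists w' => //.
  rewrite upv_compe; apply: sub_perm h5.
  by rewrite /rmap map_cat -!/(rmap _ _ _) !rmap_rtag perm_cat2r rtag_perm.
- move=> /sub_appP[u' [us [R1 [R2 [-> h1 h2 h3]]]]] /sub_appP[w' [ws [Q1 [Q2 [-> h4 h5 h6]]]]].
  have [q1 [q2 [R1' [h7 h8 h9]]]] := IH _ _ _ _ _ _ h2 h5.
  suff [q3 [q4 [R2' [h10 h11 h12]]]] : exists Q3 Q4 R', [/\ perm_eq Q2 (Q3 ++ Q4), subR r Q3 R2 R' &
                       subl (compe s r) (both R' Q4) vs ws].
    exists (q1 ++ q3), (q2 ++ q4), (R1' ++ R2'); split; first by perm_count.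
      by apply: subR_perm (subR_cat h8 h11) _ _ _ => //; rewrite perm_sym.
    apply: sub_app_intro h9 h12; rewrite /rtag; perm_count.
  clear -IHvs h3 h6.
  elim: vs us ws IHvs R2 Q2 h3 h6 => [|v vs IHl] [|u' us] [|w' ws] IHvs R2 Q2 //=.
    by move=> -> ->; exists [::], [::], [::]; split=> //; exact: subR_nil.
  have [Hv /IHl Hl] := forall_in_cons IHvs.
  move=> [R3 [R4 [h1 h2 h3]]] [Q3 [Q4 [h4 h5 h6]]].
  have [q1 [q2 [R1' [h7 h8 h9]]]] := Hv _ _ _ _ _ _ h2 h5.
  have [q3 [q4 [R2' [h10 h11 h12]]]] := Hl _ _ _ _ h3 h6.
  exists (q1 ++ q3), (q2 ++ q4), (R1' ++ R2'); split; first by perm_count.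
    by apply: subR_perm (subR_cat h8 h11) _ _ _ => //; rewrite perm_sym.
  exists (both R1' q2), (both R2' q4); split=> //; rewrite /rtag; perm_count.
- move=> /sub_muP[c1 h1 ->] /sub_muP[c2 h2 ->].
  have [Q1 [Q2 [R' [/perm_map_cat[Q3 [Q4 [h3 -> ->]]] h4 h5]]]] := subc_comp_aux IH h1 h2.
  have [R1 h6 h7] := subR_renP (upn_shift r) h4.
  exists Q3, Q4, R1; split=> //; apply: sub_mu_intro.
  rewrite upn_compe; apply: subc_perm h5.
  by rewrite /rmap map_cat -!/(rmap _ _ _) !rmap_rtag perm_cat2r rtag_perm.
Qed.

Lemma subc_comp s r R Q c c1 c2 : subc s R c c1 -> subc r Q c1 c2 ->
  exists Q1 Q2 R', [/\ perm_eq Q (Q1 ++ Q2), subR r Q1 R R' &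
                       subc (compe s r) (both R' Q2) c c2].
Proof. by case: c => b t; apply: subc_comp_aux; exact: sub_comp. Qed.

(** [X] and [Q] are constrained up to permutation only, since the recursive calls receive their
    lists in this form. *)
Let bwd t := forall s r X R' Q2 Q1 R Q w, sub (compe s r) X t w ->
  perm_eq X (both R' Q2) -> subR r Q1 R R' -> perm_eq Q (Q1 ++ Q2) ->
  exists2 u, sub s R t u & sub r Q u w.

Let subc_compV_aux t : bwd t -> forall s r X R' Q2 Q1 R Q b c2,
  subc (compe s r) X (b, t) c2 ->
  perm_eq X (both R' Q2) -> subR r Q1 R R' -> perm_eq Q (Q1 ++ Q2) ->
  exists2 c1, subc s R (b, t) c1 & subc r Q c1 c2.
Proof.
move=> IH s r X R' Q2 Q1 R Q b [b2 w'] [X1 [X2 [v /= [h1 h2 h3 E1]]]] h4 h5 h6.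
have /perm_map_cat2[Ra' [Rb' [Qa [Qb [p1 p2 p3 p4]]]]] : perm_eq (both R' Q2) (X1 ++ X2) by perm_count.
have [Y1 [Y2 [w [h7 /appl_rtagP[A pA hA] /appl_rtagP[B pB hB]]]]] := appl_catP h3.
have [pA' pB'] : perm_eq A Rb' /\ perm_eq B Qb.
  by apply: perm_inl_inr; rewrite -!/(rtag _ _) in p4; perm_count.
have [Ra [Rb [q1 [q2 [h8 h9 h10 h11]]]]] := subR_splitr h5 p1.
have [u h12 h13] := IH _ _ _ _ _ _ _ _ _ h2 p3 h10 (perm_refl _).
have [u' h14 h15] := appl_subV (appl_perm pA' hA) h13 h11 (perm_refl _).
exists ((en s b).1, u'); first by exists Ra, Rb, u.
exists ((q1 ++ Qa) ++ q2), Qb, w; split=> //; first by perm_count.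
exact: appl_perm pB' hB.
Qed.

Lemma both_nil R Q : [::] = both R Q -> R = [::] /\ Q = [::].
Proof. by case: R Q => [|? ?] [|? ?]. Qed.

Lemma sub_compV t : bwd t.
Proof.
elim/rterm_ind_in: t => [x|t IH|t vs IH IHvs|b t IH] s r X R' Q2 Q1 R Q w.
- rewrite /=; case: (ev s x) => [y|c] /=.
    case E: (ev r y) => [z|d].
      move=> [-> ->]; rewrite perm_sym => /perm_nilP/esym/both_nil[-> ->] /subR_nilr[]// -> -> /perm_nilP ->.
      by exists (RVar y) => //=; rewrite E.
    move=> ->; rewrite perm_sym => /(perm_small_eq (s2:=[:: _]) isT); case: R' => [|a R'] //= h.
      move=> /subR_nilr[]// -> -> /= p; exists (RVar y) => //=; rewrite E.
      case: Q2 h p => [|[d' w'] [|? ?]] // [<- <-] /(perm_small_eq (s2:=[:: _]) isT) //.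
  move=> ->; rewrite perm_sym => /(perm_small_eq (s2:=[:: _]) isT).
  case: R' => [|[d w1] [|a R']] /=; first by case: Q2.
    case: Q2 => // -[-> ->] h p.
    have [Q3 [Q4 [v [R1 [h3 h4 h5 /subR_nilr[]// E1 E4]]]]] := subR_consr h (perm_refl _).
    exists v; first by move: h3; rewrite E1 => /(perm_small_eq (s2:=[:: _]) isT).
    by apply: sub_perm h5; rewrite E4 in h4; perm_count.
  by [].
- move=> /= [w' h1 ->] p h2 p2; rewrite upv_compe in h1.
  have [||u h3 h4] := IH _ _ _ _ (rmap succn id Q2) _ _ (rmap succn id Q) _ h1 _
    (subR_ren (upv_shift r) h2) _.
  + by rewrite -!rmap_rtag -map_cat; exact: rmap_perm.
  + by rewrite -map_cat; exact: rmap_perm.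
  + by exists (RLam u); [exists u|exists w'].
- move=> /sub_appP[w' [ws [X1 [X2 [-> h1 h2 h3]]]]] p h4 p2.
  have /perm_map_cat2[Ra' [Rb' [Qa [Qb [p3 p4 p5 p6]]]]] : perm_eq (both R' Q2) (X1 ++ X2) by perm_count.
  have [Ra [Rb [q1 [q2 [h8 h9 h10 h11]]]]] := subR_splitr h4 p3.
  have [u h12 h13] := IH _ _ _ _ _ _ _ _ _ h2 p5 h10 (perm_refl _).
  suff [us h14 h15] : exists2 us, subl s Rb vs us & subl r (q2 ++ Qb) us ws.
    exists (RApp u us); first exact: sub_app_intro h12 h14.
    by apply: sub_app_intro h13 h15; perm_count.
  clear -IHvs h3 p6 h11.
  elim: vs ws IHvs X2 Rb Rb' q2 Qb h3 p6 h11 => [|v vs IHl] [|w' ws] IHvs X2 R R' Q1 Q2 //=.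
    move=> ->; rewrite perm_sym => /perm_nilP/esym/both_nil[-> ->] /subR_nilr[]// -> ->.
    by exists [::].
  have [Hv /IHl Hl] := forall_in_cons IHvs.
  move=> [X3 [X4 [h1 h2 h3]]] p h4.
  have /perm_map_cat2[Ra' [Rb' [Qa [Qb [p3 p4 p5 p6]]]]] : perm_eq (both R' Q2) (X3 ++ X4).
    by rewrite -!/(rtag _ _) in p; perm_count.
  have [Ra [Rb [q1 [q2 [h8 h9 h10 h11]]]]] := subR_splitr h4 p3.
  have [u h12 h13] := Hv _ _ _ _ _ _ _ _ _ h2 p5 h10 (perm_refl _).
  have [us h14 h15] := Hl _ _ _ _ _ _ h3 p6 h11.
  exists (u :: us); first by exists Ra, Rb.
  by exists (q1 ++ Qa), (q2 ++ Qb); split=> //; perm_count.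
- move=> /sub_muP[c2 h1 ->] p h2 p2; rewrite upn_compe in h1.
  have [||c1 h3 h4] := subc_compV_aux IH (Q2 := rmap id succn Q2) (Q := rmap id succn Q) h1 _ (subR_ren (upn_shift r) h2) _.
  + by rewrite -!rmap_rtag -map_cat; exact: rmap_perm.
  + by rewrite -map_cat; exact: rmap_perm.
  + exists (RMu c1.1 c1.2); first exact: sub_mu_intro.
    by apply: sub_mu_intro; case: c1 {h3} h4.
Qed.

Lemma subc_compV s r R' Q2 Q1 R Q c c2 : subc (compe s r) (both R' Q2) c c2 ->
  subR r Q1 R R' -> perm_eq Q (Q1 ++ Q2) ->
  exists2 c1, subc s R c c1 & subc r Q c1 c2.
Proof.
case: c => b t h1 h2 h3.
exact: (subc_compV_aux (@sub_compV t) h1 (perm_refl _) h2 h3).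
Qed.

End Comp.

(** * Reduction and its commutation with substitution *)

(** The variable or name bound by the contracted abstraction has index 0 and is the only one with a
    tag. [sigL] lowers the other variables because its binder disappears; [sigM] keeps the names
    because the [mu] remains. *)
Definition sigL : env unit :=
  Env (fun k => if k is j.+1 then inl j else inr tt) (fun b => (b, [::])).
Definition sigM : env unit :=
  Env inl (fun b => (b, if b is 0 then [:: tt] else [::])).

Definition mu (c : nat * rterm) := RMu c.1 c.2.
Definition rho a (c : nat * rterm) := (inst a c.1, rren id (inst a) c.2).

(** [step t T] contracts a redex of [t] into the set of terms [T].  A named term
    [_b|t|] is a pair [(b, t)]; giving it its own reduction [cstep] turns the
    third rule into a root contraction, which removes all critical pairs. *)
Inductive step : rterm -> (rterm -> Prop) -> Prop :=
| st_lam t B : step (RApp (RLam t) B) (sub sigL (tagl tt B) t)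
| st_mu b t B : step (RApp (RMu b t) B)
    (fun w => exists2 c, subc sigM (tagl tt (shiftn B)) (b, t) c & w = mu c)
| st_inlam t T : step t T -> step (RLam t) (fun w => exists2 u, T u & w = RLam u)
| st_cmd b t T : cstep (b, t) T -> step (RMu b t) (fun w => exists2 c, T c & w = mu c)
| st_fun t T B : step t T -> step (RApp t B) (fun w => exists2 u, T u & w = RApp u B)
| st_bag t B1 v V B2 : step v V ->
    step (RApp t (B1 ++ v :: B2)) (fun w => exists2 u, V u & w = RApp t (B1 ++ u :: B2))
with cstep : nat * rterm -> (nat * rterm -> Prop) -> Prop :=
| cs_rho a e t : cstep (a, RMu e t) (fun c => c = rho a (e, t))
| cs_in b t T : step t T -> cstep (b, t) (fun c => exists2 u, T u & c = (b, u)).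

Scheme step_mut := Induction for step Sort Prop
  with cstep_mut := Induction for cstep Sort Prop.
Combined Scheme step_cstep_ind from step_mut, cstep_mut.

(** [t] reduces, summand by summand, to a sum included in [P]; a summand that contracts to 0 is
    covered by every [P]. If moreover all of [P] is reachable by [red], then [P] is a reduct of [t]
    in the sense of sums. *)
Inductive covered (P : rterm -> Prop) : rterm -> Prop :=
| cov_here t : P t -> covered P t
| cov_step t T : step t T -> (forall v, T v -> covered P v) -> covered P t.
Notation cov t P := (covered P t).

Inductive red : rterm -> rterm -> Prop :=
| red_refl t : red t t
| red_step t T v u : step t T -> T v -> red v u -> red t u.

Lemma red_trans t u v : red t u -> red u v -> red t v.
Proof. by elim=> // {}t T w {}u hs hT _ IH /IH; exact: red_step hs hT. Qed.

Lemma red1 t T v : step t T -> T v -> red t v.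
Proof. by move=> h1 h2; apply: red_step h1 h2 _; exact: red_refl. Qed.

Lemma cov_bind t P Q : cov t P -> (forall s, P s -> cov s Q) -> cov t Q.
Proof.
move=> h hPQ; elim: h => {t} [t /hPQ|t T hs _ IH] //; exact: cov_step hs IH.
Qed.

Lemma cov_mono t (P Q : rterm -> Prop) : cov t P -> (forall s, P s -> Q s) -> cov t Q.
Proof. by move=> h hPQ; apply: cov_bind h _ => s /hPQ; exact: cov_here. Qed.

(** One-hole contexts, described by their effect on steps. The reducts are given up to equivalence
    because, under a [mu], a step of the body passes through a step of the named term. *)
Definition isctx (F : rterm -> rterm) := forall t T, step t T ->
  exists2 T', step (F t) T' & forall w, T' w <-> exists2 u, T u & w = F u.

Lemma isctx_id : isctx id.
Proof. by move=> t T h; exists T => // w; split=> [|[u hu ->]//]; exists w. Qed.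
Lemma isctx_comp F G : isctx F -> isctx G -> isctx (fun t => F (G t)).
Proof.
move=> hF hG t T /hG[T1 /hF[T2 h2 e2] e1]; exists T2 => // w; rewrite e2.
split=> [[u /e1[u' h ->] ->]|[u h ->]]; first by exists u'.
by exists (G u) => //; apply/e1; exists u.
Qed.
Lemma isctx_lam : isctx RLam.
Proof. by move=> t T h; eexists; first exact: st_inlam h. Qed.
Lemma isctx_mu b : isctx (RMu b).
Proof.
move=> t T h; eexists; first exact: st_cmd (cs_in b h).
move=> w; split=> [[c [u hu ->] ->]|[u hu ->]]; first by exists u.
by exists (b, u) => //; exists u.
Qed.
Lemma isctx_fun B : isctx (RApp^~ B).
Proof. by move=> t T h; eexists; first exact: st_fun h. Qed.
Lemma isctx_bag t B1 B2 : isctx (fun v => RApp t (B1 ++ v :: B2)).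
Proof. by move=> v V h; eexists; first exact: st_bag h. Qed.

Lemma cov_ctx F t P : isctx F -> cov t P -> cov (F t) (fun w => exists2 u, P u & w = F u).
Proof.
move=> hF; elim=> {t} [t h|t T /hF[T' h e] _ IH]; first by apply: cov_here; exists t.
by apply: cov_step h _ => v /e[u hu ->]; exact: IH.
Qed.

Lemma red_ctx F t u : isctx F -> red t u -> red (F t) (F u).
Proof.
move=> hF; elim=> {t u} [t|t T v u /hF[T' h e] hv _ IH]; first exact: red_refl.
by apply: red_step h _ IH; apply/e; exists v.
Qed.

(** The applied term stays in head position, hence in a one-hole context that depends on the
    resources alone. *)
Lemma appl_ctx (T : eqType) (l : seq T) R u w : appl l R u w ->
  exists2 F, isctx F & w = F u /\ forall u', appl l R u' (F u').
Proof.
elim: l R u => [|c l IH] R u /=.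
  by move=> [-> ->]; exists id; [exact: isctx_id|].
move=> [B [R' [h1 /IH[F hF [-> h2]]]]]; exists (fun u => F (RApp u B)).
  exact: isctx_comp hF (isctx_fun B).
by split=> // u'; exists B, R'.
Qed.

Definition swap T U (x : T + U) : U + T := match x with inl a => inr a | inr b => inl b end.

Lemma rtag_swap (T U : eqType) (R : seq (T * rterm)) (Q : seq (U * rterm)) :
  perm_eq (rtag (@swap T U) (rtag inl R ++ rtag inr Q)) (rtag inl Q ++ rtag inr R).
Proof.
rewrite /rtag map_cat -!map_comp perm_catC; apply: perm_cat; exact: perm_refl.
Qed.

Lemma rmap_id T (R : seq (T * rterm)) : rmap id id R = R.
Proof. by rewrite -[RHS]map_id; apply: eq_map => -[c v] /=; rewrite rren_id. Qed.

Lemma tagl_shiftn (T : eqType) (c : T) B : tagl c (shiftn B) = rmap id succn (tagl c B).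
Proof. by rewrite /tagl /shiftn /rmap -!map_comp. Qed.
Lemma tagl_shiftv (T : eqType) (c : T) B : tagl c (shiftv B) = rmap succn id (tagl c B).
Proof. by rewrite /tagl /shiftv /rmap -!map_comp. Qed.

Lemma sigL_shift : pree sigL succn id = rene id id. Proof. by []. Qed.
Lemma sigM_shift : pree sigM id succn = rene id succn. Proof. by []. Qed.

Section CommandRen.
Variable T : eqType.
Implicit Types (s : env T) (R : seq (T * rterm)).

Lemma subc_poste s R f g c c' : subc s R c c' ->
  subc (poste f g s) (rmap f g R) c (g c'.1, rren f g c'.2).
Proof.
move=> [R1 [R2 [u [h1 h2 h3 h4]]]]; exists (rmap f g R1), (rmap f g R2), (rren f g u); split.
+ by rewrite -map_cat; exact: rmap_perm.
+ exact: sub_poste.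
+ exact: appl_poste.
+ by rewrite /= h4.
Qed.

Lemma subc_posteP s R f g c c' : subc (poste f g s) (rmap f g R) c c' ->
  exists2 c1, c' = (g c1.1, rren f g c1.2) & subc s R c c1.
Proof.
case: c' => b' u' [R1 [R2 [u [/perm_map_cat[R3 [R4 [h1 -> ->]]] /sub_posteP[w -> hw] /appl_posteP[w2 /= -> hw2] /= ->]]]].
by exists ((en s c.1).1, w2) => //; exists R3, R4, w.
Qed.

Lemma rmap_instK a R : rmap id (inst a) (rmap id succn R) = R.
Proof.
rewrite /rmap -map_comp -[RHS]map_id; apply: eq_map => -[c v] /=.
by rewrite rren_comp -[RHS]/(c, v); congr pair; rewrite -[RHS]rren_id.
Qed.

End CommandRen.

(** * Commutation of a contraction with a substitution *)

Section Commute.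
Variable T : eqType.
Implicit Types (s : env T) (R : seq (T * rterm)).

(** The substitution lemma, as an equation between environments: substituting under the binder and
    then contracting, or contracting and then substituting, differ only in the side on which the
    tags are put. *)
Lemma compe_sigL s : rete (@swap _ _) (compe (upv s) sigL) = compe sigL s.
Proof.
congr Env; apply/funext; first by case=> //= x; case: (ev s x).
by move=> b /=; case: (en s b) => b' l /=; rewrite cats0 -map_comp.
Qed.
Lemma compe_sigL' s : rete (@swap _ _) (compe sigL s) = compe (upv s) sigL.
Proof.
congr Env; apply/funext; first by case=> //= x; case: (ev s x).
by move=> b /=; case: (en s b) => b' l /=; rewrite cats0 -map_comp.
Qed.
Lemma compe_sigM s : rete (@swap _ _) (compe (upn s) sigM) = compe sigM (upn s).
Proof.
congr Env; apply/funext; first by move=> x /=; case: (ev s x).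
by case=> // b /=; case: (en s b) => b' l /=; rewrite cats0 -map_comp.
Qed.
Lemma compe_sigM' s : rete (@swap _ _) (compe sigM (upn s)) = compe (upn s) sigM.
Proof.
congr Env; apply/funext; first by move=> x /=; case: (ev s x).
by case=> // b /=; case: (en s b) => b' l /=; rewrite cats0 -map_comp.
Qed.

(** Compose the two substitutions, swap the tags, decompose in the other order. The resources in
    [R0] have been weakened, so the contraction puts nothing into them; those in [R1] have gone into
    the bag [B]. *)
Lemma lam_comm s R R0 R1 t B t1 B1 x : perm_eq R (R0 ++ R1) ->
  sub (upv s) (rmap succn id R0) t t1 -> subl s R1 B B1 -> sub sigL (tagl tt B1) t1 x ->
  exists2 t', sub sigL (tagl tt B) t t' & sub s R t' x.
Proof.
move=> p h1 h2 h3.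
have [Q1 [Q2 [R' [p1 h4 h5]]]] := sub_comp h1 h3.
have [E pR] := subR_rene sigL_shift h4; rewrite E /= in p1; rewrite rmap_id in pR.
have := sub_rete (@swap _ _) h5; rewrite compe_sigL => h6.
apply: (sub_compV (R' := tagl tt B1) (Q2 := R0) h6) (subR_tagl tt h2) _; last by perm_count.
by apply: perm_trans (rtag_swap _ _) _; apply: perm_cat; apply: rtag_perm => //; rewrite perm_sym.
Qed.

Lemma lam_commV s R t B t' x : sub sigL (tagl tt B) t t' -> sub s R t' x ->
  exists t1 B1 R0 R1, [/\ perm_eq R (R0 ++ R1), sub (upv s) (rmap succn id R0) t t1,
    subl s R1 B B1 & sub sigL (tagl tt B1) t1 x].
Proof.
move=> h1 h2; have [Q1 [Q2 [R' [p1 h4 h5]]]] := sub_comp h1 h2.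
have [B1 p2 h6] := subR_tagll h4.
have := sub_rete (@swap _ _) h5; rewrite compe_sigL' => h7.
have [||t1 h8 h9] := sub_compV (R' := rmap id id Q2) (Q2 := tagl tt B1) (Q := tagl tt B1) h7 _
  (subR_rene_intro Q2 sigL_shift) _.
- by rewrite rmap_id; apply: perm_trans (rtag_swap _ _) _; apply: perm_cat; apply: rtag_perm.
- by [].
by exists t1, B1, Q2, Q1; split=> //; perm_count.
Qed.

Lemma mu_comm s R R0 R1 c B c1 B1 x : perm_eq R (R0 ++ R1) ->
  subc (upn s) (rmap id succn R0) c c1 -> subl s R1 B B1 ->
  subc sigM (tagl tt (shiftn B1)) c1 x ->
  exists2 c', subc sigM (tagl tt (shiftn B)) c c' & subc (upn s) (rmap id succn R) c' x.
Proof.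
move=> p h1 h2 h3.
have [Q1 [Q2 [R' [p1 h4 h5]]]] := subc_comp h1 h3.
have [E pR] := subR_rene sigM_shift h4; rewrite E /= in p1.
have := subc_rete (@swap _ _) h5; rewrite compe_sigM => h6.
have h7 := subR_ren (upn_shift s) (subR_tagl tt h2).
rewrite -!tagl_shiftn in h7.
apply: (subc_compV (Q2 := rmap id succn R0) (subc_perm _ h6) h7).
  by apply: perm_trans (rtag_swap _ _) _; apply: perm_cat; apply: rtag_perm => //; rewrite perm_sym.
by rewrite -map_cat; apply: rmap_perm; perm_count.
Qed.

Lemma mu_commV s R c B c' x : subc sigM (tagl tt (shiftn B)) c c' ->
  subc (upn s) (rmap id succn R) c' x ->
  exists c1 B1 R0 R1, [/\ perm_eq R (R0 ++ R1), subc (upn s) (rmap id succn R0) c c1,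
    subl s R1 B B1 & subc sigM (tagl tt (shiftn B1)) c1 x].
Proof.
move=> h1 h2; have [Q1 [Q2 [R' [/perm_map_cat[R1 [R0 [p1 E1 E2]]] h4 h5]]]] := subc_comp h1 h2.
move: h4; rewrite E1 tagl_shiftn => /(subR_renP (upn_shift s))[R2 p2 /subR_tagll[B1 p3 h6]].
have := subc_rete (@swap _ _) h5; rewrite compe_sigM' E2 => h7.
have h8 : subc (compe (upn s) sigM)
    (rtag inl (rmap id succn R0) ++ rtag inr (tagl tt (shiftn B1))) c x.
  apply: subc_perm h7; apply: perm_trans (rtag_swap _ _) _; apply: perm_cat; apply: rtag_perm => //.
  by apply: (perm_trans p2); rewrite tagl_shiftn; exact: rmap_perm.
have [|c1 h9 h10] := subc_compV (Q := tagl tt (shiftn B1)) h8 (subR_rene_intro R0 sigM_shift) _.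
  by [].
by exists c1, B1, R0, R1; split=> //; perm_count.
Qed.

Lemma poste_inst s a a' : en s a = (a', [::]) ->
  poste id (inst a') (upn s) = pree s id (inst a).
Proof.
move=> E; congr Env; apply/funext; first by move=> x /=; case: (ev s x).
by case=> [|b] /=; [rewrite E|case: (en s b)].
Qed.

Lemma rho_comm0 s R a a' c c1 : en s a = (a', [::]) ->
  subc (upn s) (rmap id succn R) c c1 -> subc s R (rho a c) (rho a' c1).
Proof.
move=> E /(subc_poste id (inst a')); rewrite rmap_instK (poste_inst E).
by move=> h; apply/subc_pree; case: c h.
Qed.

Lemma rho_comm0V s R a a' c x : en s a = (a', [::]) -> subc s R (rho a c) x ->
  exists2 c1, x = rho a' c1 & subc (upn s) (rmap id succn R) c c1.
Proof.
case: c => b t E /subc_pree; rewrite -(poste_inst E) -{1}(rmap_instK a' R).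
exact: subc_posteP.
Qed.

(** After a [rho] contraction the inner bound name and the outer name [a] are the same name, and all
    its occurrences take bags tagged [d]. In the other order, the occurrences of the inner name take
    theirs, tagged [tt], from a [mu] redex. Merging [tt] into [d] identifies the two results. *)
Definition unsigM (d : T) (x : T + unit) := if x is inl c then c else d.

Lemma poste_inst1 s a a' d : en s a = (a', [:: d]) ->
  rete (unsigM d) (poste id (inst a') (compe (upn s) sigM)) = pree s id (inst a).
Proof.
move=> E; congr Env; apply/funext; first by move=> x /=; case: (ev s x).
case=> [|b] /=; first by rewrite E.
by case: (en s b) => b' l /=; rewrite cats0 -map_comp map_id.
Qed.

Lemma rho_comm1 s R R0 B a a' d c c1 c2 : en s a = (a', [:: d]) ->
  perm_eq R (R0 ++ tagl d B) -> subc (upn s) (rmap id succn R0) c c1 ->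
  subc sigM (tagl tt (shiftn B)) c1 c2 -> subc s R (rho a c) (rho a' c2).
Proof.
move=> E p h1 h2; have [Q1 [Q2 [R' [p1 h4 h5]]]] := subc_comp h1 h2.
have [EQ pR] := subR_rene sigM_shift h4; rewrite EQ /= in p1.
have h6 : subc (compe (upn s) sigM) (rmap id succn (rtag inl R0 ++ rtag inr (tagl tt B))) c c2.
  apply: subc_perm h5; rewrite /rmap map_cat -!/(rmap _ _ _) !rmap_rtag -tagl_shiftn.
  by apply: perm_cat; apply: rtag_perm => //; rewrite perm_sym.
have := subc_rete (unsigM d) (subc_poste id (inst a') h6).
rewrite (poste_inst1 E) rmap_instK => h7; apply/subc_pree.
rewrite /rho in h7 *; case: c h1 h5 h6 h7 => b t _ _ _ h7.
apply: subc_perm h7; rewrite perm_sym rtag_cat /rtag -!map_comp.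
apply: perm_trans p _; apply: perm_cat; last by rewrite /tagl.
by rewrite (@eq_map _ _ _ id) ?map_id // => -[].
Qed.

Lemma tags_partition (X : seq ((T + unit) * rterm)) :
  exists R0 B, perm_eq X (rtag inl R0 ++ rtag inr (tagl tt B)).
Proof.
elim: X => [|[[c|[]] v] X [R0 [B p]]]; first by exists [::], [::].
  by exists ((c, v) :: R0), B; rewrite /=; perm_count.
by exists R0, (v :: B); rewrite /=; perm_count.
Qed.

Lemma rho_comm1V s R a a' d c x : en s a = (a', [:: d]) -> subc s R (rho a c) x ->
  exists R0 B c1 c2, [/\ perm_eq R (R0 ++ tagl d B),
    subc (upn s) (rmap id succn R0) c c1, subc sigM (tagl tt (shiftn B)) c1 c2 & x = rho a' c2].
Proof.
case: c => b t E /subc_pree; rewrite -(poste_inst1 E) => /subc_reteP[X p].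
rewrite -{1}(rmap_instK a' X) => /subc_posteP[c2 -> h].
have [R0 [B pX]] := tags_partition X.
have h2 : subc (compe (upn s) sigM)
    (rtag inl (rmap id succn R0) ++ rtag inr (tagl tt (shiftn B))) (b, t) c2.
  apply: subc_perm h; apply: perm_trans (rmap_perm _ _ pX) _.
  by rewrite /rmap map_cat -!/(rmap _ _ _) !rmap_rtag -tagl_shiftn.
have [|c1 h9 h10] := subc_compV (Q := tagl tt (shiftn B)) h2 (subR_rene_intro R0 sigM_shift) _.
  by [].
exists R0, B, c1, c2; split=> //.
apply: perm_trans p _; apply: perm_trans (rtag_perm _ pX) _.
rewrite rtag_cat /rtag -!map_comp; apply: perm_cat; last by rewrite /tagl.
by rewrite (@eq_map _ _ _ id) ?map_id // => -[].
Qed.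

End Commute.

(** True of [sigL], [sigM] and [rene]. In the case of [rho], the outer name then receives no bag
    ([rho_comm0]) or exactly one ([rho_comm1]). *)
Definition arity1 T (s : env T) := forall b, size (en s b).2 <= 1.

(** The sum [t<R>] reduces to the sum [T<R>]: all its summands are driven into [T<R>], and every
    summand of [T<R>] is reached from one of them. *)
Definition step_sub t (T : rterm -> Prop) := forall (U : eqType) (s : env U) R, arity1 s ->
  (forall w, sub s R t w -> cov w (fun x => exists2 v, T v & sub s R v x)) /\
  (forall v x, T v -> sub s R v x -> exists2 w, sub s R t w & red w x).

Definition cstep_sub c (T : nat * rterm -> Prop) :=
  forall (U : eqType) (s : env U) R, arity1 s ->
  (forall c', subc s R c c' ->
     cov (mu c') (fun x => exists d d', [/\ T d, subc s R d d' & x = mu d'])) /\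
  (forall d d', T d -> subc s R d d' -> exists2 c', subc s R c c' & red (mu c') (mu d')).

Lemma step_sub_comm :
  (forall t T, step t T -> step_sub t T) /\ (forall c T, cstep c T -> cstep_sub c T).
Proof.
apply: step_cstep_ind.
- move=> t B U s R ar; split.
    move=> w /sub_appP[_ [B1 [R0 [R1 [-> p [t1 h1 ->] h2]]]]].
    apply: cov_step (st_lam _ _) _ => x h3; apply: cov_here.
    exact: lam_comm p h1 h2 h3.
  move=> v x h1 h2; have [t1 [B1 [R0 [R1 [p h3 h4 h5]]]]] := lam_commV h1 h2.
  exists (RApp (RLam t1) B1); last exact: red1 (st_lam _ _) h5.
  by apply: sub_app_intro p _ h4; exists t1.
- move=> b t B U s R ar; split.
    move=> w /sub_appP[_ [B1 [R0 [R1 [-> p /sub_muP[c1 h1 ->] h2]]]]].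
    apply: cov_step (st_mu _ _ _) _ => _ [x h3 ->]; apply: cov_here.
    rewrite -surjective_pairing in h3.
    have [c' h4 h5] := mu_comm p h1 h2 h3.
    exists (mu c'); first by exists c'.
    by apply: sub_mu_intro; rewrite -surjective_pairing.
  move=> _ x [c' h1 ->] /sub_muP[c2]; rewrite -surjective_pairing => h2 ->.
  have [c1 [B1 [R0 [R1 [p h3 h4 h5]]]]] := mu_commV h1 h2.
  exists (RApp (mu c1) B1).
    by apply: sub_app_intro p _ h4; exact: sub_mu_intro.
  apply: red1 (st_mu _ _ _) _; exists c2 => //; by rewrite -surjective_pairing.
- move=> t T _ IH U s R ar.
  have [IH1 IH2] := IH U (upv s) (rmap succn id R) ar; split.
    move=> _ [u /IH1 h ->]; apply: cov_mono (cov_ctx isctx_lam h) _.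
    by move=> _ [u' [v hv h'] ->]; exists (RLam v); [exists v|exists u'].
  move=> _ _ [v hv ->] [u h ->]; have [w h1 h2] := IH2 _ _ hv h.
  by exists (RLam w); [exists w|exact: red_ctx isctx_lam h2].
- move=> b t T _ IH U s R ar.
  have ar' : arity1 (upn s) by case=> //= b'; exact: ar.
  have [IH1 IH2] := IH U (upn s) (rmap id succn R) ar'; split.
    move=> _ /sub_muP[c' /IH1 h ->]; apply: cov_mono h _.
    move=> _ [d [d' [hd h ->]]]; exists (mu d); first by exists d.
    by apply: sub_mu_intro; rewrite -surjective_pairing.
  move=> _ x [d hd ->] /sub_muP[d']; rewrite -surjective_pairing => h ->.
  have [c' h1 h2] := IH2 _ _ hd h.
  by exists (mu c') => //; exact: sub_mu_intro.
- move=> t T B _ IH U s R ar; split.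
    move=> _ /sub_appP[u [us [R1 [R2 [-> p h1 h2]]]]].
    have [/(_ _ h1) IH1 _] := IH U s R1 ar.
    apply: cov_mono (cov_ctx (isctx_fun us) IH1) _.
    move=> _ [u' [v hv h'] ->]; exists (RApp v B); first by exists v.
    exact: sub_app_intro p h' h2.
  move=> _ _ [v hv ->] /sub_appP[u [us [R1 [R2 [-> p h1 h2]]]]].
  have [_ /(_ _ _ hv h1) [w h3 h4]] := IH U s R1 ar.
  exists (RApp w us); first exact: sub_app_intro p h3 h2.
  exact: red_ctx (isctx_fun us) h4.
- move=> t B1 v V B2 _ IH U s R ar; split.
    move=> _ /sub_appP[u [us [R1 [R2 [-> p h1 h2]]]]].
    have [us1 [us' [Q1 [Q2 [-> p2 h3]]]]] := subl_catP h2.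
    case: us' => // u' us2 [Q3 [Q4 [p3 h4 h5]]].
    have [/(_ _ h4) IH1 _] := IH U s Q3 ar.
    apply: cov_mono (cov_ctx (isctx_bag u us1 us2) IH1) _.
    move=> _ [u'' [v' hv h'] ->]; exists (RApp t (B1 ++ v' :: B2)); first by exists v'.
    apply: sub_app_intro p h1 _; apply: subl_perm _ (subl_cat h3 (_ : subl s Q2 (v' :: B2) (u'' :: us2))).
      by rewrite perm_sym.
    by exists Q3, Q4.
  move=> _ _ [v' hv ->] /sub_appP[u [us [R1 [R2 [-> p h1 h2]]]]].
  have [us1 [us' [Q1 [Q2 [-> p2 h3]]]]] := subl_catP h2.
  case: us' => // u' us2 [Q3 [Q4 [p3 h4 h5]]].
  have [_ /(_ _ _ hv h4) [w h6 h7]] := IH U s Q3 ar.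
  exists (RApp u (us1 ++ w :: us2)); last exact: red_ctx (isctx_bag u us1 us2) h7.
  apply: sub_app_intro p h1 _; apply: subl_perm _ (subl_cat h3 (_ : subl s Q2 (v :: B2) (w :: us2))).
    by rewrite perm_sym.
  by exists Q3, Q4.
- move=> a e t U s R ar; have := ar a; case Ea: (en s a) => [a' l] /=.
  case: l Ea => [|d [|? ?]] Ea // _; split.
  + move=> [b' u'] [R1 [R2 [u /= []]]]; rewrite Ea => p /sub_muP[c1 h1 ->] [E2 ->] ->.
    apply: cov_step (st_cmd (cs_rho _ _ _)) _ => _ [_ -> ->]; apply: cov_here.
    exists (rho a (e, t)), (rho a' c1); split=> //.
    apply: rho_comm0 => //; apply: subc_perm h1; apply: rmap_perm.
    by rewrite E2 cats0 in p; rewrite perm_sym.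
  + move=> _ d' -> /(rho_comm0V Ea)[c1 -> h1].
    exists (a', mu c1).
      exists R, [::], (mu c1); rewrite cats0 /= Ea; split=> //; exact: sub_mu_intro.
    apply: red1 (st_cmd (cs_rho _ _ _)) _; exists (rho a' c1) => //.
  (* The bag [B] given to the outer name now separates the two [mu]s: one [mu] step absorbs it,
     after which [rho] applies. *)
  + move=> [b' u'] [R1 [R2 [u /= []]]]; rewrite Ea => p /sub_muP[c1 h1 ->] [B [R' [p2 [E2 ->]]]] ->.
    apply: cov_step (st_cmd (cs_in _ (st_mu _ _ _))) _ => _ [_ [_ [c2 h2 ->] ->] ->].
    rewrite -surjective_pairing in h2.
    apply: cov_step (st_cmd (cs_rho _ _ _)) _ => _ [_ -> ->]; apply: cov_here.
    exists (rho a (e, t)), (rho a' c2); split=> //.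
    by apply: rho_comm1 Ea _ h1 h2; rewrite E2 cats0 in p2; perm_count.
  + move=> _ d' -> /(rho_comm1V Ea)[R0 [B [c1 [c2 [p h1 h2 ->]]]]].
    exists (a', RApp (mu c1) B).
      exists R0, (tagl d B), (mu c1); rewrite /= Ea; split=> //; first exact: sub_mu_intro.
      by exists B, [::]; rewrite cats0.
    apply: (@red_trans _ (RMu a' (mu c2))).
      apply: red_ctx (isctx_mu a') _; case: c1 {h1} h2 => b1 t1 h2.
      by apply: red1 (st_mu _ _ _) _; exists c2.
    apply: red1 (st_cmd (cs_rho _ _ _)) _; exists (rho a' c2) => //.
- move=> b t T _ IH U s R ar; split.
    move=> [b' u'] [R1 [R2 [u /= [p h1 h2 ->]]]].
    have [F hF [-> h3]] := appl_ctx h2.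
    have [/(_ _ h1) IH1 _] := IH U s R1 ar.
    apply: cov_mono (cov_ctx (isctx_comp (isctx_mu _) hF) IH1) _.
    move=> _ [w [v hv h] ->]; exists (b, v), ((en s b).1, F w); split=> //; first by exists v.
    by exists R1, R2, w.
  move=> _ [b' u'] [v hv ->] [R1 [R2 [u /= [p h1 h2 ->]]]].
  have [F hF [-> h3]] := appl_ctx h2.
  have [_ /(_ _ _ hv h1) [w h4 h5]] := IH U s R1 ar.
  exists ((en s b).1, F w); first by exists R1, R2, w.
  exact: red_ctx (isctx_comp (isctx_mu _) hF) h5.
Qed.

(** * Local confluence *)

(** A resource is renamed each time it passes under a binder. The induction on the term that
    receives it therefore needs the reduction of [v] to [V] for all renamings at once; [step_stable]
    obtains this by viewing a renaming as a substitution. *)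
Definition stable_step v (V : rterm -> Prop) := forall f g,
  cov (rren f g v) (fun x => exists2 v', V v' & x = rren f g v') /\
  (forall v', V v' -> red (rren f g v) (rren f g v')).

Lemma step_stable v V : step v V -> stable_step v V.
Proof.
move=> h f g.
have [//|h1 h2] := step_sub_comm.1 _ _ h unit (rene f g) [::].
split.
  have /h1 : sub (@rene unit f g) [::] v (rren f g v) by apply/sub_rene.
  by move=> /cov_mono; apply=> x [v' hv' /sub_rene[_ ->]]; exists v'.
move=> v' hv'; have [|w /sub_rene[_ ->] //] := h2 _ (rren f g v') hv'.
exact/sub_rene.
Qed.

Lemma stable_step_rren v V f g : stable_step v V ->
  stable_step (rren f g v) (fun x => exists2 v', V v' & x = rren f g v').
Proof.
move=> h f' g'; rewrite rren_comp; have [h1 h2] := h (f' \o f) (g' \o g); split.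
  apply: cov_mono h1 _ => _ [v' hv' ->]; exists (rren f g v'); first by exists v'.
  by rewrite rren_comp.
by move=> _ [v' hv' ->]; rewrite rren_comp; exact: h2.
Qed.

Lemma stable_step_cov v V : stable_step v V -> cov v V.
Proof.
move=> /(_ id id)[]; rewrite rren_id => h _; apply: cov_mono h _ => x [v' hv' ->].
by rewrite rren_id.
Qed.

Lemma stable_step_red v V v' : stable_step v V -> V v' -> red v v'.
Proof. by move=> /(_ id id)[_ h] /h; rewrite !rren_id. Qed.

Lemma perm_cons_tagl (T : eqType) (c d : T) v R B R' :
  perm_eq ((c, v) :: R) (tagl d B ++ R') ->
  (exists B1 B2, [/\ c = d, B = B1 ++ v :: B2 & perm_eq R (tagl d (B1 ++ B2) ++ R')]) \/
  (exists2 R2, perm_eq R' ((c, v) :: R2) & perm_eq R (tagl d B ++ R2)).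
Proof.
move=> p; have : (c, v) \in tagl d B ++ R' by rewrite -(perm_mem p) mem_head.
rewrite mem_cat => /orP[/mapP[v' Bv' [E1 E2]]|h].
  left; subst c v'; case/splitPr: Bv' p => B1 B2 p; exists B1, B2; split=> //.
  by rewrite /tagl in p *; perm_count.
by right; exists (rem (c, v) R'); have p2 := perm_to_rem h; perm_count.
Qed.

(** * Reduction of one of the substituted resources *)

Section ResourceStep.
Variables (T : eqType).
Implicit Types (s : env T) (R : seq (T * rterm)).

Lemma stable_step_appl l c v V R u : stable_step v V ->
  (forall w, appl l ((c, v) :: R) u w ->
     cov w (fun x => exists2 v', V v' & appl l ((c, v') :: R) u x)) /\
  (forall v' x, V v' -> appl l ((c, v') :: R) u x ->
     exists2 w, appl l ((c, v) :: R) u w & red w x).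
Proof.
move=> hv; elim: l R u => [|d l IH] R u /=; first by split=> [w []|v' x _ []].
split.
  move=> w [B [R' [p h]]].
  case: (perm_cons_tagl p) => [[B1 [B2 [E1 E2 p1]]]|[R2 p1 p2]].
    subst; have [F hF [-> h2]] := appl_ctx h.
    apply: cov_mono (cov_ctx (isctx_comp hF (isctx_bag u B1 B2)) (stable_step_cov hv)) _.
    move=> _ [v' hv' ->]; exists v' => //; exists (B1 ++ v' :: B2), R'; split=> //.
    by rewrite /tagl in p1 *; perm_count.
  have [/(_ _ (appl_perm p1 h)) h2 _] := IH R2 (RApp u B).
  apply: cov_mono h2 _ => x [v' hv' h2]; exists v' => //.
  by exists B, ((c, v') :: R2); split=> //; perm_count.
move=> v' x hv' [B [R' [p h]]].
case: (perm_cons_tagl p) => [[B1 [B2 [E1 E2 p1]]]|[R2 p1 p2]].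
  subst; have [F hF [-> h2]] := appl_ctx h.
  exists (F (RApp u (B1 ++ v :: B2))).
    exists (B1 ++ v :: B2), R'; split=> //.
    by rewrite /tagl in p1 *; perm_count.
  exact: red_ctx (isctx_comp hF (isctx_bag u B1 B2)) (stable_step_red hv hv').
have [_ /(_ _ _ hv' (appl_perm p1 h)) [w h2 h3]] := IH R2 (RApp u B).
by exists w => //; exists B, ((c, v) :: R2); split=> //; perm_count.
Qed.

(** By linearity [v] lands in exactly one place of the result, up to renaming, and that place is a
    one-hole context. *)
Lemma stable_step_sub t s c v V R : stable_step v V ->
  (forall w, sub s ((c, v) :: R) t w ->
     cov w (fun x => exists2 v', V v' & sub s ((c, v') :: R) t x)) /\
  (forall v' x, V v' -> sub s ((c, v') :: R) t x ->
     exists2 w, sub s ((c, v) :: R) t w & red w x).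
Proof.
elim/rterm_ind_in: t s v V R => [x|t IH|t vs IH IHvs|b t IH] s v V R hv.
- split=> /=; case: (ev s x) => [y|d].
  + by move=> w [].
  + move=> w [E1 E2 E3]; subst; apply: cov_mono (stable_step_cov hv) _ => x' hx'.
    by exists x'.
  + by move=> v' x' _ [].
  + by move=> v' x' hv' [E1 E2 E3]; subst; exists v => //; exact: stable_step_red hv hv'.
- have [IH1 IH2] := IH (upv s) _ _ (rmap succn id R) (stable_step_rren succn id hv).
  split=> /=.
    move=> _ [u /IH1 h ->]; apply: cov_mono (cov_ctx isctx_lam h) _.
    by move=> _ [u' [_ [v' hv' ->] h'] ->]; exists v' => //; exists u'.
  move=> v' _ hv' [u hu ->]; have [|w h1 h2] := IH2 _ _ _ hu; first by exists v'.
  by exists (RLam w); [exists w|exact: red_ctx isctx_lam h2].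
(* Lists have no reduction of their own: the claim is made inside an arbitrary application, where
   [pre] collects the arguments already passed. *)
- have IHl : forall R,
    (forall us, subl s ((c, v) :: R) vs us -> forall t0 pre, cov (RApp t0 (pre ++ us))
      (fun x => exists v' us', [/\ V v', subl s ((c, v') :: R) vs us' & x = RApp t0 (pre ++ us')])) /\
    (forall v' us, V v' -> subl s ((c, v') :: R) vs us ->
      exists2 ws, subl s ((c, v) :: R) vs ws &
        forall t0 pre, red (RApp t0 (pre ++ ws)) (RApp t0 (pre ++ us))).
    clear IH R; elim: vs IHvs => [|v0 vs IHl] IHvs R; first by split=> [[]|v' []].
    have [Hv {}/IHl Hl] := forall_in_cons IHvs; split.
      move=> [|u us] // [R1 [R2 [p h1 h2]]] t0 pre.
      case: (perm_cons_catP p) => -[R3 p3 p4].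
        have [/(_ _ (sub_perm p3 h1)) h3 _] := Hv s v V R3 hv.
        apply: cov_mono (cov_ctx (isctx_bag t0 pre us) h3) _.
        move=> _ [u' [v' hv' h4] ->]; exists v', (u' :: us); split=> //.
        by exists ((c, v') :: R3), R2; split=> //; perm_count.
      have [/(_ _ (subl_perm p3 h2) t0 (rcons pre u)) h3 _] := Hl R3.
      rewrite -cat_rcons; apply: cov_mono h3 _ => _ [v' [us' [hv' h4 ->]]].
      exists v', (u :: us'); rewrite -cat_rcons; split=> //.
      by exists R1, ((c, v') :: R3); split=> //; perm_count.
    move=> v' [|u us] // hv' [R1 [R2 [p h1 h2]]].
    case: (perm_cons_catP p) => -[R3 p3 p4].
      have [_ /(_ _ _ hv' (sub_perm p3 h1)) [w h3 h4]] := Hv s v V R3 hv.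
      exists (w :: us); first by exists ((c, v) :: R3), R2; split=> //; perm_count.
      by move=> t0 pre; exact: red_ctx (isctx_bag t0 pre us) h4.
    have [_ /(_ _ _ hv' (subl_perm p3 h2)) [ws h3 h4]] := Hl R3.
    exists (u :: ws); first by exists R1, ((c, v) :: R3); split=> //; perm_count.
    by move=> t0 pre; rewrite -!cat_rcons; exact: h4.
  split.
    move=> _ /sub_appP[u [us [R1 [R2 [-> p h1 h2]]]]].
    case: (perm_cons_catP p) => -[R3 p3 p4].
      have [/(_ _ (sub_perm p3 h1)) h3 _] := IH s v V R3 hv.
      apply: cov_mono (cov_ctx (isctx_fun us) h3) _.
      move=> _ [u' [v' hv' h4] ->]; exists v' => //.
      by apply: sub_app_intro _ h4 h2; perm_count.
    apply: cov_mono ((IHl _).1 _ (subl_perm p3 h2) u [::]) _ => _ [v' [us' [hv' h4 ->]]].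
    by exists v' => //; apply: sub_app_intro _ h1 h4; perm_count.
  move=> v' _ hv' /sub_appP[u [us [R1 [R2 [-> p h1 h2]]]]].
  case: (perm_cons_catP p) => -[R3 p3 p4].
    have [_ /(_ _ _ hv' (sub_perm p3 h1)) [w h3 h4]] := IH s v V R3 hv.
    exists (RApp w us); last exact: red_ctx (isctx_fun us) h4.
    by apply: sub_app_intro _ h3 h2; perm_count.
  have [ws h3 h4] := (IHl _).2 _ _ hv' (subl_perm p3 h2).
  exists (RApp u ws); last exact: (h4 _ [::]).
  by apply: sub_app_intro _ h1 h3; perm_count.
- have hv2 := stable_step_rren id succn hv; split.
    move=> _ /sub_muP[[b' w] [R1 [R2 [u /= [p h1 h2 ->]]]] ->].
    case: (perm_cons_catP p) => -[R3 p3 p4].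
      have [/(_ _ (sub_perm p3 h1)) h3 _] := IH (upn s) _ _ R3 hv2.
      have [F hF [E h4]] := appl_ctx h2; rewrite /= E.
      apply: cov_mono (cov_ctx (isctx_comp (isctx_mu _) hF) h3) _.
      move=> _ [u' [_ [v' hv' ->] h5] ->]; exists v' => //.
      exists ((en (upn s) b).1, F u'); split=> //.
      by exists ((c, rren id succn v') :: R3), R2, u'; split=> //=; perm_count.
    have [/(_ _ (appl_perm p3 h2)) h3 _] := stable_step_appl (en (upn s) b).2 c R3 u hv2.
    apply: cov_mono (cov_ctx (isctx_mu _) h3) _.
    move=> _ [u' [_ [v' hv' ->] h5] ->]; exists v' => //.
    exists ((en (upn s) b).1, u'); split=> //.
    by exists R1, ((c, rren id succn v') :: R3), u; split=> //=; perm_count.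
  move=> v' _ hv' /sub_muP[[b' w] [R1 [R2 [u /= [p h1 h2 ->]]]] ->].
  have hv3 : exists2 v0, V v0 & rren id succn v' = rren id succn v0 by exists v'.
  case: (perm_cons_catP p) => -[R3 p3 p4].
    have [_ /(_ _ _ hv3 (sub_perm p3 h1)) [u' h3 h4]] := IH (upn s) _ _ R3 hv2.
    have [F hF [E h5]] := appl_ctx h2; rewrite /= E.
    exists (RMu (en (upn s) b).1 (F u')); last exact: red_ctx (isctx_comp (isctx_mu _) hF) h4.
    exists ((en (upn s) b).1, F u'); split=> //.
    by exists ((c, rren id succn v) :: R3), R2, u'; split=> //=; perm_count.
  have [_ /(_ _ _ hv3 (appl_perm p3 h2)) [w' h3 h4]] := stable_step_appl (en (upn s) b).2 c R3 u hv2.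
  exists (RMu (en (upn s) b).1 w'); last exact: red_ctx (isctx_mu _) h4.
  exists ((en (upn s) b).1, w'); split=> //.
  by exists R1, ((c, rren id succn v) :: R3), u; split=> //=; perm_count.
Qed.

Lemma stable_step_subc s cm c v V R : stable_step v V ->
  (forall d, subc s ((c, v) :: R) cm d ->
     cov (mu d) (fun x => exists v' d', [/\ V v', subc s ((c, v') :: R) cm d' & x = mu d'])) /\
  (forall v' d', V v' -> subc s ((c, v') :: R) cm d' ->
     exists2 d, subc s ((c, v) :: R) cm d & red (mu d) (mu d')).
Proof.
move=> hv; split.
  move=> [b' w] [R1 [R2 [u /= [p h1 h2 ->]]]]; rewrite /mu /=.
  case: (perm_cons_catP p) => -[R3 p3 p4].
    have [/(_ _ (sub_perm p3 h1)) h3 _] := stable_step_sub cm.2 s c R3 hv.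
    have [F hF [E h4]] := appl_ctx h2; rewrite E.
    apply: cov_mono (cov_ctx (isctx_comp (isctx_mu _) hF) h3) _.
    move=> _ [u' [v' hv' h5] ->]; exists v', ((en s cm.1).1, F u'); split=> //.
    by exists ((c, v') :: R3), R2, u'; split=> //; perm_count.
  have [/(_ _ (appl_perm p3 h2)) h3 _] := stable_step_appl (en s cm.1).2 c R3 u hv.
  apply: cov_mono (cov_ctx (isctx_mu _) h3) _.
  move=> _ [u' [v' hv' h5] ->]; exists v', ((en s cm.1).1, u'); split=> //.
  by exists R1, ((c, v') :: R3), u; split=> //; perm_count.
move=> v' [b' w] hv' [R1 [R2 [u /= [p h1 h2 ->]]]]; rewrite /mu /=.
case: (perm_cons_catP p) => -[R3 p3 p4].
  have [_ /(_ _ _ hv' (sub_perm p3 h1)) [u' h3 h4]] := stable_step_sub cm.2 s c R3 hv.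
  have [F hF [E h5]] := appl_ctx h2; rewrite E.
  exists ((en s cm.1).1, F u'); last exact: red_ctx (isctx_comp (isctx_mu _) hF) h4.
  by exists ((c, v) :: R3), R2, u'; split=> //; perm_count.
have [_ /(_ _ _ hv' (appl_perm p3 h2)) [w' h3 h4]] := stable_step_appl (en s cm.1).2 c R3 u hv.
exists ((en s cm.1).1, w'); last exact: red_ctx (isctx_mu _) h4.
by exists R1, ((c, v) :: R3), u; split=> //; perm_count.
Qed.

End ResourceStep.

Lemma step_lamP t T : step (RLam t) T ->
  exists2 T0, step t T0 & T = (fun w => exists2 u, T0 u & w = RLam u).
Proof. by move=> h; inversion h; subst; eexists; first eassumption. Qed.

Lemma step_muP b t T : step (RMu b t) T ->
  exists2 T0, cstep (b, t) T0 & T = (fun w => exists2 c, T0 c & w = mu c).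
Proof. by move=> h; inversion h; subst; eexists; first eassumption. Qed.

Lemma cstepP b t T : cstep (b, t) T ->
  (exists e t0, t = RMu e t0 /\ T = (fun c => c = rho b (e, t0))) \/
  (exists2 T0, step t T0 & T = (fun c => exists2 u, T0 u & c = (b, u))).
Proof.
move=> h; inversion h; subst; first by left; do 2 eexists.
by right; eexists; first eassumption.
Qed.

Lemma step_appP t B T : step (RApp t B) T ->
  [\/ exists t0, t = RLam t0 /\ T = sub sigL (tagl tt B) t0,
      exists b t0, t = RMu b t0 /\
        T = (fun w => exists2 c, subc sigM (tagl tt (shiftn B)) (b, t0) c & w = mu c),
      exists2 T0, step t T0 & T = (fun w => exists2 u, T0 u & w = RApp u B) |
      exists B1 v V B2, [/\ B = B1 ++ v :: B2, step v V &
        T = (fun w => exists2 u, V u & w = RApp t (B1 ++ u :: B2))]].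
Proof.
move=> h; inversion h; subst.
- by constructor 1; eexists.
- by constructor 2; do 2 eexists.
- by constructor 3; eexists; first eassumption.
- by constructor 4; do 4 eexists; split; first reflexivity; first eassumption.
Qed.

Lemma cat_cons_inj (U : Type) (A1 A2 B1 B2 : seq U) x y : A1 ++ x :: A2 = B1 ++ y :: B2 ->
  [\/ [/\ A1 = B1, x = y & A2 = B2],
      exists M, B1 = A1 ++ x :: M /\ A2 = M ++ y :: B2 |
      exists M, A1 = B1 ++ y :: M /\ B2 = M ++ x :: A2].
Proof.
elim: A1 B1 => [|a A1 IH] [|b B1] //=.
- by move=> [-> ->]; constructor 1.
- by move=> [-> ->]; constructor 2; exists B1.
- by move=> [-> <-]; constructor 3; exists A1.
- move=> [-> /IH[[-> -> ->]|[M [-> ->]]|[M [-> ->]]]].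
  + by constructor 1.
  + by constructor 2; exists M.
  + by constructor 3; exists M.
Qed.

Lemma arity1_sigL : arity1 sigL. Proof. by []. Qed.
Lemma arity1_sigM : arity1 sigM. Proof. by case. Qed.

Lemma perm_tagl_mid (T : eqType) (c : T) B1 v B2 :
  perm_eq (tagl c (B1 ++ v :: B2)) ((c, v) :: tagl c (B1 ++ B2)).
Proof. by rewrite /tagl !map_cat /=; perm_count. Qed.

(** A one-sided form of local confluence: each summand [t1] of another contraction reduces entirely
    to terms reachable from [T]. Following the branches of this covering that keep a given normal
    form leads from [t1] back to [T]. *)
Definition local_conf t T := forall T1, step t T1 -> forall t1, T1 t1 ->
  cov t1 (fun x => exists2 v, T v & red v x).
Definition clocal_conf c T := forall T1, cstep c T1 -> forall c1, T1 c1 ->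
  cov (mu c1) (fun x => exists2 d, T d & red (mu d) x).

Lemma local_confluence :
  (forall t T, step t T -> local_conf t T) /\ (forall c T, cstep c T -> clocal_conf c T).
Proof.
apply: step_cstep_ind.
- move=> t B T1 /step_appP[[t0 [[<-] ->]]|[b [t0 [//]]]|[T0 /step_lamP[T2 h2 ->] ->]|[B1 [v [V [B2 [-> hv ->]]]]]] t1.
  + by move=> h; apply: cov_here; exists t1 => //; exact: red_refl.
  + move=> [_ [t' ht' ->] ->]; apply: cov_step (st_lam _ _) _ => x hx; apply: cov_here.
    have [_ h3] := step_sub_comm.1 _ _ h2 _ sigL (tagl tt B) arity1_sigL.
    by have [w] := h3 _ _ ht' hx; exists w.
  + move=> [v' hv' ->]; apply: cov_step (st_lam _ _) _ => x hx; apply: cov_here.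
    have [_ h3] := stable_step_sub t sigL tt (tagl tt (B1 ++ B2)) (step_stable hv).
    have [w h4 h5] := h3 _ _ hv' (sub_perm (perm_tagl_mid _ _ _ _) hx).
    exists w => //; apply: sub_perm h4; rewrite perm_sym; exact: perm_tagl_mid.
- move=> b t B T1 /step_appP[[t0 [//]]|[b0 [t0 [[<- <-] ->]]]|[T0 /step_muP[T2 h2 ->] ->]|[B1 [v [V [B2 [-> hv ->]]]]]] t1.
  + by move=> h; apply: cov_here; exists t1 => //; exact: red_refl.
  + move=> [_ [[b' t'] ht' ->] ->]; apply: cov_step (st_mu _ _ _) _ => _ [c hc ->]; apply: cov_here.
    have [_ h3] := step_sub_comm.2 _ _ h2 _ sigM (tagl tt (shiftn B)) arity1_sigM.
    have [w h4 h5] := h3 _ _ ht' hc.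
    by exists (mu w) => //; exists w.
  + move=> [v' hv' ->]; apply: cov_step (st_mu _ _ _) _ => _ [c hc ->]; apply: cov_here.
    have [_ h3] := stable_step_subc sigM (b, t) tt (tagl tt (shiftn (B1 ++ B2))) (stable_step_rren id succn (step_stable hv)).
    have pm x : perm_eq (tagl tt (shiftn (B1 ++ x :: B2))) ((tt, rren id succn x) :: tagl tt (shiftn (B1 ++ B2))).
      by rewrite /shiftn !map_cat; exact: perm_tagl_mid.
    have [|w h4 h5] := h3 (rren id succn v') c _ (subc_perm (pm _) hc); first by exists v'.
    exists (mu w) => //; exists w => //; apply: subc_perm h4; rewrite perm_sym; exact: pm.
- move=> t T _ IH T1 /step_lamP[T0 /IH h ->] _ [u /h{}h ->].
  apply: cov_mono (cov_ctx isctx_lam h) _ => _ [x [v hv r] ->].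
  by exists (RLam v); [exists v|exact: red_ctx isctx_lam r].
- move=> b t T _ IH T1 /step_muP[T0 /IH h ->] _ [c /h{}h ->].
  by apply: cov_mono h _ => x [d hd r]; exists (mu d) => //; exists d.
- move=> t T B hs IH T1 /step_appP[[t0 [E ->]]|[b [t0 [E ->]]]|[T0 /IH h0 ->]|[B1 [v [V [B2 [E hv ->]]]]]] t1.
  + subst; have [T0 h0 ->] := step_lamP hs; move=> h.
    have [/(_ _ h) h3 _] := step_sub_comm.1 _ _ h0 _ sigL (tagl tt B) arity1_sigL.
    apply: cov_mono h3 _ => x [v hv hx]; exists (RApp (RLam v) B); last exact: red1 (st_lam _ _) hx.
    by exists (RLam v) => //; exists v.
  + subst; have [T0 h0 ->] := step_muP hs; move=> [c h ->].
    have [/(_ _ h) h3 _] := step_sub_comm.2 _ _ h0 _ sigM (tagl tt (shiftn B)) arity1_sigM.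
    apply: cov_mono h3 _ => _ [[b' t'] [d' [hd hx ->]]]; exists (RApp (RMu b' t') B).
      by exists (RMu b' t') => //; exists (b', t').
    by apply: red1 (st_mu _ _ _) _; exists d'.
  + move=> [u /h0 h ->]; apply: cov_mono (cov_ctx (isctx_fun B) h) _ => _ [x [v hv r] ->].
    by exists (RApp v B); [exists v|exact: red_ctx (isctx_fun B) r].
  + move=> [v' hv' ->]; apply: cov_step (st_fun _ hs) _ => _ [u hu ->]; apply: cov_here.
    exists (RApp u B); first by exists u.
    by rewrite E; apply: red1 (st_bag _ _ _ hv) _; exists v'.
- move=> t B1 v V B2 hs IH T1 /step_appP[[t0 [E ->]]|[b [t0 [E ->]]]|[T0 h0 ->]|[A1 [a [A [A2 [E ha ->]]]]]] t1.
  + subst => h.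
    have [h3 _] := stable_step_sub t0 sigL tt (tagl tt (B1 ++ B2)) (step_stable hs).
    apply: cov_mono (h3 _ (sub_perm (perm_tagl_mid _ _ _ _) h)) _ => x [v' hv' hx].
    exists (RApp (RLam t0) (B1 ++ v' :: B2)); first by exists v'.
    apply: red1 (st_lam _ _) _; apply: sub_perm hx; rewrite perm_sym; exact: perm_tagl_mid.
  + subst => -[c h ->].
    have pm x : perm_eq (tagl tt (shiftn (B1 ++ x :: B2))) ((tt, rren id succn x) :: tagl tt (shiftn (B1 ++ B2))).
      by rewrite /shiftn !map_cat; exact: perm_tagl_mid.
    have [h3 _] := stable_step_subc sigM (b, t0) tt (tagl tt (shiftn (B1 ++ B2))) (stable_step_rren id succn (step_stable hs)).
    apply: cov_mono (h3 _ (subc_perm (pm _) h)) _ => _ [_ [d' [[v' hv' ->] hd ->]]].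
    exists (RApp (RMu b t0) (B1 ++ v' :: B2)); first by exists v'.
    apply: red1 (st_mu _ _ _) _; exists d' => //; apply: subc_perm hd; rewrite perm_sym; exact: pm.
  + move=> [u hu ->]; apply: cov_step (st_bag _ _ _ hs) _ => _ [v' hv' ->]; apply: cov_here.
    exists (RApp t (B1 ++ v' :: B2)); first by exists v'.
    by apply: red1 (st_fun _ h0) _; exists u.
  + case: (cat_cons_inj E) => [[E1 E2 E3]|[M [E1 E2]]|[M [E1 E2]]]; subst.
    * move=> [u /(IH _ ha) h ->].
      apply: cov_mono (cov_ctx (isctx_bag t A1 A2) h) _ => _ [x [v' hv' r] ->].
      by exists (RApp t (A1 ++ v' :: A2)); [exists v'|exact: red_ctx (isctx_bag t A1 A2) r].
    * move=> [u hu ->]; rewrite -catA /=.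
      apply: cov_step (st_bag t B1 (M ++ u :: A2) hs) _ => _ [v' hv' ->]; apply: cov_here.
      exists (RApp t (B1 ++ v' :: M ++ a :: A2)); first by exists v'.
      rewrite -cat_cons catA -[in X in red _ X]cat_cons [in X in red _ X]catA.
      by apply: red1 (st_bag t (B1 ++ v' :: M) A2 ha) _; exists u.
    * move=> [u hu ->]; rewrite -cat_cons catA.
      apply: cov_step (st_bag t (A1 ++ u :: M) B2 hs) _ => _ [v' hv' ->]; apply: cov_here.
      exists (RApp t (A1 ++ a :: M ++ v' :: B2)); first by exists v' => //; rewrite -catA.
      by rewrite -catA; apply: red1 (st_bag t A1 (M ++ v' :: B2) ha) _; exists u.
- move=> a e t T1 /cstepP[[e0 [t0 [[<- <-] ->]]]|[T0 /step_muP[T2 h2 ->] ->]] c1.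
  + by move=> ->; apply: cov_here; exists (rho a (e, t)) => //; exact: red_refl.
  + move=> [_ [[b' t'] hc ->] ->].
    apply: cov_step (st_cmd (cs_rho _ _ _)) _ => _ [_ -> ->]; apply: cov_here.
    exists (rho a (e, t)) => //.
    (* The inner step, possibly itself a [rho], is carried through the renaming [inst a], as an
       instance of commutation with substitution. *)
    have [//|_ h3] := step_sub_comm.2 _ _ h2 unit (rene id (inst a)) [::].
    have [|w [R1 [R2 [u /= [p /sub_rene[_ E1] [_ E2] E3]]]] r] := h3 _ (rho a (b', t')) hc.
      by exists [::], [::], (rren id (inst a) t'); split=> //; apply/sub_rene.
    by move: r; rewrite {1}/mu E2 E1 E3.
- move=> b t T hs IH T1 /cstepP[[e [t0 [E ->]]]|[T0 h0 ->]] c1.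
  + move=> ->; subst; have [T0 h0 ->] := step_muP hs.
    have [//|h3 _] := step_sub_comm.2 _ _ h0 unit (rene id (inst b)) [::].
    have h4 : subc (@rene unit id (inst b)) [::] (e, t0) (rho b (e, t0)).
      by exists [::], [::], (rren id (inst b) t0); split=> //; apply/sub_rene.
    apply: cov_mono (h3 _ h4) _ => _ [[b' t'] [d' [hd [R1 [R2 [u /= [p /sub_rene[_ E1] [_ E2] E3]]]] ->]]].
    exists (b, RMu b' t'); first by exists (RMu b' t') => //; exists (b', t').
    apply: red1 (st_cmd (cs_rho _ _ _)) _; exists (rho b (b', t')) => //.
    by rewrite /mu E2 E1 E3.
  + move=> [u /(IH _ h0) h ->]; apply: cov_mono (cov_ctx (isctx_mu b) h) _ => _ [x [v hv r] ->].
    by exists (b, v); [exists v|exact: red_ctx (isctx_mu b) r].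
Qed.

(** * Strong normalisation and uniqueness of normal forms *)

Fixpoint nmu (t : rterm) : nat :=
  match t with
  | RVar _ => 0
  | RLam t => nmu t
  | RApp t vs => nmu t + sumn [seq nmu v | v <- vs]
  | RMu _ t => (nmu t).+1
  end.

(** A contraction of [(mu a. _b|t|) B] creates at most [N] applications, where
    [N] bounds the number of [mu]'s, but all of them are below one more [mu]:
    hence the weight [N.+1 ^ e] of an application, where [e] decreases under
    [mu] and starts from the number of [mu]'s of the term. *)
Fixpoint wt (N e : nat) (t : rterm) : nat :=
  match t with
  | RVar _ => 1
  | RLam t => (wt N e t).+1
  | RApp t vs => N.+1 ^ e + wt N e t + sumn [seq wt N e v | v <- vs]
  | RMu _ t => (wt N e.-1 t).+1
  end.

Definition rsumn T (h : rterm -> nat) (R : seq (T * rterm)) := sumn [seq h p.2 | p <- R].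

Lemma rsumn_cat T h (R Q : seq (T * rterm)) : rsumn h (R ++ Q) = rsumn h R + rsumn h Q.
Proof. by rewrite /rsumn map_cat sumn_cat. Qed.

Lemma rsumn_perm (T : eqType) h (R Q : seq (T * rterm)) : perm_eq R Q -> rsumn h R = rsumn h Q.
Proof. by move=> p; apply/perm_sumn/perm_map. Qed.

Lemma rsumn_tagl T h (c : T) B : rsumn h (tagl c B) = sumn [seq h v | v <- B].
Proof. by rewrite /rsumn /tagl -map_comp. Qed.

Lemma rsumn_le T h h' (R : seq (T * rterm)) : (forall t, h t <= h' t) -> rsumn h R <= rsumn h' R.
Proof. by move=> le; elim: R => //= p R IH; exact: leq_add. Qed.

Lemma nmu_rren f g t : nmu (rren f g t) = nmu t.
Proof.
elim/rterm_ind_in: t f g => [x|t IH|t vs IH IHvs|b t IH] f g //=; rewrite IH // -map_comp.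
by congr (_ + sumn _); apply/eq_in_map => v /IHvs /=.
Qed.

Lemma wt_rren N e f g t : wt N e (rren f g t) = wt N e t.
Proof.
elim/rterm_ind_in: t e f g => [x|t IH|t vs IH IHvs|b t IH] e f g //=; rewrite IH // -map_comp.
by congr (_ + sumn _); apply/eq_in_map => v /IHvs /=.
Qed.

Lemma leq_sumn_map (U : eqType) (h h' : U -> nat) s : (forall v, v \in s -> h v <= h' v) ->
  sumn [seq h v | v <- s] <= sumn [seq h' v | v <- s].
Proof.
by elim: s => //= v s IH /forall_in_cons[hv /IH]; exact: leq_add.
Qed.

Lemma wt_mono N e e' t : e <= e' -> wt N e t <= wt N e' t.
Proof.
elim/rterm_ind_in: t e e' => [x|t IH|t vs IH IHvs|b t IH] e e' le //=.
- by rewrite ltnS; exact: IH.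
- apply: leq_add; first by apply: leq_add; [rewrite leq_pexp2l|exact: IH].
  by apply: leq_sumn_map => v /IHvs; apply.
- by rewrite ltnS; apply: IH; lia.
Qed.

Lemma rsumn_rmap T h f g (R : seq (T * rterm)) : (forall f g t, h (rren f g t) = h t) ->
  rsumn h (rmap f g R) = rsumn h R.
Proof. by move=> e; rewrite /rsumn /rmap -map_comp; congr sumn; apply: eq_map => p /=. Qed.

Section SubWeight.
Variables (T : eqType) (N : nat).
Implicit Types (s : env T) (R : seq (T * rterm)).

Lemma appl_nmu l R u w : appl l R u w -> nmu w = nmu u + rsumn nmu R.
Proof.
elim: l R u => [|c l IH] R u /=; first by move=> [-> ->]; rewrite addn0.
move=> [B [R' [/(rsumn_perm nmu) -> /IH ->]]] /=.
by rewrite rsumn_cat rsumn_tagl addnA.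
Qed.

Lemma appl_wt e l R u w : appl l R u w ->
  wt N e w = wt N e u + rsumn (wt N e) R + size l * N.+1 ^ e.
Proof.
elim: l R u => [|c l IH] R u /=; first by move=> [-> ->]; rewrite !addn0.
move=> [B [R' [/(rsumn_perm (wt N e)) -> /IH ->]]] /=.
by rewrite rsumn_cat rsumn_tagl mulSn; lia.
Qed.

Lemma sub_nmu s R t w : sub s R t w -> nmu w = nmu t + rsumn nmu R.
Proof.
elim/rterm_ind_in: t s R w => [x|t IH|t vs IH IHvs|b t IH] s R w.
- by rewrite /=; case: (ev s x) => [y [-> ->]|c ->] //=; rewrite /rsumn /= addn0.
- by move=> /= [u /IH E ->] /=; rewrite E rsumn_rmap //; exact: nmu_rren.
- move=> /sub_appP[u [us [R1 [R2 [-> /(rsumn_perm nmu) -> /IH /= -> h]]]]].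
  suff -> : sumn [seq nmu v | v <- us] = sumn [seq nmu v | v <- vs] + rsumn nmu R2 by rewrite rsumn_cat; lia.
  elim: vs us IHvs R2 h => [|v vs IHl] [|u' us] IHvs R2 //=; first by move=> ->.
  have [Hv /IHl Hl] := forall_in_cons IHvs.
  move=> [R3 [R4 [/(rsumn_perm nmu) -> /Hv -> /Hl ->]]]; rewrite rsumn_cat; lia.
- move=> /sub_muP[c [R1 [R2 [u /= [/(rsumn_perm nmu) p /IH h1 /appl_nmu h2 _]]]] ->] /=.
  by move: p; rewrite rsumn_rmap ?rsumn_cat; [lia|exact: nmu_rren].
Qed.

(** Each [mu] of [t] carries one name, which yields at most [A] new applications, all below that
    [mu]: hence the exponent [e.-1]. Resources carried under a [mu] can only lose weight. *)
Lemma sub_wt A e s R t w : (forall b, size (en s b).2 <= A) -> sub s R t w ->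
  wt N e w <= wt N e t + rsumn (wt N e) R + A * nmu t * N.+1 ^ e.-1.
Proof.
elim/rterm_ind_in: t e s R w => [x|t IH|t vs IH IHvs|b t IH] e s R w ar.
- by rewrite /=; case: (ev s x) => [y [-> ->]|c ->] //=; rewrite /rsumn /=; lia.
- move=> /= [u /(IH e) E ->] /=; have := E ar.
  by rewrite rsumn_rmap; [lia|exact: wt_rren].
- move=> /sub_appP[u [us [R1 [R2 [-> /(rsumn_perm (wt N e)) -> /(IH e _ _ _ ar) /= h1 h]]]]].
  suff : sumn [seq wt N e v | v <- us] <= sumn [seq wt N e v | v <- vs] + rsumn (wt N e) R2
           + A * sumn [seq nmu v | v <- vs] * N.+1 ^ e.-1 by rewrite rsumn_cat mulnDr mulnDl; lia.
  elim: vs us IHvs R2 h => [|v vs IHl] [|u' us] IHvs R2 //=.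
  have [Hv /IHl Hl] := forall_in_cons IHvs.
  move=> [R3 [R4 [/(rsumn_perm (wt N e)) -> /(Hv e _ _ _ ar) h2 /Hl h3]]].
  by rewrite rsumn_cat mulnDr mulnDl; lia.
- move=> /sub_muP[c [R1 [R2 [u /= [/(rsumn_perm (wt N e.-1)) p h1 h2 _]]]] ->] /=.
  have ar' : forall b, size (en (upn s) b).2 <= A by case=> //= b'; exact: ar.
  have := IH e.-1 _ _ _ ar' h1; have := appl_wt e.-1 h2.
  have le1 : size (en (upn s) b).2 * N.+1 ^ e.-1 <= A * N.+1 ^ e.-1 by rewrite leq_mul2r ar' orbT.
  have le2 : A * nmu t * N.+1 ^ e.-1.-1 <= A * nmu t * N.+1 ^ e.-1.
    by rewrite leq_mul2l leq_pexp2l ?orbT // leq_pred.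
  have le3 : rsumn (wt N e.-1) R <= rsumn (wt N e) R.
    by apply: rsumn_le => t'; apply: wt_mono; exact: leq_pred.
  move: p le1; rewrite rsumn_rmap ?rsumn_cat /=; last exact: wt_rren.
  rewrite mulnS mulnDl; lia.
Qed.

Lemma subc_wt A e s R c c' : (forall b, size (en s b).2 <= A) -> subc s R c c' ->
  wt N e c'.2 <= wt N e c.2 + rsumn (wt N e) R + A * (nmu c.2).+1 * N.+1 ^ e.
Proof.
move=> ar [R1 [R2 [u [/(rsumn_perm (wt N e)) -> h1 h2 _]]]].
have := sub_wt e ar h1; have := appl_wt e h2.
have le1 : size (en s c.1).2 * N.+1 ^ e <= A * N.+1 ^ e by rewrite leq_mul2r ar orbT.
have le2 : A * nmu c.2 * N.+1 ^ e.-1 <= A * nmu c.2 * N.+1 ^ e.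
  by rewrite leq_mul2l leq_pexp2l ?orbT // leq_pred.
rewrite rsumn_cat mulnS mulnDl; lia.
Qed.

Lemma subc_nmu s R c c' : subc s R c c' -> nmu c'.2 = nmu c.2 + rsumn nmu R.
Proof.
move=> [R1 [R2 [u [/(rsumn_perm nmu) -> /sub_nmu h1 /appl_nmu -> _]]]].
by rewrite h1 rsumn_cat addnA.
Qed.

End SubWeight.

Lemma sumn_wt_mono N e e' vs : e <= e' ->
  sumn [seq wt N e v | v <- vs] <= sumn [seq wt N e' v | v <- vs].
Proof. by move=> le; apply: leq_sumn_map => v _; exact: wt_mono. Qed.

(** Only [rho] erases a [mu], since substitution preserves their total number. The exponent at the
    root drops by as many, so that the body of the surviving [mu] keeps its exponent and the rest of
    the term does not gain weight. The bound [nmu t <= e] keeps [e.-1] from being truncated. *)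
Lemma step_wt N :
  (forall t T, step t T -> forall u, T u -> nmu t <= N -> nmu u <= nmu t /\
     forall e, nmu t <= e -> wt N (e - (nmu t - nmu u)) u < wt N e t) /\
  (forall c T, cstep c T -> forall d, T d -> (nmu c.2).+1 <= N -> nmu d.2 <= nmu c.2 /\
     forall e, nmu c.2 <= e -> wt N (e - (nmu c.2 - nmu d.2)) d.2 < wt N e c.2).
Proof.
apply: step_cstep_ind.
- move=> t B u h leN; have := sub_nmu h; rewrite rsumn_tagl /= => E; rewrite -E subnn.
  split=> // e _; rewrite subn0; have := @sub_wt _ N 0 e sigL _ _ _ (fun=> leqnn 0) h.
  by rewrite rsumn_tagl /= => le; have := expn_gt0 N.+1 e; lia.
- move=> b t B _ [c h ->] leN; have := subc_nmu h.
  have En : sumn [seq nmu v | v <- shiftn B] = sumn [seq nmu v | v <- B].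
    by rewrite /shiftn -map_comp; congr sumn; apply: eq_map => v; exact: nmu_rren.
  rewrite rsumn_tagl En /= => E; have -> : nmu c.2 = nmu t + sumn [seq nmu v | v <- B] by [].
  rewrite -addSn subnn; split=> // -[|e] le; first by move: le; rewrite addSn.
  rewrite subn0 /=.
  have := @subc_wt _ N 1 e _ _ _ _ _ h; rewrite rsumn_tagl /=.
  have -> : sumn [seq wt N e v | v <- shiftn B] = sumn [seq wt N e v | v <- B].
    by rewrite /shiftn -map_comp; congr sumn; apply: eq_map => v; exact: wt_rren.
  move=> /(_ ltac:(by case)) le1; have := sumn_wt_mono N B (leqnSn e).
  have leN' : (nmu t).+1 <= N by move: leN => /=; lia.
  (* At most [N] applications are created, one for each [mu] including the contracted one. As
     [N.+1 ^ e.+1] is [N.+1 ^ e + N * N.+1 ^ e], the vanished application pays for them with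
     something left over. *)
  have le2 : 1 * (nmu t).+1 * N.+1 ^ e <= N * N.+1 ^ e by rewrite mul1n leq_mul2r leN' orbT.
  have := expn_gt0 N.+1 e; rewrite expnS mulSn; lia.
- move=> t T _ IH _ [u hu ->] /= leN; have [h1 h2] := IH _ hu leN; by split=> // e /h2.
- move=> b t T _ IH _ [d hd ->] /= leN; have [/= h1 h2] := IH _ hd leN; split=> // e le.
  have /h2 : nmu t <= e.-1 by lia.
  by rewrite subSS ltnS; have -> : (e - (nmu t - nmu d.2)).-1 = e.-1 - (nmu t - nmu d.2) by lia.
- move=> t T B _ IH _ [u hu ->] /= leN; have [|h1 h2] := IH _ hu; first by lia.
  rewrite subnDr leq_add2r; split=> // e le.
  have /h2 : nmu t <= e by lia.
  have := sumn_wt_mono N B (leq_subr (nmu t - nmu u) e).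
  have : N.+1 ^ (e - (nmu t - nmu u)) <= N.+1 ^ e by rewrite leq_pexp2l // leq_subr.
  lia.
- move=> t B1 v V B2 _ IH _ [u hu ->] /=; rewrite !map_cat !sumn_cat /= => leN.
  have [|h1 h2] := IH _ hu; first by lia.
  set k' := nmu t + _; set k := nmu t + _.
  have -> : k - k' = nmu v - nmu u by rewrite /k /k'; lia.
  split; first by rewrite /k /k'; lia.
  move=> e le; have /h2 : nmu v <= e by move: le; rewrite /k; lia.
  have := sumn_wt_mono N B1 (leq_subr (nmu v - nmu u) e).
  have := sumn_wt_mono N B2 (leq_subr (nmu v - nmu u) e).
  have := wt_mono N t (leq_subr (nmu v - nmu u) e).
  have : N.+1 ^ (e - (nmu v - nmu u)) <= N.+1 ^ e by rewrite leq_pexp2l // leq_subr.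
  rewrite !map_cat !sumn_cat /=; lia.
- move=> a e t _ -> /= leN; rewrite nmu_rren; split=> // -[|e'] // le.
  by rewrite wt_rren /=; have -> : e'.+1 - ((nmu t).+1 - nmu t) = e' by lia.
- by move=> b t T _ IH _ [u hu ->] /= leN; apply: IH hu _; exact: ltnW.
Qed.

Definition msr N t := wt N (nmu t) t.

Lemma step_msr N t T u : step t T -> T u -> nmu t <= N -> msr N u < msr N t /\ nmu u <= N.
Proof.
move=> hs hu leN; have [h1 h2] := (step_wt N).1 _ _ hs _ hu leN; split; last by lia.
by have := h2 _ (leqnn _); rewrite /msr subKn.
Qed.

Lemma sumn_mem (h : rterm -> nat) v vs : v \in vs -> h v <= sumn [seq h v | v <- vs].
Proof.
elim: vs => //= v' vs IH; rewrite inE => /predU1P[->|/IH]; first exact: leq_addr.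
by move=> le; apply: leq_trans le _; exact: leq_addl.
Qed.

Lemma msr_lam N t : msr N t < msr N (RLam t). Proof. exact: leqnn. Qed.
Lemma msr_mu N b t : msr N t < msr N (RMu b t). Proof. exact: leqnn. Qed.
Lemma msr_fun N t B : msr N t < msr N (RApp t B).
Proof.
rewrite /msr /=; have := expn_gt0 N.+1 (nmu t + sumn [seq nmu v | v <- B]).
have := wt_mono N t (leq_addr (sumn [seq nmu v | v <- B]) (nmu t)); lia.
Qed.
Lemma msr_bag N t B v : v \in B -> msr N v < msr N (RApp t B).
Proof.
move=> hv; rewrite /msr /=; have := expn_gt0 N.+1 (nmu t + sumn [seq nmu v | v <- B]).
have := sumn_mem (wt N (nmu t + sumn [seq nmu v | v <- B])) hv.
have : nmu v <= nmu t + sumn [seq nmu v | v <- B] by have := sumn_mem nmu hv; lia.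
move=> /(wt_mono N v); lia.
Qed.

Definition normal u := forall T, ~ step u T.
(** [u] is a summand of the normal form of [t], without mention of the sums in between; [nfP]
    relates this to [nf]. *)
Definition Nf t u := red t u /\ normal u.

Lemma Nf_red t v u : red t v -> Nf v u -> Nf t u.
Proof. by move=> h1 [h2 h3]; split=> //; exact: red_trans h1 h2. Qed.

Lemma Nf_normal u : normal u -> Nf u u.
Proof. by split=> //; exact: red_refl. Qed.

Lemma Nf_normal_eq t u : normal t -> Nf t u -> u = t.
Proof. by move=> h [r _]; case: r h => // {}t T v {}u hs _ _ /(_ _ hs). Qed.

(** The analogue of Newman's lemma for summands. If [u] is reached through another contraction,
    local confluence joins that branch to [T], and the induction on the measure keeps [u] along the
    joining reductions. *)
Lemma Nf_step_aux N n t : nmu t <= N -> msr N t < n -> forall T u, step t T -> Nf t u ->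
  exists2 v, T v & Nf v u.
Proof.
elim: n t => // n IH t leN; rewrite ltnS => lt T u hs [r n1].
case: r leN lt hs n1 => {t u} [t _ _ hs /(_ _ hs) //|t T1 t1 u hs1 ht1 r1 leN lt hs n1].
have [lt1 leN1] := step_msr hs1 ht1 leN.
have h := local_confluence.1 _ _ hs _ hs1 _ ht1.
suff [x [v hv rx] nx] : exists2 x, (exists2 v, T v & red v x) & Nf x u.
  by exists v => //; exact: Nf_red rx nx.
have {leN1}lt1 : msr N t1 < n /\ nmu t1 <= N by split=> //; lia.
have nf1 : Nf t1 u by split.
(* Inside the covering of [t1], each contraction starts from a term of smaller measure, so the
   induction hypothesis selects a summand that still has [u] as a normal form. *)
elim: h lt1 nf1 => {t1 ht1 r1} [x hx _ nx|t1 T2 hs2 _ IH2 [lt1 leN1] nx]; first by exists x.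
have [v hv nv] := IH _ leN1 lt1 _ _ hs2 nx.
have [lt2 leN2] := step_msr hs2 hv leN1.
by apply: (IH2 _ hv) => //; split=> //; lia.
Qed.

Lemma Nf_step t T u : step t T -> Nf t u -> exists2 v, T v & Nf v u.
Proof. exact: Nf_step_aux (leqnn (nmu t)) (ltnSn _) _ _. Qed.

Lemma Nf_cov t P u : cov t P -> Nf t u -> exists2 s, P s & Nf s u.
Proof.
elim=> {t} [t ht nt|t T hs _ IH nt]; first by exists t.
by have [v hv nv] := Nf_step hs nt; exact: IH hv nv.
Qed.

Lemma normal_or_step t : normal t \/ exists T, step t T.
Proof.
by case: (pselect (exists T, step t T)) => [|h]; [right|left=> T hT; apply: h; exists T].
Qed.

Lemma cov_Nf t : cov t (Nf t).
Proof.
have: nmu t <= nmu t by []; move: {2}(nmu t) => N leN.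
have [n lt] := ubnP (msr N t); elim: n t leN lt => // n IH t leN lt.
case: (normal_or_step t) => [h|[T hs]]; first by apply: cov_here; exact: Nf_normal.
apply: (cov_step hs) => v hv; have [lt1 leN1] := step_msr hs hv leN.
apply: cov_mono (IH v leN1 _) _; first by lia.
by move=> u; apply: Nf_red; exact: red1 hs hv.
Qed.

Lemma Nf_ctxP F t u : isctx F -> Nf (F t) u -> exists2 s, Nf t s & Nf (F s) u.
Proof.
by move=> hF /(Nf_cov (cov_ctx hF (cov_Nf t)))[_ [s hs ->] h]; exists s.
Qed.

Lemma Nf_ctx F t s u : isctx F -> Nf t s -> Nf (F s) u -> Nf (F t) u.
Proof. by move=> hF [r _]; apply: Nf_red; exact: red_ctx. Qed.

Lemma Nf_bagP t B u pre : Nf (RApp t (pre ++ B)) u ->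
  exists2 D, List.Forall2 Nf B D & Nf (RApp t (pre ++ D)) u.
Proof.
elim: B pre => [|v B IH] pre h; first by exists [::].
have [v' hv'] := Nf_ctxP (isctx_bag t pre B) h.
rewrite -cat_rcons => /IH[D hD]; rewrite cat_rcons => h'.
by exists (v' :: D) => //; constructor.
Qed.

Lemma Nf_appP t B u : Nf (RApp t B) u ->
  exists s D, [/\ Nf t s, List.Forall2 Nf B D & Nf (RApp s D) u].
Proof.
move=> /(Nf_ctxP (isctx_fun B))[s hs h].
by have [D hD h'] := @Nf_bagP _ _ _ [::] h; exists s, D.
Qed.

Lemma Nf_app t B s D u : Nf t s -> List.Forall2 Nf B D -> Nf (RApp s D) u -> Nf (RApp t B) u.
Proof.
move=> ht hB h; apply: (Nf_ctx (isctx_fun B) ht).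
rewrite -[B]/([::] ++ B); rewrite -[D]/([::] ++ D) in h.
elim: hB {ht} [::] h => // v v' {}B {}D hv _ IH pre h.
by apply: (Nf_ctx (isctx_bag s pre B) hv); rewrite -cat_rcons; apply: IH; rewrite cat_rcons.
Qed.

Lemma normal_lam t : normal t -> normal (RLam t).
Proof. by move=> h T /step_lamP[T0 /h]. Qed.

Lemma Nf_lamP t u : Nf (RLam t) u -> exists2 s, Nf t s & u = RLam s.
Proof.
move=> /(Nf_ctxP isctx_lam)[s hs h]; exists s => //.
by apply: Nf_normal_eq h; apply: normal_lam; case: hs.
Qed.

Lemma Nf_lam t s : Nf t s -> Nf (RLam t) (RLam s).
Proof. by move=> hs; apply: (Nf_ctx isctx_lam hs); apply/Nf_normal/normal_lam; case: hs. Qed.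

Lemma normal_mu b t : normal t -> (forall e t0, t <> RMu e t0) -> normal (RMu b t).
Proof. by move=> h h2 T /step_muP[T0 /cstepP[[e [t0 [/h2]]]|[T1 /h]]]. Qed.

Lemma normal_app t B : normal t -> (forall v, v \in B -> normal v) ->
  (forall t0, t <> RLam t0) -> (forall e t0, t <> RMu e t0) -> normal (RApp t B).
Proof.
move=> h hB h2 h3 T /step_appP[[t0 [/h2]]|[b [t0 [/h3]]]|[T0 /h]|[B1 [v [V [B2 [E]]]]]] //.
by move=> hv _; apply: (hB v) hv; rewrite E mem_cat inE eqxx orbT.
Qed.

(** * Equality of resource terms *)

Section Peq.
Variables (U V : eqType) (E : U -> V -> Prop).

(** Multiset lifting of a relation. For [req] it is [beq], in a form that permutations act on
    directly; it also serves for tagged resources, with [treq]. *)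
Definition peq (l : seq U) (l' : seq V) := exists2 m, perm_eq l' m & List.Forall2 E l m.

Lemma Forall2_catl l1 l2 m : List.Forall2 E (l1 ++ l2) m ->
  exists m1 m2, [/\ m = m1 ++ m2, List.Forall2 E l1 m1 & List.Forall2 E l2 m2].
Proof.
by move=> /List.Forall2_app_inv_l[m1 [m2 [h1 [h2 ->]]]]; exists m1, m2.
Qed.

Lemma Forall2_permr l m m' : List.Forall2 E l m -> perm_eq m m' ->
  exists2 l', perm_eq l l' & List.Forall2 E l' m'.
Proof.
elim: m' l m => [|y m' IH] l m h p.
  move/perm_nilP: p h => -> h; inversion h; subst; by exists [::].
have : y \in m by rewrite (perm_mem p) mem_head.
move=> /splitPr hm; case: hm h p => m1 m2 h p.
have [l1 [l2' [h1 [h2 El]]]] := List.Forall2_app_inv_r _ _ h.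
inversion h2 as [|x ? l2 ? hx h2']; subst.
have [|l' p' h'] := IH _ _ (List.Forall2_app h1 h2'); first by perm_count.
by exists (x :: l'); [perm_count|constructor].
Qed.

Lemma Forall2_perml l l' m : List.Forall2 E l m -> perm_eq l l' ->
  exists2 m', perm_eq m m' & List.Forall2 E l' m'.
Proof.
elim: l' l m => [|y l' IH] l m h p.
  move/perm_nilP: p h => -> h; inversion h; subst; by exists [::].
have : y \in l by rewrite (perm_mem p) mem_head.
move=> /splitPr hl; case: hl h p => l1 l2 h p.
have [m1 [m2' [Em h1 h2]]] := Forall2_catl h.
inversion h2 as [|? x ? m2 hx h2']; subst.
have [|m' p' h'] := IH _ _ (List.Forall2_app h1 h2'); first by perm_count.
by exists (x :: m'); [perm_count|constructor].
Qed.

Lemma peq_perml l l1 l' : perm_eq l l1 -> peq l l' -> peq l1 l'.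
Proof.
move=> p [m pm h]; have [m' pm' h'] := Forall2_perml h p.
by exists m' => //; perm_count.
Qed.

Lemma peq_permr l l' l1 : perm_eq l' l1 -> peq l l' -> peq l l1.
Proof. by move=> p [m pm h]; exists m => //; perm_count. Qed.

Lemma peq_nil : peq [::] [::]. Proof. by exists [::]. Qed.

Lemma peq_nill l : peq [::] l -> l = [::].
Proof. by move=> [m p h]; inversion h; subst; exact/perm_nilP. Qed.

Lemma peq_cons x y l l' : E x y -> peq l l' -> peq (x :: l) (y :: l').
Proof. by move=> h [m p h']; exists (y :: m); [perm_count|constructor]. Qed.

Lemma peq_cat l1 l2 m1 m2 : peq l1 m1 -> peq l2 m2 -> peq (l1 ++ l2) (m1 ++ m2).
Proof.
move=> [k1 p1 h1] [k2 p2 h2]; exists (k1 ++ k2); [perm_count|exact: List.Forall2_app].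
Qed.

Lemma peq_catl l1 l2 m : peq (l1 ++ l2) m ->
  exists m1 m2, [/\ perm_eq m (m1 ++ m2), peq l1 m1 & peq l2 m2].
Proof.
move=> [k p /Forall2_catl[m1 [m2 [Ek h1 h2]]]]; exists m1, m2.
by rewrite -Ek; split=> //; [exists m1|exists m2].
Qed.

Lemma peq_mid l1 x l2 m : peq (l1 ++ x :: l2) m ->
  exists m1 y m2, [/\ m = m1 ++ y :: m2, E x y & peq (l1 ++ l2) (m1 ++ m2)].
Proof.
move=> h; have /(peq_perml (l1 := x :: l1 ++ l2)) : perm_eq (l1 ++ x :: l2) (x :: l1 ++ l2) by perm_count.
move=> /(_ _ h)[k p hk]; inversion hk as [|? y ? k' hxy hk']; subst.
have : y \in m by rewrite (perm_mem p) mem_head.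
move=> /splitPr hm; case: hm p {h hk} => m1 m2 p; exists m1, y, m2; split=> //.
by exists k' => //; perm_count.
Qed.

Lemma peq_mid_intro l1 x l2 m1 y m2 : E x y -> peq (l1 ++ l2) (m1 ++ m2) ->
  peq (l1 ++ x :: l2) (m1 ++ y :: m2).
Proof.
move=> hxy /(peq_cons hxy) h.
apply: (@peq_perml (x :: l1 ++ l2)); first by perm_count.
by apply: (@peq_permr _ (y :: m1 ++ m2)) => //; perm_count.
Qed.

End Peq.

Lemma Forall2_in (U V : eqType) (E E' : U -> V -> Prop) l m : List.Forall2 E l m ->
  (forall x y, x \in l -> y \in m -> E x y -> E' x y) -> List.Forall2 E' l m.
Proof.
elim=> {l m} [|x y l m h _ IH] H; constructor.
  by apply: H => //; exact: mem_head.
by apply: IH => a b ha hb; apply: H; rewrite inE ?ha ?hb orbT.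
Qed.

Lemma peq_in (U V : eqType) (E E' : U -> V -> Prop) l m : peq E l m ->
  (forall x y, x \in l -> y \in m -> E x y -> E' x y) -> peq E' l m.
Proof.
move=> [k p h] H; exists k => //; apply: Forall2_in h _ => x y hx hy.
by apply: H => //; rewrite (perm_mem p).
Qed.

Lemma peq_sym (U V : eqType) (E : U -> V -> Prop) l m : peq E l m -> peq (fun y x => E x y) m l.
Proof.
move=> [k p h]; rewrite perm_sym in p; have [l' pl h'] := Forall2_permr h p.
by exists l' => //; elim: h' => [|x y l0 m0 hxy _ IH]; constructor.
Qed.

Lemma peq_mem (U V : eqType) (E : U -> V -> Prop) l m y : peq E l m -> y \in m ->
  exists2 x, x \in l & E x y.
Proof.
move=> [k p h]; rewrite (perm_mem p) => hy; clear p.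
elim: h hy => // x z l0 m0 hxz _ IH; rewrite inE => /predU1P[->|/IH[x' hx' h']].
  by exists x => //; exact: mem_head.
by exists x' => //; rewrite inE hx' orbT.
Qed.

Lemma peq_mapl (U V W : eqType) (f : W -> U) (E : U -> V -> Prop) l m :
  peq E (map f l) m <-> peq (fun x => E (f x)) l m.
Proof.
split=> -[k p h]; exists k => //.
  elim: l k {p} h => [|x l IH] k h; inversion h; subst; constructor => //; exact: IH.
by elim: h => [|x y l0 m0 h0 _ IH] //=; constructor.
Qed.

Lemma beq_peq B B' : beq B B' <-> peq req B B'.
Proof.
split.
  elim=> [|t t' B0 B1 B2 h _ hB]; first exact: peq_nil.
  exact: (@peq_mid_intro _ _ _ [::]).
move=> [m p h]; elim: h B' p => [|t t' {}B l h _ IH] B' p.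
  by move/perm_nilP: p => ->; constructor.
have : t' \in B' by rewrite (perm_mem p) mem_head.
move=> /splitPr hB; case: hB p => B1 B2 p; constructor=> //.
by apply: IH; perm_count.
Qed.

Lemma req_lamP t u : req (RLam t) u -> exists2 t', u = RLam t' & req t t'.
Proof. by move=> h; inversion h; subst; eexists. Qed.
Lemma req_muP b t u : req (RMu b t) u -> exists2 t', u = RMu b t' & req t t'.
Proof. by move=> h; inversion h; subst; eexists. Qed.
Lemma req_appP t B u : req (RApp t B) u ->
  exists t' B', [/\ u = RApp t' B', req t t' & peq req B B'].
Proof. by move=> h; inversion h; subst; do 2 eexists; split=> //; apply/beq_peq. Qed.
Lemma req_varP x u : req (RVar x) u -> u = RVar x.
Proof. by move=> h; inversion h. Qed.
Lemma req_app_intro t t' B B' : req t t' -> peq req B B' -> req (RApp t B) (RApp t' B').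
Proof. by move=> h1 /beq_peq; constructor. Qed.

Lemma req_refl t : req t t.
Proof.
elim/rterm_ind_in: t => [x|t IH|t vs IH IHvs|b t IH]; try by constructor.
apply: req_app_intro => //; exists vs => //.
elim: vs IHvs => [|v vs IHl] //= /forall_in_cons[hv /IHl hvs]; by constructor.
Qed.

Lemma req_sym t t' : req t t' -> req t' t.
Proof.
elim/rterm_ind_in: t t' => [x|t IH|t vs IH IHvs|b t IH] t'.
- by move=> /req_varP ->; constructor.
- by move=> /req_lamP[u -> /IH]; constructor.
- move=> /req_appP[u [us [-> /IH h1 h2]]]; apply: req_app_intro => //.
  by apply: peq_in (peq_sym h2) _ => x y _ hy; exact: IHvs.
- by move=> /req_muP[u -> /IH]; constructor.
Qed.

Lemma req_trans t t' t'' : req t t' -> req t' t'' -> req t t''.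
Proof.
elim/rterm_ind_in: t t' t'' => [x|t IH|t vs IH IHvs|b t IH] t' t''.
- by move=> /req_varP ->.
- by move=> /req_lamP[u -> /IH h] /req_lamP[u' -> /h]; constructor.
- move=> /req_appP[u [us [-> /IH h1 h2]]] /req_appP[u' [us' [-> /h1 h1' h3]]].
  apply: req_app_intro => //; case: h2 => k p h2.
  have [k' p' h3'] := peq_perml p h3; exists k' => //; clear -h2 h3' IHvs.
  elim: h2 k' h3' IHvs => [|x y l m hxy _ IHl] k' h IHvs; inversion h as [|? z ? k2 hyz h']; subst; constructor.
    exact: (IHvs _ (mem_head _ _)) hxy hyz.
  by apply: IHl => // v hv; apply: IHvs; rewrite inE hv orbT.
- by move=> /req_muP[u -> /IH h] /req_muP[u' -> /h]; constructor.
Qed.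

Lemma peq_req_sym B B' : peq req B B' -> peq req B' B.
Proof. by move=> /peq_sym h; apply: peq_in h _ => x y _ _; exact: req_sym. Qed.

Lemma peq_req_refl B : peq req B B.
Proof. by exists B => //; elim: B => [|v B IH]; constructor => //; exact: req_refl. Qed.

Lemma perm_peq_req B B' : perm_eq B B' -> peq req B B'.
Proof. by move=> p; apply: peq_permr p _; exact: peq_req_refl. Qed.

Lemma req_rren f g t t' : req t t' -> req (rren f g t) (rren f g t').
Proof.
elim/rterm_ind_in: t f g t' => [x|t IH|t vs IH IHvs|b t IH] f g t'.
- by move=> /req_varP ->; constructor.
- by move=> /req_lamP[u -> /IH h] /=; constructor.
- move=> /req_appP[u [us [-> /IH h1 h2]]] /=; apply: req_app_intro => //.
  apply/peq_mapl/peq_sym/peq_mapl/peq_sym.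
  by apply: peq_in h2 _ => x y hx _; exact: IHvs.
- by move=> /req_muP[u -> /IH h] /=; constructor.
Qed.

Definition treq (T : eqType) (p q : T * rterm) := p.1 = q.1 /\ req p.2 q.2.

Lemma treq_rmap (T : eqType) f g (R R' : seq (T * rterm)) :
  peq (@treq T) R R' -> peq (@treq T) (rmap f g R) (rmap f g R').
Proof.
move=> h; apply/peq_mapl/peq_sym/peq_mapl/peq_sym; apply: peq_in h _ => x y _ _ [h1 h2].
by split=> //; exact: req_rren.
Qed.

Lemma treq_tagl (T : eqType) (c : T) B B' : peq req B B' -> peq (@treq T) (tagl c B) (tagl c B').
Proof.
move=> h; apply/peq_mapl/peq_sym/peq_mapl/peq_sym; apply: peq_in h _ => x y _ _ h.
by split.
Qed.

Lemma treq_taglP (T : eqType) (c : T) B R : peq (@treq T) (tagl c B) R ->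
  exists2 B', R = tagl c B' & peq req B B'.
Proof.
move=> h; have E : R = tagl c (map snd R).
  have: forall q, q \in R -> q.1 = c.
    by move=> q /(peq_mem h)[p /mapP[v _ ->] [<-]].
  elim: R {h} => //= -[d v] R IH /forall_in_cons[/= -> /IH {1}->] //.
exists (map snd R) => //; rewrite E in h.
by move: h => /peq_mapl/peq_sym/peq_mapl/peq_sym h; apply: peq_in h _ => x y _ _ [].
Qed.

Lemma subl_perml (T : eqType) (s : env T) R vs us vs' : subl s R vs us -> perm_eq vs vs' ->
  exists2 us', perm_eq us us' & subl s R vs' us'.
Proof.
elim: vs' vs us R => [|v vs' IH] vs us R h p.
  by move/perm_nilP: p h => -> h; exists us.
have : v \in vs by rewrite (perm_mem p) mem_head.
move=> /splitPr hv; case: hv h p => vs1 vs2 h p.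
have [us1 [[|u us2] [R1 [R2 [-> p1 h1]]]]] // := subl_catP h; move=> [R3 [R4 [p2 h2 h3]]].
have [|us' p3 h4] := IH _ _ _ (subl_cat h1 h3); first by perm_count.
exists (u :: us'); first by perm_count.
by exists R3, (R1 ++ R4); split=> //; perm_count.
Qed.

Lemma subl_permr (T : eqType) (s : env T) R vs us us' : subl s R vs us -> perm_eq us us' ->
  exists2 vs', perm_eq vs vs' & subl s R vs' us'.
Proof.
elim: us' vs us R => [|u us' IH] vs us R h p.
  by move/perm_nilP: p h => -> h; exists vs.
have : u \in us by rewrite (perm_mem p) mem_head.
move=> /splitPr hu; case: hu h p => us1 us2 h p.
have [vs1 [[|v vs2] [R1 [R2 [-> p1 h1]]]]] // := subl_catr h; move=> [R3 [R4 [p2 h2 h3]]].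
have [|vs' p3 h4] := IH _ _ _ (subl_cat h1 h3); first by perm_count.
exists (v :: vs'); first by perm_count.
by exists R3, (R1 ++ R4); split=> //; perm_count.
Qed.

Section SubReq.
Variable T : eqType.
Implicit Types (s : env T) (R : seq (T * rterm)).

Lemma appl_req l R R' u u' w : appl l R u w -> req u u' -> peq (@treq T) R R' ->
  exists2 w', appl l R' u' w' & req w w'.
Proof.
elim: l R R' u u' => [|c l IH] R R' u u' /=.
  by move=> [-> ->] hu /peq_nill ->; exists u'.
move=> [B [R1 [p h]]] hu /(peq_perml p)/peq_catl[X1 [X2 [p2 /treq_taglP[B' EB hB] hX]]].
have [w' h1 h2] := IH _ _ _ _ h (req_app_intro hu hB) hX.
by exists w' => //; exists B', X2; rewrite -EB.
Qed.

Lemma sub_req s R R' t t' u : sub s R t u -> req t t' -> peq (@treq T) R R' ->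
  exists2 u', sub s R' t' u' & req u u'.
Proof.
elim/rterm_ind_in: t s R R' t' u => [x|t IH|t vs IH IHvs|b t IH] s R R' t' u.
- move=> h /req_varP -> hR; move: h => /=; case: (ev s x) => [y [E ->]|c E].
    by rewrite E in hR; exists (RVar y); [split=> //; exact: peq_nill hR|constructor].
  rewrite E in hR; have [] := @treq_taglP _ c [:: u] _ hR => B' -> [m p h].
  inversion h as [|? v ? ? hv h']; subst; inversion h'; subst.
  by rewrite (perm_small_eq (s2 := [:: v]) isT p); exists v.
- move=> /= [w h ->] /req_lamP[t1 -> ht] /(treq_rmap succn id) hR.
  by have [w' h1 h2] := IH _ _ _ _ _ h ht hR; exists (RLam w'); [exists w'|constructor].
- move=> /sub_appP[w [ws [R1 [R2 [-> p h1 h2]]]]] /req_appP[t1 [vs1 [-> ht hvs]]].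
  move=> /(peq_perml p)/peq_catl[X1 [X2 [pX hX1 hX2]]].
  have [w' h3 h4] := IH _ _ _ _ _ h1 ht hX1.
  suff [ws' h5 h6] : exists2 ws', subl s X2 vs1 ws' & peq req ws ws'.
    by exists (RApp w' ws'); [exact: sub_app_intro pX h3 h5|exact: req_app_intro].
  case: hvs => l pl hl.
  suff [wl h5 h6] : exists2 wl, subl s X2 l wl & List.Forall2 req ws wl.
    rewrite perm_sym in pl; have [ws' p' h7] := subl_perml h5 pl.
    by exists ws' => //; exists wl => //; rewrite perm_sym.
  clear -hl IHvs h2 hX2.
  elim: hl ws R2 X2 h2 hX2 IHvs => [|v v1 vs0 l0 hv _ IHl] [|w ws] R2 X2 //=.
    by move=> -> /peq_nill -> _; exists [::].
  move=> [R3 [R4 [p h1 h2]]] /(peq_perml p)/peq_catl[X3 [X4 [pX hX1 hX2]]] /forall_in_cons[Hv Hvs].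
  have [w' h3 h4] := Hv _ _ _ _ _ h1 hv hX1.
  have [wl h5 h6] := IHl _ _ _ h2 hX2 Hvs.
  by exists (w' :: wl); [exists X3, X4|constructor].
- move=> /sub_muP[[b' w] [R1 [R2 [w0 /= [p h1 h2 ->]]]] ->] /req_muP[t1 -> ht].
  move=> /(treq_rmap id succn)/(peq_perml p)/peq_catl[X1 [X2 [pX hX1 hX2]]].
  have [w1 h3 h4] := IH _ _ _ _ _ h1 ht hX1.
  have [w2 h5 h6] := appl_req h2 h4 hX2.
  exists (RMu (en (upn s) b).1 w2); last by constructor.
  by exists ((en (upn s) b).1, w2); split=> //; exists X1, X2, w1.
Qed.

Lemma subc_req s R R' b t t' d : subc s R (b, t) d -> req t t' -> peq (@treq T) R R' ->
  exists2 d', subc s R' (b, t') d' & req (mu d) (mu d').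
Proof.
case: d => b' w [R1 [R2 [w0 /= [p h1 h2 ->]]]] ht /(peq_perml p)/peq_catl[X1 [X2 [pX hX1 hX2]]].
have [w1 h3 h4] := sub_req h1 ht hX1.
have [w2 h5 h6] := appl_req h2 h4 hX2.
by exists ((en s b).1, w2); [exists X1, X2, w1|constructor].
Qed.

End SubReq.

Definition sim (T T2 : rterm -> Prop) :=
  (forall v, T v -> exists2 v2, T2 v2 & req v v2) /\
  (forall v2, T2 v2 -> exists2 v, T v & req v v2).

Lemma peq_shiftn B B' : peq req B B' -> peq req (shiftn B) (shiftn B').
Proof.
move=> h; apply/peq_mapl/peq_sym/peq_mapl/peq_sym; apply: peq_in h _ => x y _ _.
exact: req_rren.
Qed.

Lemma step_req :
  (forall t T, step t T -> forall t2, req t t2 -> exists2 T2, step t2 T2 & sim T T2) /\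
  (forall c T, cstep c T -> forall t2, req c.2 t2 -> exists2 T2, cstep (c.1, t2) T2 &
     sim (fun w => exists2 d, T d & w = mu d) (fun w => exists2 d, T2 d & w = mu d)).
Proof.
apply: step_cstep_ind.
- move=> t B _ /req_appP[_ [B' [-> /req_lamP[t' -> ht] hB]]].
  eexists; first exact: st_lam.
  split=> v h; first exact: sub_req h ht (treq_tagl tt hB).
  have [v' h1 h2] := sub_req h (req_sym ht) (treq_tagl tt (peq_req_sym hB)).
  by exists v' => //; exact: req_sym.
- move=> b t B _ /req_appP[_ [B' [-> /req_muP[t' -> ht] hB]]].
  eexists; first exact: st_mu.
  split=> _ [d h ->].
    have [d' h1 h2] := subc_req h ht (treq_tagl tt (peq_shiftn hB)).
    by exists (mu d') => //; exists d'.
  have [d' h1 h2] := subc_req h (req_sym ht) (treq_tagl tt (peq_shiftn (peq_req_sym hB))).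
  by exists (mu d'); [exists d'|exact: req_sym].
- move=> t T _ IH _ /req_lamP[t' -> /IH[T2 h2 [h3 h4]]]; eexists; first exact: st_inlam h2.
  split=> _ [u hu ->].
    by have [v hv e] := h3 _ hu; exists (RLam v); [exists v|constructor].
  by have [v hv e] := h4 _ hu; exists (RLam v); [exists v|constructor].
- by move=> b t T _ IH _ /req_muP[t' -> /IH[T2 h2 h3]]; eexists; first exact: st_cmd h2.
- move=> t T B _ IH _ /req_appP[t' [B' [-> /IH[T2 h2 [h3 h4]] hB]]].
  eexists; first exact: st_fun h2.
  split=> _ [u hu ->].
    by have [v hv e] := h3 _ hu; exists (RApp v B'); [exists v|exact: req_app_intro].
  by have [v hv e] := h4 _ hu; exists (RApp v B); [exists v|exact: req_app_intro].
- move=> t B1 v V B2 _ IH _ /req_appP[t' [B' [-> ht hB]]].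
  have [A1 [v' [A2 [-> hv hA]]]] := peq_mid hB.
  have [V2 h2 [h3 h4]] := IH _ hv.
  eexists; first exact: st_bag h2.
  split=> _ [u hu ->].
    have [x hx e] := h3 _ hu; exists (RApp t' (A1 ++ x :: A2)); first by exists x.
    by apply: req_app_intro => //; exact: peq_mid_intro.
  have [x hx e] := h4 _ hu; exists (RApp t (B1 ++ x :: B2)); first by exists x.
  by apply: req_app_intro => //; exact: peq_mid_intro.
- move=> a e t _ /= /req_muP[t' -> ht]; eexists; first exact: cs_rho.
  have h := req_rren id (inst a) ht.
  split=> _ [_ -> ->].
    by exists (mu (rho a (e, t'))); [eexists|constructor].
  by exists (mu (rho a (e, t))); [eexists|constructor].
- move=> b t T _ IH t' /= /IH[T2 h2 [h3 h4]]; eexists; first exact: cs_in h2.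
  split=> _ [_ [u hu ->] ->].
    by have [v hv e] := h3 _ hu; exists (RMu b v); [exists (b, v) => //; exists v|constructor].
  by have [v hv e] := h4 _ hu; exists (RMu b v); [exists (b, v) => //; exists v|constructor].
Qed.

Lemma red_req t u t2 : red t u -> req t t2 -> exists2 u2, red t2 u2 & req u u2.
Proof.
move=> h; elim: h t2 => {t u} [t|t T v u hs hv _ IH] t2 ht; first by exists t2 => //; exact: red_refl.
have [T2 hs2 [h1 _]] := step_req.1 _ _ hs _ ht.
have [v2 hv2 /IH[u2 r e]] := h1 _ hv.
by exists u2 => //; exact: red_step hs2 hv2 r.
Qed.

Lemma normal_req t t2 : normal t -> req t t2 -> normal t2.
Proof.
by move=> h /req_sym e T hs; have [T2 /h] := step_req.1 _ _ hs _ e.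
Qed.

Lemma Nf_req t u t2 : Nf t u -> req t t2 -> exists2 u2, Nf t2 u2 & req u u2.
Proof.
move=> [r n] e; have [u2 r2 e2] := red_req r e.
by exists u2 => //; split=> //; exact: normal_req n e2.
Qed.

(** * Uniformity *)

(** Not reflexive: the elements of a bag must also be coherent with each other. *)
Inductive coh : rterm -> rterm -> Prop :=
| coh_var x : coh (RVar x) (RVar x)
| coh_lam t t' : coh t t' -> coh (RLam t) (RLam t')
| coh_app t t' (B B' : seq rterm) : coh t t' ->
    (forall v v', v \in B ++ B' -> v' \in B ++ B' -> coh v v') ->
    coh (RApp t B) (RApp t' B')
| coh_mu b t t' : coh t t' -> coh (RMu b t) (RMu b t').

Lemma coh_req t t' u u' : coh t t' -> req t u -> req t' u' -> coh u u'.
Proof.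
move=> h; elim: h u u' => {t t'} [x|t t' _ IH|t t' B B' _ IH _ IHB|b t t' _ IH] u u'.
- by move=> /req_varP -> /req_varP ->; constructor.
- by move=> /req_lamP[w -> h] /req_lamP[w' -> h']; constructor; exact: IH.
- move=> /req_appP[w [D [-> h hD]]] /req_appP[w' [D' [-> h' hD']]]; constructor; first exact: IH.
  have hDD := peq_cat hD hD' => v v' /(peq_mem hDD)[x hx ex] /(peq_mem hDD)[y hy ey].
  exact: IHB hx hy _ _ ex ey.
- by move=> /req_muP[w -> h] /req_muP[w' -> h']; constructor; exact: IH.
Qed.

Lemma coh_rren f g t t' : coh t t' -> coh (rren f g t) (rren f g t').
Proof.
move=> h; elim: h f g => {t t'} [x|t t' _ IH|t t' B B' _ IH _ IHB|b t t' _ IH] f g /=;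
  constructor => // v v'; rewrite -map_cat => /mapP[x hx ->] /mapP[y hy ->]; exact: IHB.
Qed.

Lemma peq_map_inj (U W : eqType) (E : U -> U -> Prop) (E' : W -> W -> Prop) (f : W -> U) l l' :
  (forall x y, x \in l -> y \in l' -> E (f x) (f y) -> E' x y) ->
  peq E (map f l) (map f l') -> peq E' l l'.
Proof.
by move=> H /peq_mapl/peq_sym/peq_mapl/peq_sym h; apply: peq_in h _ => x y hx hy; exact: H.
Qed.

(** The renaming may identify variables or names: coherent terms already carry the same ones at
    corresponding places. *)
Lemma req_rren_coh f g t t' : coh t t' -> req (rren f g t) (rren f g t') -> req t t'.
Proof.
move=> h; elim: h f g => {t t'} [x|t t' _ IH|t t' B B' _ IH _ IHB|b t t' _ IH] f g /=.
- by constructor.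
- by move=> /req_lamP[w [<-] /IH]; constructor.
- move=> /req_appP[w [D [[<- <-] /IH h hD]]]; apply: req_app_intro => //.
  by apply: peq_map_inj hD => x y hx hy; apply: IHB; rewrite mem_cat ?hx ?hy ?orbT.
- by move=> /req_muP[w [<-] /IH]; constructor.
Qed.

(** [p] and [q] may be the same resource, so each resource is also coherent with itself. *)
Definition clique (T : eqType) (R : seq (T * rterm)) :=
  forall p q, p \in R -> q \in R -> p.1 = q.1 -> coh p.2 q.2.

Lemma clique_sub (T : eqType) (R Q : seq (T * rterm)) :
  {subset Q <= R} -> clique R -> clique Q.
Proof. by move=> h c p q /h hp /h hq; exact: c. Qed.

Lemma clique_rmap (T : eqType) f g (R : seq (T * rterm)) : clique R -> clique (rmap f g R).
Proof.
by move=> h p q /mapP[p' hp ->] /mapP[q' hq ->] /= e; apply: coh_rren; exact: h.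
Qed.

Lemma clique_tagl (T : eqType) (c : T) B :
  (forall v v', v \in B -> v' \in B -> coh v v') -> clique (tagl c B).
Proof. by move=> h p q /mapP[v hv ->] /mapP[v' hv' ->] _ /=; exact: h. Qed.

Lemma treq_rmapV (T : eqType) f g (R R' : seq (T * rterm)) : clique (R ++ R') ->
  peq (@treq T) (rmap f g R) (rmap f g R') -> peq (@treq T) R R'.
Proof.
move=> c; apply: peq_map_inj => p q hp hq [/= e h]; split=> //.
by apply: req_rren_coh h; apply: c; rewrite ?mem_cat ?hp ?hq ?orbT.
Qed.

Lemma subl_mem (T : eqType) (s : env T) R vs us u : subl s R vs us -> u \in us ->
  exists v Rv, [/\ v \in vs, {subset Rv <= R} & sub s Rv v u].
Proof.
elim: vs us R => [|v vs IH] [|u' us] R //= [R1 [R2 [p h1 h2]]].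
rewrite inE => /predU1P[->|/(IH _ _ h2)[x [Rx [hx sx h]]]].
  by exists v, R1; split=> // [|q hq]; rewrite ?mem_head // (perm_mem p) mem_cat hq.
exists x, Rx; split=> // [|q /sx hq]; first by rewrite inE hx orbT.
by rewrite (perm_mem p) mem_cat hq orbT.
Qed.

Lemma perm_subset (T : eqType) (R R1 R2 : seq T) : perm_eq R (R1 ++ R2) ->
  {subset R1 <= R} /\ {subset R2 <= R}.
Proof. by move=> p; split=> q hq; rewrite (perm_mem p) mem_cat hq ?orbT. Qed.

Lemma subset_cat (T : eqType) (A A' R R' : seq T) :
  {subset A <= R} -> {subset A' <= R'} -> {subset A ++ A' <= R ++ R'}.
Proof. by move=> h h' q; rewrite !mem_cat => /orP[/h ->|/h' ->]; rewrite ?orbT. Qed.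

Lemma subset_cat2 (T : eqType) (A A' R : seq T) :
  {subset A <= R} -> {subset A' <= R} -> {subset A ++ A' <= R}.
Proof. by move=> h h' q; rewrite !mem_cat => /orP[/h|/h']. Qed.

Section Uniform.
Variable T : eqType.
Implicit Types (s : env T) (R : seq (T * rterm)).

Lemma treq_perm R R' Q Q' : perm_eq R Q -> perm_eq R' Q' -> peq (@treq T) Q Q' ->
  peq (@treq T) R R'.
Proof.
move=> p p' h; rewrite perm_sym in p; rewrite perm_sym in p'.
by apply: peq_perml p _; apply: peq_permr p' _.
Qed.

Lemma appl_coh l R R' u u' w w' : clique (R ++ R') -> coh u u' ->
  appl l R u w -> appl l R' u' w' ->
  coh w w' /\ (req w w' -> req u u' /\ peq (@treq T) R R').
Proof.
elim: l R R' u u' => [|c l IH] R R' u u' cl cu /=.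
  by move=> [-> ->] [-> ->]; split=> // h; split=> //; exact: peq_nil.
move=> [B [Q [p h]]] [B' [Q' [p' h']]].
have [s1 s2] := perm_subset p; have [s1' s2'] := perm_subset p'.
have cB : forall v v', v \in B ++ B' -> v' \in B ++ B' -> coh v v'.
  move=> v v' hv hv'; apply: (cl (c, v) (c, v')) => //.
    by apply: (subset_cat s1 s1'); rewrite -map_cat; exact: map_f.
  by apply: (subset_cat s1 s1'); rewrite -map_cat; exact: map_f.
have [||h1 h2] := IH Q Q' (RApp u B) (RApp u' B') _ _ h h'.
- by apply: clique_sub cl; exact: subset_cat.
- by constructor.
split=> // /h2[/req_appP[_ [_ [[<- <-] hu hB]]] hQ]; split=> //.
by apply: treq_perm p p' _; apply: peq_cat => //; exact: treq_tagl.
Qed.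

(** Coherent terms follow the same clauses of [sub]. If the results are equal, their bags match
    element by element; the elements of [B] and [B'] behind each matched pair are coherent, so the
    induction recovers both their equality and that of the resources they use, which add up to [R]
    and [R']. *)
Lemma sub_coh t t' s R R' u u' : coh t t' -> clique (R ++ R') ->
  sub s R t u -> sub s R' t' u' ->
  coh u u' /\ (req u u' -> req t t' /\ peq (@treq T) R R').
Proof.
move=> h; elim: h s R R' u u' => {t t'} [x|t t' _ IH|t t' B B' _ IH _ IHB|b t t' _ IH] s R R' u u' cl.
- move=> /=; case: (ev s x) => [y [-> ->] [-> ->]|c E E'].
    split=> [|_]; first by constructor.
    by split; [constructor|exact: peq_nil].
  subst; split; first by apply: (cl (c, u) (c, u')); rewrite ?inE ?eqxx ?orbT.
  move=> e; split; first by constructor.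
  by apply: peq_cons; [split|exact: peq_nil].
- move=> /= [w h ->] [w' h' ->].
  have [|h1 h2] := IH _ _ _ _ _ _ h h'; first by rewrite -map_cat; exact: clique_rmap.
  split; first by constructor.
  move=> /req_lamP[_ [<-] /h2[e hR]]; split; first by constructor.
  exact: treq_rmapV hR.
- move=> /sub_appP[w [ws [R1 [R2 [-> p h1 h2]]]]] /sub_appP[w' [ws' [R1' [R2' [-> p' h1' h2']]]]].
  have [s1 s2] := perm_subset p; have [s1' s2'] := perm_subset p'.
  have [|hc hi] := IH _ _ _ _ _ _ h1 h1'; first by apply: clique_sub cl; exact: subset_cat.
  split.
    constructor=> // v v'.
    (* Two elements of the same result bag have to be compared as well, so the origin of an element
       is sought in both sides together. *)
    have hm x : x \in ws ++ ws' -> exists y Ry, [/\ y \in B ++ B', {subset Ry <= R ++ R'} & sub s Ry y x].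
      rewrite mem_cat => /orP[/(subl_mem h2)|/(subl_mem h2')] [y [Ry [hy sy hs]]];
        exists y, Ry; split=> // [|q /sy hq]; rewrite mem_cat ?hy ?orbT //.
        by rewrite s2.
      by rewrite s2' // orbT.
    move=> /hm[y [Ry [hy sy hys]]] /hm[z [Rz [hz sz hzs]]].
    have [|//] := IHB _ _ hy hz s Ry Rz v v' _ hys hzs.
    by apply: clique_sub cl; exact: subset_cat2.
  move=> /req_appP[_ [_ [[<- <-] /hi[ht hR1] [l pl hl]]]].
  (* Reorder [B'] so that what its elements become lines up with the result bag on the left. *)
  have [vs' pvs hvs'] := subl_permr h2' pl.
  suff [hB hR2] : List.Forall2 req B vs' /\ peq (@treq T) R2 R2'.
    split; first by apply: req_app_intro => //; exists vs'.
    by apply: treq_perm p p' _; exact: peq_cat.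
  have : forall v v', v \in B -> v' \in vs' -> forall Q Q' x x',
      {subset Q <= R2} -> {subset Q' <= R2'} -> sub s Q v x -> sub s Q' v' x' ->
      req x x' -> req v v' /\ peq (@treq T) Q Q'.
    move=> v v' hv hv' Q Q' x x' sQ sQ' hx hx' e.
    have [||| _ /(_ e) //] := IHB v v' _ _ s Q Q' x x' _ hx hx'.
    + by rewrite mem_cat hv.
    + by rewrite mem_cat (perm_mem pvs) hv' orbT.
    + apply: clique_sub cl; apply: subset_cat => q; [move=> /sQ|move=> /sQ']; [exact: s2|exact: s2'].
  clear -h2 hvs' hl.
  elim: hl B vs' R2 R2' h2 hvs' => [|x x' ws0 l0 hx _ IHl] [|v B] [|v' vs'] //= R2 R2'.
    by move=> -> -> _; split=> //; exact: peq_nil.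
  move=> [R3 [R4 [p3 h3 h4]]] [R3' [R4' [p3' h3' h4']]] H.
  have [s3 s4] := perm_subset p3; have [s3' s4'] := perm_subset p3'.
  have [e1 e2] := H _ _ (mem_head _ _) (mem_head _ _) _ _ _ _ s3 s3' h3 h3' hx.
  have [|e3 e4] := IHl _ _ _ _ h4 h4'.
    move=> y y' hy hy' Q Q' z z' sQ sQ'; apply: H; rewrite ?inE ?hy ?hy' ?orbT //.
      by move=> q /sQ/s4.
    by move=> q /sQ'/s4'.
  split; first by constructor.
  by apply: treq_perm p3 p3' _; exact: peq_cat.
- move=> /sub_muP[[b1 w] [R1 [R2 [w0 /= [p h1 h2 ->]]]] ->].
  move=> /sub_muP[[b1' w'] [R1' [R2' [w0' /= [p' h1' h2' ->]]]] ->] /=.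
  have [s1 s2] := perm_subset p; have [s1' s2'] := perm_subset p'.
  have cl' : clique (rmap id succn R ++ rmap id succn R').
    by rewrite -map_cat; exact: clique_rmap.
  have [|hc hi] := IH _ _ _ _ _ _ h1 h1'; first by apply: clique_sub cl'; exact: subset_cat.
  have [||hc' hi'] := appl_coh _ _ h2 h2' => //; first by apply: clique_sub cl'; exact: subset_cat.
  split; first by constructor.
  move=> /req_muP[_ [<-] /hi'[/hi[ht hR1] hR2]]; split; first by constructor.
  by apply: (@treq_rmapV _ id succn) => //; apply: treq_perm p p' _; exact: peq_cat.
Qed.

Lemma subc_coh t t' s R R' b d d' : coh t t' -> clique (R ++ R') ->
  subc s R (b, t) d -> subc s R' (b, t') d' ->
  coh (mu d) (mu d') /\ (req (mu d) (mu d') -> req t t' /\ peq (@treq T) R R').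
Proof.
move=> ct cl; case: d d' => [b1 w] [b1' w'].
move=> [R1 [R2 [w0 /= [p h1 h2 ->]]]] [R1' [R2' [w0' /= [p' h1' h2' ->]]]].
have [s1 s2] := perm_subset p; have [s1' s2'] := perm_subset p'.
have [|hc hi] := sub_coh ct _ h1 h1'; first by apply: clique_sub cl; exact: subset_cat.
have [||hc' hi'] := appl_coh _ _ h2 h2' => //; first by apply: clique_sub cl; exact: subset_cat.
split; first by constructor.
move=> /req_muP[_ [<-] /hi'[/hi[ht hR1] hR2]]; split=> //.
by apply: treq_perm p p' _; exact: peq_cat.
Qed.

End Uniform.

Lemma red_msr N t u : red t u -> nmu t <= N -> nmu u <= N /\ msr N u <= msr N t.
Proof.
elim=> // {}t T v {}u hs hv _ IH leN; have [lt le] := step_msr hs hv leN.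
by have [h1 h2] := IH le; split=> //; lia.
Qed.

Lemma coh_lamP t u : coh (RLam t) u -> exists2 t', u = RLam t' & coh t t'.
Proof. by move=> h; inversion h; subst; eexists. Qed.
Lemma coh_muP b t u : coh (RMu b t) u -> exists2 t', u = RMu b t' & coh t t'.
Proof. by move=> h; inversion h; subst; eexists. Qed.
Lemma coh_lamPr t u : coh u (RLam t) -> exists2 t', u = RLam t' & coh t' t.
Proof. by move=> h; inversion h; subst; eexists. Qed.
Lemma coh_muPr b t u : coh u (RMu b t) -> exists2 t', u = RMu b t' & coh t' t.
Proof. by move=> h; inversion h; subst; eexists. Qed.

Lemma Forall2_memr (U V : eqType) (E : U -> V -> Prop) l m y : List.Forall2 E l m -> y \in m ->
  exists2 x, x \in l & E x y.
Proof. by move=> h; apply: peq_mem; exists m. Qed.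

Lemma cases_head t : [\/ exists t0, t = RLam t0, exists b t0, t = RMu b t0 |
  (forall t0, t <> RLam t0) /\ (forall b t0, t <> RMu b t0)].
Proof.
case: t => [x|t|t B|b t].
- by constructor 3.
- by constructor 1; exists t.
- by constructor 3.
- by constructor 2; exists b, t.
Qed.

(** Normalise the immediate subterms, then contract the root, if it is a redex, on both sides at
    once: coherence makes the same rule apply, [sub_coh] and [subc_coh] transport coherence and
    equality through it, and the measure has dropped. One bound [N] serves both terms, so that their
    measures are comparable with the same [n]. *)
Lemma Nf_coh_aux N n t t' u u' : nmu t <= N -> nmu t' <= N -> msr N t < n -> msr N t' < n ->
  coh t t' -> Nf t u -> Nf t' u' -> coh u u' /\ (req u u' -> req t t').
Proof.
elim: n t t' u u' => // n IH t t' u u' leN leN' lt lt' ct.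
case: ct leN leN' lt lt' => {t t'} [x|t t' ct|t t' B B' ct cB|b t t' ct] leN leN' lt lt'.
- have nx : normal (RVar x) by move=> T hT; inversion hT.
  by move=> /(Nf_normal_eq nx) -> /(Nf_normal_eq nx) ->; split=> //; constructor.
- move=> /Nf_lamP[s hs ->] /Nf_lamP[s' hs' ->].
  have := msr_lam N t; have := msr_lam N t' => l1 l2.
  have [||||h1 h2] := IH t t' s s' _ _ _ _ ct hs hs' => //; try lia.
  split; first by constructor.
  by move=> /req_lamP[_ [<-] /h2]; constructor.
- move=> /[dup] hA /Nf_appP[s [D [hs hD hu]]] /[dup] hA' /Nf_appP[s' [D' [hs' hD' hu']]].
  have l1 := msr_fun N t B; have l1' := msr_fun N t' B'.
  have [||||hc hi] := IH t t' s s' _ _ _ _ ct hs hs'; try by [move: leN leN' => /=; lia | lia].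
  have leB v : v \in B ++ B' -> nmu v <= N /\ msr N v < n.
    rewrite mem_cat => /orP[] hv.
      by have := sumn_mem nmu hv; have := msr_bag N t hv; move: leN => /=; lia.
    by have := sumn_mem nmu hv; have := msr_bag N t' hv; move: leN' => /=; lia.
  have hDB x : x \in D ++ D' -> exists2 v, v \in B ++ B' & Nf v x.
    by rewrite mem_cat => /orP[/(Forall2_memr hD)|/(Forall2_memr hD')] [v hv h];
      exists v => //; rewrite mem_cat hv ?orbT.
  have cD x x' : x \in D ++ D' -> x' \in D ++ D' -> coh x x'.
    move=> /hDB[v hv hx] /hDB[v' hv' hx'].
    have [l2 l3] := leB _ hv; have [l2' l3'] := leB _ hv'.
    by have [] := IH v v' x x' l2 l2' l3 l3' (cB _ _ hv hv') hx hx'.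
  (* The permutation that matches [D'] with [D] is carried back to [B']; the induction hypothesis
     then applies to each matched pair of arguments. *)
  have iD : peq req D D' -> peq req B B'.
    move=> [m p hm].
    have [B2 pB hB2] := Forall2_permr hD' p; exists B2 => //.
    have sub2 v : v \in B2 -> v \in B' by rewrite (perm_mem pB).
    have : forall v v' x x', v \in B -> v' \in B2 -> Nf v x -> Nf v' x' -> req x x' -> req v v'.
      move=> v v' x x' hv /sub2 hv' hx hx'.
      have hv1 : v \in B ++ B' by rewrite mem_cat hv.
      have hv2 : v' \in B ++ B' by rewrite mem_cat hv' orbT.
      have [l2 l3] := leB _ hv1; have [l2' l3'] := leB _ hv2.
      by have [] := IH v v' x x' l2 l2' l3 l3' (cB _ _ hv1 hv2) hx hx'.
    clear -hD hm hB2.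
    elim: hm B B2 hD hB2 => [|x x' D0 m0 hx _ IHm] B B2 hD hB2 H;
      inversion hD as [|v ? Bt ? hv hD2]; inversion hB2 as [|v' ? B2t ? hv' hB3]; subst; constructor.
      exact: (H _ _ _ _ (mem_head _ _) (mem_head _ _) hv hv').
    apply: IHm => // w w' y y' hw hw'; apply: H; by rewrite inE ?hw ?hw' orbT.
  have iA : req s s' -> peq req D D' -> req (RApp t B) (RApp t' B').
    by move=> /hi h1 /iD h2; exact: req_app_intro.
  (* Normalising the subterms does not raise the measure, so a contraction at the root brings it
     strictly below [n]. *)
  have redA r r0 E E0 : Nf r r0 -> List.Forall2 Nf E E0 -> red (RApp r E) (RApp r0 E0).
    clear=> -[hr _] hE; apply: red_trans (red_ctx (isctx_fun E) hr) _.
    rewrite -[E]/([::] ++ E) -[E0]/([::] ++ E0).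
    elim: hE [::] => [|x y {}E {}E0 [hx _] _ IHE] pre; first exact: red_refl.
    apply: red_trans (red_ctx (isctx_bag _ pre E) hx) _; rewrite -!cat_rcons; exact: IHE.
  have [l2 l3] := red_msr (redA _ _ _ _ hs hD) leN.
  have [l2' l3'] := red_msr (redA _ _ _ _ hs' hD') leN'.
  (* [s'] begins with the same constructor as [s], by coherence: both applications contract by the
     same rule, or both are normal. *)
  case: (cases_head s) => [[r E]|[b [r E]]|[n1 n2]].
  + subst; have [r' E' cr] := coh_lamP hc; subst.
    have [v hv nv] := Nf_step (st_lam _ _) hu; have [v' hv' nv'] := Nf_step (st_lam _ _) hu'.
    have [l4 l5] := step_msr (st_lam _ _) hv l2; have [l4' l5'] := step_msr (st_lam _ _) hv' l2'.
    have [|cv iv] := sub_coh cr _ hv hv'; first by rewrite -map_cat; exact: clique_tagl.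
    have [||||h1 h2] := IH v v' u u' _ _ _ _ cv nv nv' => //; try lia.
    split=> // /h2/iv[e1 /treq_taglP[D2 E2 e2]]; apply: iA; first by constructor.
    by move: e2; rewrite -(_ : D' = D2) //; apply: inj_map E2 => ? ? [].
  + subst; have [r' E' cr] := coh_muP hc; subst.
    have [_ [d hd ->] nv] := Nf_step (st_mu _ _ _) hu; have [_ [d' hd' ->] nv'] := Nf_step (st_mu _ _ _) hu'.
    have [|l4 l5] := step_msr (u := mu d) (st_mu _ _ _) _ l2; first by exists d.
    have [|l4' l5'] := step_msr (u := mu d') (st_mu _ _ _) _ l2'; first by exists d'.
    have cl : clique (tagl tt D ++ tagl tt D') by rewrite -map_cat; exact: clique_tagl.
    have [|cv iv] := subc_coh cr _ hd hd'.
      by rewrite !tagl_shiftn -map_cat; exact: clique_rmap.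
    have [||||h1 h2] := IH (mu d) (mu d') u u' _ _ _ _ cv nv nv' => //; try lia.
    split=> // /h2/iv[e1]; rewrite !tagl_shiftn => /(treq_rmapV cl)/treq_taglP[D2 E2 e2].
    apply: iA; first by constructor.
    by move: e2; rewrite -(_ : D' = D2) //; apply: inj_map E2 => ? ? [].
  + have nD x : x \in D -> normal x by move=> /(Forall2_memr hD)[v _ []].
    have nD' x : x \in D' -> normal x by move=> /(Forall2_memr hD')[v _ []].
    have -> := Nf_normal_eq (normal_app hs.2 nD n1 n2) hu.
    have -> : u' = RApp s' D'.
      apply: Nf_normal_eq hu'; apply: normal_app hs'.2 nD' _ _ => [t0 E|e t0 E]; rewrite E in hc.
        by have [? /n1] := coh_lamPr hc.
      by have [? /n2] := coh_muPr hc.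
    split; first by constructor.
    by move=> /req_appP[_ [_ [[<- <-] e1 e2]]]; exact: iA.
- move=> /(Nf_ctxP (isctx_mu b))[s hs hu] /(Nf_ctxP (isctx_mu b))[s' hs' hu'].
  have l1 := msr_mu N b t; have l1' := msr_mu N b t'.
  have [||||hc hi] := IH t t' s s' _ _ _ _ ct hs hs'; try by [exact: ltnW | lia].
  have [l2 l3] := red_msr (red_ctx (isctx_mu b) hs.1) leN.
  have [l2' l3'] := red_msr (red_ctx (isctx_mu b) hs'.1) leN'.
  (* The body being normal, [rho] is the only contraction that can remain, and coherence makes it
     available on both sides or on neither. *)
  case: (pselect (exists e r, s = RMu e r)) => [[e [r E]]|nmu].
    subst; have [r' E' cr] := coh_muP hc; subst.
    have [_ [_ -> ->] nv] := Nf_step (st_cmd (cs_rho _ _ _)) hu.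
    have [_ [_ -> ->] nv'] := Nf_step (st_cmd (cs_rho _ _ _)) hu'.
    have [|l4 l5] := step_msr (u := mu (rho b (e, r))) (st_cmd (cs_rho _ _ _)) _ l2; first by eexists.
    have [|l4' l5'] := step_msr (u := mu (rho b (e, r'))) (st_cmd (cs_rho _ _ _)) _ l2'; first by eexists.
    have cv : coh (mu (rho b (e, r))) (mu (rho b (e, r'))) by constructor; exact: coh_rren.
    have [||||h1 h2] := IH _ _ u u' _ _ _ _ cv nv nv' => //; try lia.
    split=> // /h2/req_muP[_ [<-] /(req_rren_coh cr) e1].
    by constructor; apply: hi; constructor.
  have -> : u = RMu b s.
    by apply: Nf_normal_eq hu; apply: normal_mu hs.2 _ => e r E; apply: nmu; exists e, r.
  have -> : u' = RMu b s'.
    apply: Nf_normal_eq hu'; apply: normal_mu hs'.2 _ => e r E; rewrite E in hc.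
    by have [r' E' _] := coh_muPr hc; apply: nmu; exists e, r'.
  split; first by constructor.
  by move=> /req_muP[_ [<-] /hi]; constructor.
Qed.

Lemma Nf_coh t t' u u' : coh t t' -> Nf t u -> Nf t' u' -> coh u u' /\ (req u u' -> req t t').
Proof.
set N := maxn (nmu t) (nmu t'); set n := maxn (msr N t) (msr N t').
by apply: (@Nf_coh_aux N n.+1); rewrite ?ltnS ?leq_maxl ?leq_maxr.
Qed.

(** * Sums *)

Lemma In_mem (U : eqType) (x : U) l : List.In x l <-> x \in l.
Proof.
elim: l => [|y l IH] //=; rewrite inE IH; split=> [[->|->]|/predU1P[->|]]; rewrite ?eqxx ?orbT //.
  by left.
by right.
Qed.

Lemma splits_perm B p : p \in splits B -> perm_eq B (p.1 ++ p.2).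
Proof.
elim: B p => [|v B IH] p /=; first by rewrite inE => /eqP ->.
rewrite mem_cat => /orP[] /mapP[q /IH h ->] /=; perm_count.
Qed.

Lemma perm_splits (B B1 B2 : seq rterm) : perm_eq B (B1 ++ B2) ->
  exists2 p, p \in splits B & perm_eq B1 p.1 /\ perm_eq B2 p.2.
Proof.
elim: B B1 B2 => [|v B IH] B1 B2 p /=.
  by exists ([::], [::]); [rewrite inE|case: B1 B2 p => [|? ?] [|? ?] // /perm_size].
case: (perm_cons_catP p) => -[D pD /IH[q hq [p1 p2]]].
  exists (v :: q.1, q.2); last by split=> //=; perm_count.
  by rewrite mem_cat (map_f (fun p => (v :: p.1, p.2)) hq).
exists (q.1, v :: q.2); last by split=> //=; perm_count.
by rewrite mem_cat (map_f (fun p => (p.1, v :: p.2)) hq) orbT.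
Qed.

(** The choice of a weak composition and of a summand for each part, made one argument at a time:
    the recursion of [subl]. *)
Fixpoint distrl (fs : seq (bag -> rsum)) (B us : seq rterm) : Prop :=
  match fs, us with
  | [::], [::] => B = [::]
  | f :: fs, u :: us => exists2 p, p \in splits B & u \in f p.1 /\ distrl fs p.2 us
  | _, _ => False
  end.

Lemma distrlP fs B us : distrl fs B us <->
  exists2 Bs, Bs \in wcomps (size fs) B & us \in bag_of_sums [seq p.1 p.2 | p <- zip fs Bs].
Proof.
elim: fs B us => [|f fs IH] B us /=.
  split; first by case: us => // ->; exists [::]; rewrite ?inE.
  case: B => [|v B] [Bs] //; rewrite inE => /eqP ->; rewrite inE => /eqP ->//.
split.
  case: us => // u us [p hp [hu /IH[Bs hBs hus]]].
  exists (p.1 :: Bs); first by apply/allpairsPdep; exists p, Bs.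
  by apply/allpairsPdep; exists u, us.
move=> [_ /allpairsPdep[p [Bs [hp hBs ->]]] /allpairsPdep[u [us' [hu hus ->]]]].
by exists p => //; split=> //; apply/IH; exists Bs.
Qed.

Lemma distr_appP f fs B w : w \in distr_app f fs B <->
  exists u us, w = RApp u us /\ distrl (f :: fs) B (u :: us).
Proof.
split.
  move=> /flatten_mapP[_ /allpairsPdep[p [Bs [hp hBs ->]]] /allpairsPdep[u [us [hu hus ->]]]].
  by exists u, us; split=> //; exists p => //; split=> //; apply/distrlP; exists Bs.
move=> [u [us [-> [p hp [hu /distrlP[Bs hBs hus]]]]]].
apply/flatten_mapP; exists (p.1 :: Bs); first by apply/allpairsPdep; exists p, Bs.
by apply/allpairsPdep; exists u, us.
Qed.

Lemma tagl_cat (T : eqType) (c : T) A B : tagl c (A ++ B) = tagl c A ++ tagl c B.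
Proof. exact: map_cat. Qed.

Lemma taglK (T : eqType) (c : T) B : map snd (tagl c B) = B.
Proof. by rewrite /tagl -map_comp map_id. Qed.

Lemma tagl_tt (R : seq (unit * rterm)) : R = tagl tt (map snd R).
Proof. by elim: R => //= -[[] v] R {1}->. Qed.

Lemma perm_tagl_tt (R1 R2 : seq (unit * rterm)) B : perm_eq (tagl tt B) (R1 ++ R2) ->
  exists2 p, p \in splits B & perm_eq R1 (tagl tt p.1) /\ perm_eq R2 (tagl tt p.2).
Proof.
rewrite (tagl_tt R1) (tagl_tt R2) -tagl_cat => /(perm_map snd); rewrite !taglK.
move=> /perm_splits[p hp [p1 p2]]; exists p => //.
by split; apply: perm_map.
Qed.

Section Distr.
Variables (s : env unit) (F : rterm -> bag -> rsum).

Lemma distrl_subl vs B us :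
  (forall v, v \in vs -> forall B u, u \in F v B -> sub s (tagl tt B) v u) ->
  distrl [seq F v | v <- vs] B us -> subl s (tagl tt B) vs us.
Proof.
elim: vs B us => [|v vs IH] B [|u us] //=; first by move=> _ ->.
move=> /forall_in_cons[hv /IH hvs] [p /splits_perm hp [/hv h1 /hvs h2]].
by exists (tagl tt p.1), (tagl tt p.2); split=> //; rewrite -tagl_cat; exact: perm_map.
Qed.

Lemma subl_distrl vs R B us :
  (forall v, v \in vs -> forall R B u, sub s R v u -> perm_eq R (tagl tt B) ->
     exists2 u', u' \in F v B & req u u') ->
  subl s R vs us -> perm_eq R (tagl tt B) ->
  exists2 us', distrl [seq F v | v <- vs] B us' & List.Forall2 req us us'.
Proof.
elim: vs R B us => [|v vs IH] R B [|u us] //=.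
  move=> _ ->; rewrite perm_sym => /perm_nilP; case: B => // _; by exists [::].
move=> /forall_in_cons[hv /IH hvs] [R1 [R2 [p h1 h2]]] pB.
have [|q hq [p1 p2]] := @perm_tagl_tt R1 R2 B; first by perm_count.
have [u' hu' e1] := hv _ _ _ h1 p1; have [us' hus' e2] := hvs _ _ _ h2 p2.
by exists (u' :: us'); [exists q|constructor].
Qed.

Lemma distr_app_sub t vs B w :
  (forall B u, u \in F t B -> sub s (tagl tt B) t u) ->
  (forall v, v \in vs -> forall B u, u \in F v B -> sub s (tagl tt B) v u) ->
  w \in distr_app (F t) [seq F v | v <- vs] B -> sub s (tagl tt B) (RApp t vs) w.
Proof.
move=> ht hvs /distr_appP[u [us [-> h]]]; rewrite sub_app; exists u, us; split=> //.
by apply: (@distrl_subl (t :: vs)) => // v; rewrite inE => /predU1P[->//|]; exact: hvs.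
Qed.

Lemma sub_distr_app t vs R B w :
  (forall R B u, sub s R t u -> perm_eq R (tagl tt B) -> exists2 u', u' \in F t B & req u u') ->
  (forall v, v \in vs -> forall R B u, sub s R v u -> perm_eq R (tagl tt B) ->
     exists2 u', u' \in F v B & req u u') ->
  sub s R (RApp t vs) w -> perm_eq R (tagl tt B) ->
  exists2 w', w' \in distr_app (F t) [seq F v | v <- vs] B & req w w'.
Proof.
move=> ht hvs; rewrite sub_app => -[u [us [-> h]]] p.
have [|us' h1 h2] := @subl_distrl (t :: vs) R B (u :: us) _ h p.
  by move=> v; rewrite inE => /predU1P[->//|]; exact: hvs.
inversion h2 as [|? u1 ? us1 hu hus]; subst.
exists (RApp u1 us1); first by apply/distr_appP; exists u1, us1.
by apply: req_app_intro => //; exists us1.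
Qed.

End Distr.

(** [lsubst] counts the binders it crosses in an index instead of lifting an environment. These are
    the lifted forms of [sigL] and [sigM]. *)
Definition sigLk k : env unit :=
  Env (fun y => if y == k then inr tt else inl (unbump k y)) (fun b => (b, [::])).
Definition sigMk a : env unit :=
  Env inl (fun b => (b, if b == a then [:: tt] else [::])).

Lemma sigLk0 : sigLk 0 = sigL.
Proof. by congr Env; apply/funext; case=> // y /=; rewrite /unbump /= subn1. Qed.
Lemma sigMk0 : sigMk 0 = sigM.
Proof. by congr Env; apply/funext; case. Qed.
Lemma upv_sigLk k : upv (sigLk k) = sigLk k.+1.
Proof.
congr Env; apply/funext; case=> // y /=; rewrite eqSS; case: eqP => // _.
by congr inl; rewrite /unbump; lia.
Qed.
Lemma upn_sigLk k : upn (sigLk k) = sigLk k.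
Proof. by congr Env; apply/funext; case. Qed.
Lemma upv_sigMk k : upv (sigMk k) = sigMk k.
Proof. by congr Env; apply/funext; case. Qed.
Lemma upn_sigMk k : upn (sigMk k) = sigMk k.+1.
Proof. by congr Env; apply/funext; case. Qed.

Lemma lsubst_sub k B t u : u \in lsubst k B t -> sub (sigLk k) (tagl tt B) t u.
Proof.
elim/rterm_ind_in: t k B u => [x|t IH|t vs IH IHvs|b t IH] k B u.
- rewrite /=; case: eqP => _; first by case: B => [|v [|]] //; rewrite inE => /eqP ->.
  by case: B => //; rewrite inE => /eqP ->.
- by move=> /mapP[w /IH h ->]; exists w => //; rewrite upv_sigLk -tagl_shiftv.
- by move=> /= h; apply: (distr_app_sub (F := fun v B => lsubst k B v)) h => *; [apply: IH|apply: IHvs].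
- move=> /mapP[w /IH h ->]; rewrite sub_mu upn_sigLk -tagl_shiftn.
  by exists (b, w); split=> //; exists (tagl tt (shiftn B)), [::], w; rewrite cats0.
Qed.

Lemma sub_lsubst k R B t u : sub (sigLk k) R t u -> perm_eq R (tagl tt B) ->
  exists2 u', u' \in lsubst k B t & req u u'.
Proof.
elim/rterm_ind_in: t k R B u => [x|t IH|t vs IH IHvs|b t IH] k R B u.
- rewrite /=; case: eqP => _.
    move=> ->; rewrite perm_sym => /(perm_small_eq (s2 := [:: _]) isT).
    case: B => [|v [|]] // [->]; exists u; [exact: mem_head|exact: req_refl].
  move=> [-> ->]; rewrite perm_sym => /perm_nilP; case: B => // _.
  by eexists; [exact: mem_head|exact: req_refl].
- rewrite /= upv_sigLk => -[w h ->] p.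
  have [|w' h1 h2] := IH _ _ (shiftv B) _ h; first by rewrite tagl_shiftv; exact: rmap_perm.
  by exists (RLam w'); [exact: map_f|constructor].
- move=> h p; apply: (sub_distr_app (F := fun v B => lsubst k B v)) h p.
    by move=> R' B' u'; exact: IH.
  by move=> v hv R' B' u'; exact: IHvs.
- rewrite sub_mu upn_sigLk => -[[b' w] [[R1 [R2 [w0 /= [p1 h [E ->] ->]]]] ->]] p.
  have [|w' h1 h2] := IH _ _ (shiftn B) _ h.
    by rewrite E cats0 in p1; rewrite tagl_shiftn; have := rmap_perm id succn p => p2; perm_count.
  by exists (RMu b w'); [exact: (map_f (RMu b))|constructor].
Qed.

Section Named.
Variables (a b : nat) (t : rterm).

Lemma named_lapp_subc B u :
  (forall B u, u \in lapp a B t -> sub (sigMk a) (tagl tt B) t u) ->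
  u \in named_lapp (fun B' => lapp a B' t) a b B -> subc (sigMk a) (tagl tt B) (b, t) (b, u).
Proof.
move=> ht; rewrite /named_lapp; case: (eqVneq b a) => [E|ne].
  move=> /flatten_mapP[p /splits_perm hp /mapP[w /ht h ->]].
  exists (tagl tt p.1), (tagl tt p.2), w; split=> //=.
    by rewrite -tagl_cat; exact: perm_map.
  by rewrite E eqxx; exists p.2, [::]; rewrite cats0.
move=> /ht h; exists (tagl tt B), [::], u; rewrite cats0 /= (negbTE ne); by split.
Qed.

(** Up to [req] only: the bag produced by [splits] keeps the order of [B], whereas [appl] accepts
    any order. *)
Lemma subc_named_lapp R B d :
  (forall R B u, sub (sigMk a) R t u -> perm_eq R (tagl tt B) ->
     exists2 u', u' \in lapp a B t & req u u') ->
  subc (sigMk a) R (b, t) d -> perm_eq R (tagl tt B) ->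
  exists2 u, u \in named_lapp (fun B' => lapp a B' t) a b B & d.1 = b /\ req d.2 u.
Proof.
move=> ht; case: d => b' w [R1 [R2 [w0 /= [p1 h1 h2 ->]]]] p.
rewrite /named_lapp; case: (eqVneq b a) h2 => [E|ne].
  move=> [D [D' [pD [ED ->]]]]; rewrite ED cats0 in pD.
  have [|q hq [q1 q2]] := @perm_tagl_tt R1 R2 B; first by perm_count.
  have [u hu e] := ht _ _ _ h1 q1.
  exists (RApp u q.2).
    by apply/flatten_mapP; exists q => //; apply/mapP; exists u.
  split=> //; apply: req_app_intro => //; apply: perm_peq_req.
  have : perm_eq (tagl tt D) (tagl tt q.2) by perm_count.
  by move=> /(perm_map snd); rewrite !taglK.
move=> [E ->]; rewrite E cats0 in p1.
have [|u hu e] := ht R1 B _ h1; first by perm_count.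
by exists u.
Qed.

End Named.

Lemma lapp_sub a B t u : u \in lapp a B t -> sub (sigMk a) (tagl tt B) t u.
Proof.
elim/rterm_ind_in: t a B u => [x|t IH|t vs IH IHvs|b t IH] a B u.
- by rewrite /=; case: B => //; rewrite inE => /eqP ->.
- by move=> /mapP[w /IH h ->]; exists w => //; rewrite upv_sigMk -tagl_shiftv.
- by move=> /= h; apply: (distr_app_sub (F := fun v B => lapp a B v)) h => *; [apply: IH|apply: IHvs].
- move=> /mapP[w h ->]; rewrite sub_mu upn_sigMk -tagl_shiftn.
  by exists (b, w); split=> //; apply: named_lapp_subc h => *; exact: IH.
Qed.

Lemma sub_lapp a R B t u : sub (sigMk a) R t u -> perm_eq R (tagl tt B) ->
  exists2 u', u' \in lapp a B t & req u u'.
Proof.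
elim/rterm_ind_in: t a R B u => [x|t IH|t vs IH IHvs|b t IH] a R B u.
- move=> [-> ->]; rewrite perm_sym => /perm_nilP; case: B => // _.
  by eexists; [exact: mem_head|exact: req_refl].
- rewrite /= upv_sigMk => -[w h ->] p.
  have [|w' h1 h2] := IH _ _ (shiftv B) _ h; first by rewrite tagl_shiftv; exact: rmap_perm.
  by exists (RLam w'); [exact: map_f|constructor].
- move=> h p; apply: (sub_distr_app (F := fun v B => lapp a B v)) h p.
    by move=> R' B' u'; exact: IH.
  by move=> v hv R' B' u'; exact: IHvs.
- rewrite sub_mu upn_sigMk => -[d [h ->]] p.
  have [||u' h1 [-> h2]] := subc_named_lapp (B := shiftn B) _ h.
  + by move=> R' B' u'; exact: IH.
  + by rewrite tagl_shiftn; exact: rmap_perm.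
  by exists (RMu b u'); [exact: (map_f (RMu b))|constructor].
Qed.

Definition lists (T : rsum) (T' : rterm -> Prop) :=
  (forall u, u \in T -> T' u) /\ (forall v, T' v -> exists2 u, u \in T & req v u).

Lemma lists_map F T T' : (forall v u, req v u -> req (F v) (F u)) -> lists T T' ->
  lists [seq F u | u <- T] (fun w => exists2 u, T' u & w = F u).
Proof.
move=> hF [h1 h2]; split=> [_ /mapP[u /h1 hu ->]|_ [u /h2[v hv e] ->]]; first by exists u.
by exists (F v); [exact: map_f|exact: hF].
Qed.

Lemma rstep_step t T : rstep t T -> exists2 T', step t T' & lists T T'.
Proof.
elim=> {t T} [t B|b t B|a e t|t T _ [T' hs h]|b t T _ [T' hs h]|t T B _ [T' hs h]|t v V B1 B2 _ [V' hs h]].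
- eexists; first exact: st_lam.
  rewrite -sigLk0; split=> u; first exact: lsubst_sub.
  by move=> hu; apply: sub_lsubst hu _.
- eexists; first exact: st_mu.
  rewrite -sigMk0; split.
    move=> _ /mapP[u h ->]; exists (b, u) => //.
    by apply: named_lapp_subc h => B' u'; exact: lapp_sub.
  move=> _ [d hd ->].
  have [||u h1 [E h2]] := subc_named_lapp (B := shiftn B) _ hd => //; first by move=> R' B' u'; exact: sub_lapp.
  by exists (RMu b u); [exact: (map_f (RMu b))|rewrite /mu E; constructor].
- eexists; first exact: st_cmd (cs_rho _ _ _).
  split=> [u|_ [_ -> ->]]; first by rewrite inE => /eqP ->; eexists.
  by eexists; [exact: mem_head|exact: req_refl].
- by eexists; [exact: st_inlam hs|apply: lists_map => //; constructor].
- have [T2 h1 h2] := isctx_mu b hs; exists T2 => //.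
  have [h3 h4] : lists [seq RMu b u | u <- T] (fun w => exists2 u, T' u & w = RMu b u).
    by apply: lists_map => //; constructor.
  by split=> [u /h3|u] /h2 // /h4.
- eexists; [exact: st_fun hs|apply: (@lists_map (fun u => RApp u B)) => // u v e].
  by apply: req_app_intro => //; exact: peq_req_refl.
- eexists; [exact: st_bag hs|apply: (@lists_map (fun u => RApp t (B1 ++ u :: B2))) => // x y e].
  apply: req_app_intro; first exact: req_refl.
  by apply: peq_mid_intro => //; exact: peq_req_refl.
Qed.

(** Ensures that a term which is not normal for [step] has an [rstep]; the summands of the
    contraction are described by [rstep_step]. *)
Lemma step_rstep :
  (forall t T, step t T -> exists S, rstep t S) /\
  (forall c T, cstep c T -> exists S, rstep (mu c) S).
Proof.
apply: step_cstep_ind => *; repeat match goal with H : exists _, rstep _ _ |- _ => case: H => ? ? end;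
  eexists; rewrite /mu /=;
  solve [exact: rstep_lam | exact: rstep_mu | exact: rstep_rho | apply: rstep_inlam; eassumption
    | eassumption | apply: rstep_infun; eassumption | apply: rstep_inbag; eassumption
    | apply: rstep_inmu; eassumption].
Qed.

(** * Normalisation of sums *)

Lemma smem_in s S : smem s S <-> exists2 s', s' \in S & req s s'.
Proof. by split=> -[s' /In_mem h e]; exists s'. Qed.

Lemma smem_cat s S S' : smem s (S ++ S') <-> smem s S \/ smem s S'.
Proof.
split=> [/smem_in[x]|[] /smem_in[x h e]].
- by rewrite mem_cat => /orP[] h e; [left|right]; apply/smem_in; exists x.
- by apply/smem_in; exists x => //; rewrite mem_cat h.
- by apply/smem_in; exists x => //; rewrite mem_cat h orbT.
Qed.

Lemma smem_cons s t S : smem s (t :: S) <-> req s t \/ smem s S.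
Proof.
rewrite -cat1s smem_cat; split=> -[|h]; try by right.
  by move=> /smem_in[x]; rewrite inE => /eqP ->; left.
by left; apply/smem_in; exists t; rewrite ?inE.
Qed.

Lemma smem_req s t S : req s t -> smem t S -> smem s S.
Proof. by move=> e [x h e']; exists x => //; exact: req_trans e e'. Qed.

(** The whole [req]-class of [t] is removed, as [sum_step] demands that the contracted term be
    absent from the rest of the sum. *)
Definition others (t : rterm) (S : rsum) := [seq r <- S | ~~ `[< req t r >]].

Lemma sum_step_others t S T : smem t S -> rstep t T -> sum_step S (T ++ others t S).
Proof.
move=> ht hs; exists t, T, (others t S); split=> //.
  by move=> /smem_in[x]; rewrite mem_filter => /andP[/asboolP].
move=> s; rewrite smem_cons; split.
  move=> /smem_in[x hx e]; case: (pselect (req t x)) => h.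
    by left; apply: req_trans e _; exact: req_sym.
  by right; apply/smem_in; exists x => //; rewrite mem_filter hx andbT; apply/asboolP.
move=> [h|/smem_in[x]]; first exact: smem_req ht.
by rewrite mem_filter => /andP[_ hx] e; apply/smem_in; exists x.
Qed.

Lemma sum_normalP S : sum_normal S <-> forall s, s \in S -> normal s.
Proof.
split=> [h s hs T /step_rstep.1[T' hT']|h S' [t [T [R [hs _ e _]]]]].
  apply: h (sum_step_others _ hT'); apply/smem_in; exists s => //; exact: req_refl.
have /e/smem_in[x hx ex] : smem t (t :: R) by apply/smem_cons; left; exact: req_refl.
have [T' hs' _] := rstep_step hs.
exact: (normal_req (h _ hx) (req_sym ex)) hs'.
Qed.

(** Contract a non-normal element whose measure attains the current bound [k]: its class disappears
    and its reducts have smaller measure. The induction is on the bound, then on the number of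
    non-normal elements that attain it. *)
Lemma sum_normalizes S : exists2 S', clos_refl_trans rsum sum_step S S' & sum_normal S'.
Proof.
pose N := \max_(s <- S) nmu s.
have : forall s, s \in S -> nmu s <= N by move=> s hs; exact: leq_bigmax_seq hs _.
pose n := (\max_(s <- S) msr N s).+1.
have : forall s, s \in S -> ~ normal s -> msr N s < n.
  by move=> s hs _; rewrite ltnS; exact: leq_bigmax_seq hs _.
move: n => k; move: N => N.
elim: k S => [|k IHk] S hk hN.
  exists S; first exact: rt_refl.
  by apply/sum_normalP => s hs; apply: contrapT => /(hk _ hs).
pose top s := `[< ~ normal s >] && (msr N s == k).
have [m] := ubnP (count top S); elim: m S hk hN => // m IHm S hk hN lt.
case: (pselect (exists2 t, t \in S & top t)) => [[t tS /andP[/asboolP nt /eqP et]]|no].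
  have [T hT] : exists T, step t T by case: (normal_or_step t).
  have [T0 hs] := step_rstep.1 _ _ hT; have [T' hT' [h1 _]] := rstep_step hs.
  have hlt s : s \in T0 -> msr N s < k /\ nmu s <= N.
    by move=> /h1 hs'; rewrite -et; apply: step_msr hT' hs' _; exact: hN.
  have [||| S' h2 h3] := IHm (T0 ++ others t S).
  - move=> s; rewrite mem_cat => /orP[/hlt[h _] _|]; first exact: ltnW.
    by rewrite mem_filter => /andP[_]; exact: hk.
  - move=> s; rewrite mem_cat => /orP[/hlt[_ h]|] //.
    by rewrite mem_filter => /andP[_]; exact: hN.
  - rewrite count_cat (_ : count top T0 = 0); last first.
      apply/eqP; rewrite -leqn0 leqNgt -has_count; apply/hasPn => s /hlt[h _].
      by rewrite /top; apply/negP => /andP[_ /eqP es]; rewrite es ltnn in h.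
    rewrite add0n -ltnS; apply: leq_trans lt.
    rewrite /others count_filter; set q := fun r => ~~ _.
    have E l : count top l = count (predI top q) l + count (predI top (predC q)) l.
      by elim: l => //= x l ->; case: (top x); case: (q x) => /=; lia.
    have : 0 < count (predI top (predC q)) S.
      rewrite -has_count; apply/hasP; exists t => //=.
      rewrite /top et eqxx andbT /q negbK; apply/andP; split; apply/asboolP => //.
      exact: req_refl.
    by rewrite (E S) -ltnS; lia.
  exists S' => //; apply: rt_trans h2; apply: rt_step; apply: sum_step_others => //.
  by apply/smem_in; exists t => //; exact: req_refl.
apply: IHk => // s hs ns; have := hk _ hs ns; rewrite ltnS leq_eqVlt => /orP[/eqP e|//].
by case: no; exists s => //; rewrite /top e eqxx andbT; apply/asboolP.
Qed.

(** * Taylor expansion *)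

Lemma sum_step_reach t S S' : sum_step S S' ->
  (forall s, smem s S -> exists2 u, red t u & req s u) ->
  (forall s, smem s S' -> exists2 u, red t u & req s u).
Proof.
move=> [t0 [T [R [hs _ e e']]]] h s /e'/smem_cat[/smem_in[x hx ex]|hR].
  have /e/h[u0 r0 e0] : smem t0 (t0 :: R) by apply/smem_cons; left; exact: req_refl.
  have [T' hs' [h1 _]] := rstep_step hs.
  have [u r1 e1] := red_req (red1 hs' (h1 _ hx)) e0.
  by exists u; [exact: red_trans r0 r1|exact: req_trans ex e1].
by apply: h; apply/e/smem_cons; right.
Qed.

Lemma sum_step_Nf u S S' : sum_step S S' ->
  (exists2 s, smem s S & Nf s u) -> exists2 s, smem s S' & Nf s u.
Proof.
move=> [t0 [T [R [hs _ e e']]]] [s /e/smem_cons[es|hR] hu].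
  have [T1 hs1 [_ h1]] := rstep_step hs.
  have [T2 hs2 [_ h2]] := step_req.1 _ _ hs1 _ (req_sym es).
  have [v2 hv2 nv2] := Nf_step hs2 hu.
  have [v1 /h1[v hv ev] ev1] := h2 _ hv2.
  exists v2 => //; apply/e'/smem_cat; left; apply/smem_in; exists v => //.
  by apply: req_trans ev; exact: req_sym.
by exists s => //; apply/e'/smem_cat; right.
Qed.

(** Elements of a reduct of [t] are reachable from [t] ([sum_step_reach]), so those of a normal sum
    are normal forms of [t]. Conversely each step of sums preserves the presence of an element that
    has [u] as a normal form ([sum_step_Nf]), and in a normal sum that element is [u] itself, up to
    [req]. *)
Lemma nfP t s : nf t s <-> exists2 u, Nf t u & req s u.
Proof.
split.
  move=> [S [hr hn hs]].
  have : forall s, smem s S -> exists2 u, red t u & req s u.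
    have : forall s, smem s [:: t] -> exists2 u, red t u & req s u.
      move=> x /smem_in[y]; rewrite inE => /eqP -> e; exists t => //; exact: red_refl.
    elim: hr {hs hn} => [S1 S2 h|//|S1 S2 S3 _ IH1 _ IH2 h]; first exact: sum_step_reach h.
    exact/IH2/IH1.
  move=> /(_ _ hs)[u r e]; exists u => //; split=> //.
  have /smem_in[x hx ex] := hs; have nx := (sum_normalP S).1 hn x hx.
  by apply: normal_req (normal_req nx (req_sym ex)) e.
move=> [u hu e]; have [S hr hn] := sum_normalizes [:: t].
exists S; split=> //.
have [x hx nx] : exists2 s, smem s S & Nf s u.
  have : exists2 s, smem s [:: t] & Nf s u.
    by exists t => //; apply/smem_in; exists t; [exact: mem_head|exact: req_refl].
  elim: hr {hn} => [S1 S2 h|//|S1 S2 S3 _ IH1 _ IH2 h]; first exact: sum_step_Nf h.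
  exact/IH2/IH1.
apply: smem_req e _; have /smem_in[y hy ey] := hx.
have nnx : normal x by apply: normal_req (req_sym ey); exact: (sum_normalP S).1 hn y hy.
by rewrite (Nf_normal_eq nnx nx).
Qed.

Lemma Forall_mem (U : eqType) (P : U -> Prop) l : List.Forall P l <-> forall x, x \in l -> P x.
Proof.
by rewrite List.Forall_forall; split=> h x hx; apply: h; apply/In_mem.
Qed.

Lemma taylor_coh M t t' : taylor M t -> taylor M t' -> coh t t'.
Proof.
elim: M t t' => [x|M IH|M IHM N IHN|b M IH] t t' /=.
- by move=> -> ->; constructor.
- by move=> [u hu <-] [u' hu' <-]; constructor; exact: IH.
- move=> [u [B [hu /Forall_mem hB ->]]] [u' [B' [hu' /Forall_mem hB' ->]]].
  constructor; first exact: IHM.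
  have h v : v \in B ++ B' -> taylor N v by rewrite mem_cat => /orP[/hB|/hB'].
  by move=> v v' /h hv /h hv'; exact: IHN.
- by move=> [u hu <-] [u' hu' <-]; constructor; exact: IH.
Qed.

Lemma Forall_exists_map (U V : eqType) (P : V -> Prop) (Q : U -> Prop) (f : V -> U) l :
  (forall x, Q x -> exists2 y, P y & x = f y) -> List.Forall Q l ->
  exists2 m, List.Forall P m & l = map f m.
Proof.
move=> h; elim: l => [|x l IH] hl; first by exists [::].
inversion hl as [|? ? hx hl']; subst; have [y hy ->] := h _ hx; have [m hm ->] := IH hl'.
by exists (y :: m) => //; constructor.
Qed.

Lemma taylor_ren f g M t : taylor (ren f g M) t <-> exists2 t0, taylor M t0 & t = rren f g t0.
Proof.
elim: M f g t => [x|M IH|M IHM N IHN|b M IH] f g t /=.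
- by split=> [->|[_ -> ->]] //; exists (RVar x).
- split=> [[u /IH[u0 hu ->] <-]|[_ [u hu <-] ->]]; first by exists (RLam u0) => //; exists u0.
  by exists (rren (up f) g u) => //; apply/IH; exists u.
- split.
    move=> [u [B [/IHM[u0 hu ->] hB ->]]].
    have [B0 hB0 ->] := Forall_exists_map (fun x => (IHN f g x).1) hB.
    by exists (RApp u0 B0) => //; exists u0, B0.
  move=> [_ [u [B [hu hB ->]]] ->]; exists (rren f g u), (map (rren f g) B); split=> //.
    by apply/IHM; exists u.
  apply/Forall_mem => _ /mapP[v hv ->]; apply/IHN; exists v => //.
  by move/Forall_mem: hB; exact.
- split=> [[u /IH[u0 hu ->] <-]|[_ [u hu <-] ->]]; first by exists (RMu b u0) => //; exists u0.
  by exists (rren f (up g) u) => //; apply/IH; exists u.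
Qed.

Lemma NFTP M s : NFT M s <-> exists t u, [/\ taylor M t, Nf t u & req s u].
Proof.
split=> [[t ht /nfP[u hu e]]|[t [u [ht hu e]]]]; first by exists t, u.
by exists t => //; apply/nfP; exists u.
Qed.

Lemma NFT_req M s s' : NFT M s -> req s s' -> NFT M s'.
Proof.
move=> /NFTP[t [u [ht hu e]]] e'; apply/NFTP; exists t, u; split=> //.
by apply: req_trans e; exact: req_sym.
Qed.

Lemma NFT_coh M p q : NFT M p -> NFT M q -> coh p q.
Proof.
move=> /NFTP[t [u [ht hu e]]] /NFTP[t' [u' [ht' hu' e']]].
by apply: coh_req (Nf_coh (taylor_coh ht ht') hu hu').1 _ _; exact: req_sym.
Qed.

Lemma cov_rren f g t P : cov t P -> cov (rren f g t) (fun w => exists2 u, P u & w = rren f g u).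
Proof.
elim=> {t} [t h|t T hs _ IH]; first by apply: cov_here; exists t.
by apply: cov_bind (step_stable hs f g).1 _ => _ [v hv ->]; exact: IH.
Qed.

Lemma red_rren f g t u : red t u -> red (rren f g t) (rren f g u).
Proof.
elim=> {t u} [t|t T v u hs hv _ IH]; first exact: red_refl.
exact: red_trans ((step_stable hs f g).2 _ hv) IH.
Qed.

(** Redexes are patterns of constructors, which a renaming leaves in place, so it creates none. *)
Lemma step_rrenP f g t T : step (rren f g t) T -> exists T', step t T'.
Proof.
elim/rterm_ind_in: t f g T => [x|t IH|t vs IH IHvs|b t IH] f g T /=.
- by move=> h; inversion h.
- by move=> /step_lamP[T0 /IH[T' h] _]; eexists; exact: st_inlam h.
- move=> /step_appP[[t0 [E _]]|[b [t0 [E _]]]|[T0 /IH[T' h] _]|[B1 [v [V [B2 [E hv _]]]]]].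
  + by case: t E {IH} => // t1 _; eexists; exact: st_lam.
  + by case: t E {IH} => // b1 t1 _; eexists; exact: st_mu.
  + by eexists; exact: st_fun h.
  + have : v \in map (rren f g) vs by rewrite E mem_cat inE eqxx orbT.
    move=> /mapP[x hx Ex]; rewrite Ex in hv; have [V' h] := IHvs _ hx _ _ _ hv.
    by case/splitPr: hx => A1 A2; eexists; exact: st_bag h.
- move=> /step_muP[T0 /cstepP[[e [t0 [E _]]]|[T1 /IH[T' h] _]] _].
    by case: t E {IH} => // e1 t1 _; eexists; apply: st_cmd; exact: cs_rho.
  by eexists; apply: st_cmd; exact: cs_in h.
Qed.

Lemma normal_rren f g t : normal t -> normal (rren f g t).
Proof. by move=> h T /step_rrenP[T' /h]. Qed.

Lemma NFT_ren f g M s : NFT (ren f g M) s <-> exists2 p, NFT M p & req s (rren f g p).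
Proof.
split.
  move=> /NFTP[_ [u [/taylor_ren[t ht ->] hu e]]].
  have [_ [p hp ->] hu'] := Nf_cov (cov_rren f g (cov_Nf t)) hu.
  exists p; first by apply/NFTP; exists t, p; split=> //; exact: req_refl.
  by rewrite -(Nf_normal_eq (normal_rren hp.2) hu').
move=> [p /NFTP[t [u [ht [r n] e]]] es]; apply/NFTP; exists (rren f g t), (rren f g u); split.
- by apply/taylor_ren; exists t.
- by split; [exact: red_rren|exact: normal_rren].
- by apply: req_trans es _; exact: req_rren.
Qed.

Lemma NFT_lam M s : NFT (Lam M) s <-> exists2 p, NFT M p & req s (RLam p).
Proof.
split.
  move=> /NFTP[_ [u [[t ht <-] /Nf_lamP[p hp ->] e]]]; exists p => //.
  by apply/NFTP; exists t, p; split=> //; exact: req_refl.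
move=> [p /NFTP[t [u [ht hu e]]] es]; apply/NFTP; exists (RLam t), (RLam u); split.
- by exists t.
- exact: Nf_lam.
- by apply: req_trans es _; constructor.
Qed.

(** The normal form [p] of the body may begin with a [mu], in which case [rho] still applies at the
    root: hence [Nf] on the right-hand side. *)
Lemma NFT_mu b M s : NFT (Mu b M) s <->
  exists2 p, NFT M p & exists2 u, Nf (RMu b p) u & req s u.
Proof.
split.
  move=> /NFTP[_ [u [[t ht <-] /(Nf_ctxP (isctx_mu b))[p hp hu] e]]].
  exists p; last by exists u.
  by apply/NFTP; exists t, p; split=> //; exact: req_refl.
move=> [p /NFTP[t [p0 [ht hp e]]] [u hu es]].
have [|u0 hu0 e0] := Nf_req (t2 := RMu b p0) hu; first by constructor.
apply/NFTP; exists (RMu b t), u0; split; first by exists t.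
  exact: Nf_ctx (isctx_mu b) hp hu0.
exact: req_trans es e0.
Qed.

Lemma NFT_bag N (B : seq rterm) : List.Forall (NFT N) B ->
  exists TB B0, [/\ List.Forall (taylor N) TB, List.Forall2 Nf TB B0 & List.Forall2 req B B0].
Proof.
elim=> [|b B0 /NFTP[t [u [ht hu e]]] _ [TB [D [h1 h2 h3]]]]; first by exists [::], [::].
by exists (t :: TB), (u :: D); split; constructor.
Qed.

Lemma NFT_app M N s : NFT (App M N) s <-> exists p B,
  [/\ NFT M p, List.Forall (NFT N) B & exists2 u, Nf (RApp p B) u & req s u].
Proof.
split.
  move=> /NFTP[_ [u [[t [B [ht /Forall_mem hB ->]]] /Nf_appP[p [D [hp hD hu]]] e]]].
  exists p, D; split; last by exists u.
    by apply/NFTP; exists t, p; split=> //; exact: req_refl.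
  apply/Forall_mem => v /(Forall2_memr hD)[v0 hv0 hv]; apply/NFTP; exists v0, v; split=> //.
    exact: hB.
  exact: req_refl.
move=> [p [B [/NFTP[t [p0 [ht hp e]]] /NFT_bag[TB [B0 [hTB hB0 eB]]] [u hu es]]]].
have [|u0 hu0 e0] := Nf_req (t2 := RApp p0 B0) hu.
  by apply: req_app_intro => //; exists B0.
apply/NFTP; exists (RApp t TB), u0; split; first by exists t, TB.
  exact: Nf_app hp hB0 hu0.
exact: req_trans es e0.
Qed.

(** * Contexts: monotonicity and preservation of intersections *)

Lemma NFT_fill_mono n (C : ctx n) (M N : 'I_n -> term) :
  (forall i, term_le (M i) (N i)) -> term_le (fill C M) (fill C N).
Proof.
move=> le; elim: C => [x|i|x C IH|C IHC D IHD|a b C IH] s //=.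
- exact: le.
- move=> /NFT_lam[p /NFT_ren[q /IH hq eq] e]; apply/NFT_lam; exists p => //.
  by apply/NFT_ren; exists q.
- move=> /NFT_app[p [B [/IHC hp /Forall_mem hB hu]]]; apply/NFT_app; exists p, B; split=> //.
  by apply/Forall_mem => v /hB /IHD.
- move=> /NFT_mu[p /NFT_ren[q /IH hq eq] e]; apply/NFT_mu; exists p => //.
  by apply/NFT_ren; exists q.
Qed.

Local Open Scope classical_set_scope.

Lemma NFT_fill_glb n (C : ctx n) (X : 'I_n -> set term) (M L N0 : 'I_n -> term) :
  (forall i N, X i N -> term_le N (L i)) -> (forall i, X i (N0 i)) ->
  (forall i s, (forall N, X i N -> NFT N s) -> NFT (M i) s) ->
  forall s, (forall N, (forall i, X i (N i)) -> NFT (fill C N) s) -> NFT (fill C M) s.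
Proof.
move=> XL XN0 glb.
have leL D N : (forall i, X i (N i)) -> term_le (fill D N) (fill D L).
  by move=> XN; apply: NFT_fill_mono => i; exact: XL.
have cohL D N q0 q : (forall i, X i (N i)) ->
    NFT (fill D N0) q0 -> NFT (fill D N) q -> coh q0 q.
  by move=> XN /(leL D N0 XN0) h0 /(leL D N XN) h; exact: NFT_coh h0 h.
elim: C => [x|i|x C IH|C IHC D IHD|a b C IH] s H /=.
- exact: H XN0.
- apply: glb => N XN.
  (* Only hole [i] matters here; the other holes are filled with the fixed elements [N0 j]. *)
  pose N' j := if j == i then N else N0 j.
  have := H N'; rewrite /= /N' eqxx; apply=> j.
  by case: eqP => [->|_].
- have /NFT_lam[p0 /NFT_ren[q0 hq0 eq0] e0] := H _ XN0.
  apply/NFT_lam; exists p0 => //; apply/NFT_ren; exists q0 => //.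
  apply: IH => N XN; have /NFT_lam[p /NFT_ren[q hq eq] e] := H _ XN.
  apply: (NFT_req hq); apply: req_sym.
  (* The hypotheses equate [q0] and [q] after renaming by [abs x]; their coherence, obtained from
     the common bound, removes the renaming. *)
  apply: (req_rren_coh (f := abs x) (g := id)); first exact: cohL hq0 hq.
  have /req_lamP[_ [<-] ep] := req_trans (req_sym e0) e.
  exact: req_trans (req_sym eq0) (req_trans ep eq).
- have /NFT_app[p0 [B0 [hp0 /Forall_mem hB0 [u0 hu0 e0]]]] := H _ XN0.
  have key N : (forall i, X i (N i)) -> NFT (fill C N) p0 /\ forall v, v \in B0 -> NFT (fill D N) v.
    move=> XN; have /NFT_app[p [B [hp /Forall_mem hB [u hu e]]]] := H _ XN.
    (* Coherence of the two applications involves all pairs of arguments, within one bag and across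
       the two, so [B0] and [B] are placed in the same set. *)
    have hD v : v \in B0 ++ B -> NFT (fill D L) v.
      by rewrite mem_cat => /orP[/hB0|/hB]; exact: leL.
    have cA : coh (RApp p0 B0) (RApp p B).
      by constructor; [exact: cohL hp0 hp|move=> v v' /hD hv /hD hv'; exact: NFT_coh hv hv'].
    have := (Nf_coh cA hu0 hu).2 (req_trans (req_sym e0) e).
    move=> /req_appP[_ [_ [[<- <-] ep eB]]]; split; first exact: NFT_req hp (req_sym ep).
    move=> v /(peq_mem (peq_sym eB))[v' hv' ev].
    exact: NFT_req (hB _ hv') (req_sym ev).
  apply/NFT_app; exists p0, B0; split; last by exists u0.
    by apply: IHC => N /key[].
  by apply/Forall_mem => v hv; apply: IHD => N /key[_]; exact.
(* [NFT_ren] yields the renamed body up to [req]. It is replaced by the renaming itself, the form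
   that [coh_rren] and [req_rren_coh] apply to. *)
- have key N : (forall i, X i (N i)) -> NFT (fill (CMu a b C) N) s ->
      exists2 q, NFT (fill C N) q &
        exists2 u, Nf (RMu (abs a b) (rren id (abs a) q)) u & req s u.
    move=> XN /NFT_mu[p /NFT_ren[q hq eq] [u hu e]]; exists q => //.
    have [|u' hu' e'] := Nf_req (t2 := RMu (abs a b) (rren id (abs a) q)) hu; first by constructor.
    by exists u' => //; exact: req_trans e e'.
  have [q0 hq0 [u0 hu0 e0]] := key _ XN0 (H _ XN0).
  apply/NFT_mu; exists (rren id (abs a) q0); last by exists u0.
  apply/NFT_ren; exists q0; last exact: req_refl.
  apply: IH => N XN; have [q hq [u hu e]] := key _ XN (H _ XN).
  have cq := cohL C N _ _ XN hq0 hq.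
  have cM : coh (RMu (abs a b) (rren id (abs a) q0)) (RMu (abs a b) (rren id (abs a) q)).
    by constructor; exact: coh_rren.
  have := (Nf_coh cM hu0 hu).2 (req_trans (req_sym e0) e).
  move=> /req_muP[_ [<-] /(req_rren_coh cq) e1].
  exact: NFT_req hq (req_sym e1).
Qed.

Theorem theorem4p1 (n : nat) (C : ctx n) (X : 'I_n -> set term)
    (X_neq0 : forall i, X i !=set0)
    (X_bounded : forall i, bounded_terms (X i))
    (M : 'I_n -> term)
    (M_glb : forall i, NFT (M i) = \bigcap_(N in X i) NFT N) :
  NFT (fill C M) =
    \bigcap_(N in [set N : 'I_n -> term | forall i, X i (N i)]) NFT (fill C N).
Proof.
(* [N0] supplies the reference decomposition of an element of the intersection, and [L] the single
   bounding family under which all decompositions are coherent. *)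
have [N0 XN0] := choice X_neq0; have [L XL] := choice X_bounded.
apply/seteqP; split=> s.
  move=> hs N /= XN; apply: NFT_fill_mono hs => i t.
  by rewrite M_glb; apply; exact: XN.
move=> hs; apply: (NFT_fill_glb XL XN0) => [i t ht|N XN]; last exact: hs.
by rewrite M_glb => N XN; exact: ht.
Qed.
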